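(* (Pontrjagin duality) Let $H$ be a bornological quantum group. Then the double dual quantum group of $H$, i.e. the dual quantum group $\hat{\hat H}$ of the dual quantum group $\hat H$ of $H$, is canonically isomorphic to $H$ (as a bornological quantum group).
   Context: Conventions. Vector spaces are complex. A bornological vector space is a vector space with a convex bornology, whose members are called small sets; it is always assumed complete (every small set lies in a small disk $T$ whose linear span $\langle T\rangle$ is a Banach space for the Minkowski gauge of $T$). $\mathrm{Hom}(V,W)$ is the space of bounded linear maps (those mapping small sets to small sets) with the equibounded bornology; all linear maps considered are bounded and isomorphisms are bounded with bounded inverse. $\hat\otimes$ is the completed bornological tensor product (universal for bounded bilinear maps) and $\tau$ is the flip. $V$ has the approximation property if for each compact disk $S\subset V$ (i.e. compact in some Banach space $\langle T\rangle$, $T$ a small disk) there is a sequence of bounded finite rank operators $f_n:V\to V$ with $f_n\to\mathrm{id}$ in $\mathrm{Hom}(\langle S\rangle,V)$. A bornological algebra is a bornological vector space $H$ with a bounded associative multiplication $\mu:H\hat\otimes H\to H$ (no unit required). For a right $H$-module $M$ and a left $H$-module $V$, $M\hat\otimes_H V$ is the quotient of $M\hat\otimes V$ by the closure of the span of all $mh\otimes v-m\otimes hv$. A left $H$-module $V$ is essential if the action induces an isomorphism $H\hat\otimes_H V\cong V$ (similarly for right modules); $H$ is essential if it is nonzero and $\mu$ induces an isomorphism $H\hat\otimes_H H\cong H$. The multiplier algebra $M(H)$ consists of pairs $(L,R)$ of bounded linear maps $H\to H$ with $L(fg)=L(f)g$, $R(fg)=fR(g)$, $fL(g)=R(f)g$,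 with the bornology and multiplication inherited from left and right multipliers. A homomorphism $f:H\to M(K)$ is essential if it turns $K$ into an essential left and right $H$-module; for essential $K$ it extends uniquely to a unital homomorphism $M(H)\to M(K)$, denoted by the same letter. A bounded functional $\omega$ on $H$ is faithful if ($\omega(fg)=0$ for all $g$) implies $f=0$ and ($\omega(fg)=0$ for all $f$) implies $g=0$. Bornological quantum groups. Let $H$ be an essential bornological algebra with the approximation property and a faithful bounded functional; then $H\subset M(H)$, and similarly for tensor powers. A comultiplication is an essential homomorphism $\Delta:H\to M(H\hat\otimes H)$ with $(\Delta\hat\otimes\mathrm{id})\Delta=(\mathrm{id}\hat\otimes\Delta)\Delta$. Its Galois maps $H\hat\otimes H\to M(H\hat\otimes H)$ are $\gamma_l(f\otimes g)=\Delta(f)(g\otimes 1)$, $\gamma_r(f\otimes g)=\Delta(f)(1\otimes g)$, $\rho_l(f\otimes g)=(f\otimes 1)\Delta(g)$, $\rho_r(f\otimes g)=(1\otimes f)\Delta(g)$. If these are bounded maps into $H\hat\otimes H$, then for a bounded functional $\omega$ the multiplier $(\mathrm{id}\hat\otimes\omega)\Delta(f)\in M(H)$ is defined by $(\mathrm{id}\hat\otimes\omega)\Delta(f)\cdot g=(\mathrm{id}\hat\otimes\omega)\gamma_l(f\otimes g)$, $g\cdot(\mathrm{id}\hat\otimes\omega)\Delta(f)=(\mathrm{id}\hat\otimes\omega)\rho_l(g\otimes f)$, and $(\omega\hat\otimes\mathrm{id})\Delta(f)\in M(H)$ by $(\omega\hat\otimes\mathrm{id})\Delta(f)\cdot g=(\omega\hat\otimes\mathrm{id})\gamma_r(f\otimes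 g)$, $g\cdot(\omega\hat\otimes\mathrm{id})\Delta(f)=(\omega\hat\otimes\mathrm{id})\rho_r(g\otimes f)$. A bounded functional $\phi$ is left invariant if $(\mathrm{id}\hat\otimes\phi)\Delta(f)=\phi(f)1$ for all $f$, and $\psi$ is right invariant if $(\psi\hat\otimes\mathrm{id})\Delta(f)=\psi(f)1$ for all $f$. A bornological quantum group is an essential bornological algebra with the approximation property together with a comultiplication all of whose four Galois maps are isomorphisms of $H\hat\otimes H$ onto itself, and a faithful left invariant functional $\phi$. It has a unique counit (essential homomorphism $\epsilon:H\to\mathbb{C}$ with $(\epsilon\hat\otimes\mathrm{id})\Delta=\mathrm{id}=(\mathrm{id}\hat\otimes\epsilon)\Delta$) and antipode (an isomorphism $S:H\to H$, antimultiplicative and anticomultiplicative, with $\mu(S\hat\otimes\mathrm{id})\gamma_r=\epsilon\hat\otimes\mathrm{id}$, $\mu(\mathrm{id}\hat\otimes S)\rho_l=\mathrm{id}\hat\otimes\epsilon$). An isomorphism of bornological quantum groups is an isomorphism of bornological algebras compatible with the comultiplications. The dual. Let $\phi$ be a faithful left invariant functional and $\psi$ a faithful right invariant functional on $H$ (e.g. $\psi=\phi\circ S$). Define maps $H\to H'=\mathrm{Hom}(H,\mathbb{C})$ by $\mathcal{F}_l(f)(h)=\phi(hf)$, $\mathcal{F}_r(f)(h)=\phi(fh)$, $\mathcal{G}_l(f)(h)=\psi(hf)$, $\mathcal{G}_r(f)(h)=\psi(fh)$. These are injective and have the same image $\hat H\subset H'$; $\hat H$ carries the bornology transported from $H$ along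 any of them (all give the same bornology). The product of $\hat H$ is $\hat\mu(\mathcal{F}_l(f)\otimes\mathcal{F}_l(g))=\mathcal{F}_l((\mathrm{id}\hat\otimes\phi)\gamma_l^{-1}(f\otimes g))$. The comultiplication $\hat\Delta:\hat H\to M(\hat H\hat\otimes\hat H)$ is the unique one whose Galois maps $\hat\gamma_r,\hat\rho_l$ are $\hat\gamma_r(\mathcal{F}_l(f)\otimes\mathcal{F}_l(g))=(\mathcal{F}_l\hat\otimes\mathcal{F}_l)\tau\gamma_l^{-1}(f\otimes g)$ and $\hat\rho_l(\mathcal{G}_r(g)\otimes\mathcal{G}_r(f))=(\mathcal{G}_r\hat\otimes\mathcal{G}_r)\tau\rho_r^{-1}(g\otimes f)$. With the faithful left invariant functional $\hat\phi(\mathcal{G}_r(f))=\epsilon(f)$, $\hat H$ is a bornological quantum group, called the dual quantum group of $H$; $\hat\psi(\mathcal{F}_l(f))=\epsilon(f)$ is a faithful right invariant functional on it. *)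

(* Defs.v *)
From HB Require Import structures.
From mathcomp Require Import all_boot all_order all_algebra.
From mathcomp Require Import complex.
From mathcomp Require Import mathcomp_extra boolp classical_sets functions.
From mathcomp Require Import reals topology normedtype.

Set Implicit Arguments.
Unset Strict Implicit.
Unset Printing Implicit Defensive.

Import Order.TTheory GRing.Theory Num.Theory.
Import numFieldNormedType.Exports.
Local Open Scope classical_set_scope.
Local Open Scope ring_scope.
Local Open Scope complex_scope.

Section Gauge.
Context {R : realType} {V : lmodType R[i]}.
Implicit Types (T S : set V) (u v x y : V).

Definition lspan T : set V := [set v | exists n (c : 'I_n -> R[i]) (a : 'I_n -> V),
  (forall i, T (a i)) /\ v = \sum_(i < n) c i *: a i].

(* Disks are the nonempty absolutely convex sets. *)
Definition disk T := T !=set0 /\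
  forall x y (a b : R[i]), T x -> T y -> `|a| + `|b| <= 1 -> T (a *: x + b *: y).

(* The Minkowski gauge; meaningful on <T> = lspan T only (inf set0 = 0). *)
Definition gauge T v : R :=
  inf [set r : R | 0 < r /\ exists2 t, T t & v = r%:C *: t].

Definition gauge_cvg T (u : nat -> V) l := forall e : R, 0 < e ->
  exists N, forall n, (N <= n)%N -> lspan T (u n - l) /\ gauge T (u n - l) < e.

Definition gauge_cauchy T (u : nat -> V) := forall e : R, 0 < e ->
  exists N, forall m n, (N <= m)%N -> (N <= n)%N -> gauge T (u m - u n) < e.

Definition banach_disk T := [/\ disk T,
  forall v, lspan T v -> gauge T v = 0 -> v = 0 &
  forall u : nat -> V, (forall n, lspan T (u n)) -> gauge_cauchy T u ->
    exists2 l, lspan T l & gauge_cvg T u l].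

(* v \in r T. *)
Definition dil T (r : R) v := exists2 t, T t & v = r%:C *: t.

Lemma disk0 T : disk T -> T 0.
Proof.
move=> [[x Tx] dT]; have := dT x x 0 0 Tx Tx.
by rewrite !scale0r addr0 normr0 addr0; apply; exact: ler01.
Qed.

Lemma ltC0 (r : R) : (0 < r%:C) = (0 < r).
Proof. exact: (ltcR 0 r). Qed.

Lemma leC1 (r : R) : (r%:C <= 1) = (r <= 1).
Proof. exact: (lecR r 1). Qed.

Lemma normCr (r : R) : 0 <= r -> `|r%:C| = r%:C.
Proof. by move=> r0; rewrite ger0_norm // (lecR 0). Qed.

Lemma diskZ T (a : R[i]) x : disk T -> T x -> `|a| <= 1 -> T (a *: x).
Proof.
move=> dT Tx a1; have := dT.2 x x a 0 Tx Tx.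
by rewrite scale0r addr0 normr0 addr0; apply.
Qed.

Lemma dilS T r s v : disk T -> 0 < s -> r <= s -> 0 <= r -> dil T r v -> dil T s v.
Proof.
move=> dT s0 rs r0 [t Tt ->]; exists ((r / s)%:C *: t).
  apply: diskZ => //; rewrite normCr ?divr_ge0 ?(ltW s0)//.
  by rewrite leC1 ler_pdivrMr // mul1r.
by rewrite scalerA -rmorphM /= mulrC divfK // gt_eqF.
Qed.

Lemma dilZ T r (a : R[i]) (s : R) v : disk T -> 0 < s -> `|a| <= s%:C ->
  dil T r v -> dil T (s * r) (a *: v).
Proof.
move=> dT s0 as_ [t Tt ->]; exists ((a / s%:C) *: t).
  apply: diskZ => //; rewrite normf_div normCr ?(ltW s0)//.
  by rewrite ler_pdivrMr ?ltC0 // mul1r.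
rewrite !scalerA rmorphM /=; congr (_ *: _).
have sn0 : s%:C != 0 by rewrite gt_eqF // ltC0.
by rewrite [RHS]mulrC -mulrA mulKf.
Qed.

Lemma dilD T r s u v : disk T -> 0 < r -> 0 < s ->
  dil T r u -> dil T s v -> dil T (r + s) (u + v).
Proof.
move=> dT r0 s0 [x Tx ->] [y Ty ->].
have rs : 0 < r + s by rewrite addr_gt0.
exists ((r / (r + s))%:C *: x + (s / (r + s))%:C *: y).
  apply: dT.2 => //; rewrite !normCr ?divr_ge0 ?(ltW r0) ?(ltW s0) ?(ltW rs)//.
  by rewrite -rmorphD /= leC1 -mulrDl divff // gt_eqF.
rewrite scalerDr !scalerA -!rmorphM /=.
by congr (_%:C *: _ + _%:C *: _); rewrite mulrC divfK // gt_eqF.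
Qed.

Lemma dilN T r u : disk T -> dil T r u -> dil T r (- u).
Proof.
move=> dT [x Tx ->]; exists (-1 *: x); last by rewrite scaleN1r scalerN.
by apply: diskZ => //; rewrite normrN normr1.
Qed.

Lemma normC_bound (a : R[i]) : exists2 s : R, 0 < s & `|a| <= s%:C.
Proof.
have Ex := normc_def a; set x := Num.sqrt _ in Ex.
have x0 : 0 <= x by exact: sqrtr_ge0.
by exists (x + 1); [exact: ltr_wpDl | rewrite Ex lecR lerDl].
Qed.

Lemma lspan_dil T v : disk T -> lspan T v <-> exists2 r, 0 < r & dil T r v.
Proof.
move=> dT; split; last first.
  move=> [r _ [t Tt ->]]; exists 1%N, (fun=> r%:C), (fun=> t).
  by split => //; rewrite big_ord1.
move=> [n [c [a [Ta ->]]]].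
elim/big_rec: _ => [|i x _ [r r0 xr]].
  by exists 1 => //; exists 0; [exact: disk0 | rewrite scaler0].
have [s s0 cs] := normC_bound (c i).
exists (s * 1 + r); first by rewrite mulr1 addr_gt0.
apply: dilD => //; first by rewrite mulr1.
apply: dilZ => //; exists (a i) => //.
by rewrite scale1r.
Qed.

Lemma gauge_dil T v r : 0 < r -> dil T r v -> gauge T v <= r.
Proof.
move=> r0 vr; apply: ge_inf; first by exists 0 => x [/ltW].
by split => //; case: vr => t Tt ->; exists t.
Qed.

Lemma dil_gauge T v r : disk T -> lspan T v -> gauge T v < r -> dil T r v.
Proof.
move=> dT /(lspan_dil _ dT)[s s0 vs] vr.
have Sn0 : [set r : R | 0 < r /\ exists2 t, T t & v = r%:C *: t] !=set0.
  by exists s; split => //; case: vs => t ? ->; exists t.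
have [x [x0 vx] xr] := inf_lt Sn0 vr.
by apply: (@dilS _ x) => //; rewrite ?(ltW x0) ?(ltW xr)//; exact: lt_trans xr.
Qed.

Lemma lspanB T x y : disk T -> lspan T x -> lspan T y -> lspan T (x - y).
Proof.
move=> dT /(lspan_dil _ dT)[r r0 xr] /(lspan_dil _ dT)[s s0 ys].
apply/lspan_dil => //; exists (r + s); first exact: addr_gt0.
by apply: dilD => //; exact: dilN.
Qed.

(* Membership form of completeness: gauge T v < e versus v \in e T. *)
Lemma banach_diskI T : disk T ->
  (forall v, (forall e, 0 < e -> dil T e v) -> v = 0) ->
  (forall u : nat -> V,
    (forall e, 0 < e -> exists N, forall m n, (N <= m)%N -> (N <= n)%N ->
      dil T e (u m - u n)) ->
    exists l, forall e, 0 < e -> exists N, forall n, (N <= n)%N -> dil T e (u n - l)) ->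
  banach_disk T.
Proof.
move=> dT sep cpl; split => //.
  move=> v Tv v0; apply: sep => e e0; apply: dil_gauge => //.
  by rewrite v0.
move=> u Tu uC; have [|l ul] := cpl u.
  move=> e e0; have [N HN] := uC e e0; exists N => m n Nm Nn.
  by apply: dil_gauge => //; [exact: lspanB | exact: HN].
have lT n e : 0 < e -> dil T e (u n - l) -> lspan T (u n - l).
  by move=> e0 h; apply/lspan_dil => //; exists e.
exists l.
  have [N /(_ N (leqnn _)) HN] := ul 1 ltr01.
  have -> : l = u N - (u N - l) by rewrite opprB addrC subrK.
  by apply: lspanB => //; exact: lT HN.
move=> e e0; have e20 : 0 < e / 2 by rewrite divr_gt0.
have [N HN] := ul _ e20; exists N => n /HN h; split; first exact: lT h.
apply: le_lt_trans (gauge_dil _ h) _ => //.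
by rewrite ltr_pdivrMr // mulr_natr mulr2n ltrDl.
Qed.

Lemma banach_sep T v : banach_disk T -> (forall e, 0 < e -> dil T e v) -> v = 0.
Proof.
move=> [dT sep _] h; apply: sep; first by apply/lspan_dil => //; exists 1 => //; exact: h.
apply/eqP; rewrite eq_le; apply/andP; split.
  by apply/ler_addgt0Pr => e e0; rewrite add0r; apply: gauge_dil => //; exact: h.
apply: lb_le_inf; last by move=> x [/ltW].
by exists 1; split => //; case: (h _ ltr01) => t Tt ->; exists t.
Qed.

Lemma banach_lim T (u : nat -> V) : banach_disk T ->
  (forall e, 0 < e -> exists N, forall m n, (N <= m)%N -> (N <= n)%N ->
    dil T e (u m - u n)) ->
  exists l, forall e, 0 < e -> exists N, forall n, (N <= n)%N -> dil T e (u n - l).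
Proof.
move=> [dT _ cpl] uC.
have [N0 HN0] := uC 1 ltr01.
pose w n := u (n + N0)%N - u N0.
have [|e e0|l Tl wl] := cpl w.
- move=> n; apply/lspan_dil => //; exists 1 => //.
  by apply: HN0 => //; exact: leq_addl.
- have e20 : 0 < e / 2 by rewrite divr_gt0.
  have [N HN] := uC _ e20; exists N => m n Nm Nn.
  have -> : w m - w n = u (m + N0)%N - u (n + N0)%N.
    by rewrite /w opprB addrA subrK.
  apply: le_lt_trans (gauge_dil e20 (HN _ _ _ _)) _.
  + exact: leq_trans Nm (leq_addr _ _).
  + exact: leq_trans Nn (leq_addr _ _).
  + by rewrite ltr_pdivrMr // mulr_natr mulr2n ltrDl.
exists (l + u N0) => e e0; have [N HN] := wl e e0.
exists (N + N0)%N => n NN0.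
have nN : (N <= n - N0)%N by rewrite leq_subRL ?(leq_trans _ NN0) ?leq_addl // addnC.
have [h1 h2] := HN _ nN.
have -> : u n - (l + u N0) = w (n - N0)%N - l.
  by rewrite /w subnK ?(leq_trans _ NN0) ?leq_addl // opprD addrCA addrC addrAC -addrA.
exact: dil_gauge.
Qed.

End Gauge.

HB.mixin Record isBornological (R : realType) V of GRing.Lmodule R[i] V := {
  small : set (set V);
  small1 : forall v : V, small [set v];
  small_sub : forall A B : set V, A `<=` B -> small B -> small A;
  smallU : forall A B : set V, small A -> small B -> small (A `|` B);
  smallD : forall A B : set V, small A -> small B ->
    small [set a + b | a in A & b in B];
  smallZ : forall (r : R) (A : set V), small A ->
    small [set z *: a | z in [set z : R[i] | `|z| <= r%:C] & a in A];
  small_complete : forall A : set V, small A ->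
    exists T, [/\ small T, banach_disk T & A `<=` T]
}.

#[short(type="bornType")]
HB.structure Definition Bornological (R : realType) :=
  {V of isBornological R V & GRing.Lmodule R[i] V}.

Arguments small_sub {R s} [A B].
Arguments smallU {R s} [A B].
Arguments smallD {R s} [A B].
Arguments smallZ {R s} r [A].
Arguments small_complete {R s} [A].

Section Scalars.
Context {R : realType}.
Local Notation C := (R[i]^o).

Definition bounded_scalars (A : set C) :=
  exists r : R, forall z : R[i], A z -> `|z| <= r%:C.

Definition cball (r : R) : set C := [set z | `|z : R[i]| <= r%:C].

Lemma realCM (a b : R) : (a * b)%:C = a%:C * b%:C.
Proof. exact: rmorphM. Qed.

Lemma cball_disk r : 0 < r -> disk (cball r).
Proof.
move=> r0; split; first by exists 0; rewrite /cball /= normr0 (lecR 0) ltW.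
move=> x y a b xr yr ab; rewrite /cball /=.
apply: (@le_trans _ _ ((`|a| + `|b|) * r%:C)); last first.
  by rewrite ler_piMl // (lecR 0) ltW.
rewrite mulrDl; apply: le_trans (ler_normD _ _) _.
by apply: lerD; rewrite normrM; apply: ler_wpM2l.
Qed.

Lemma normC_ReIm (z : R[i]) (e : R) : `|z| <= e%:C ->
  `|complex.Re z| <= e /\ `|complex.Im z| <= e.
Proof.
move=> ze; split; rewrite -lecR; apply: le_trans ze; first exact: normc_ge_Re.
by case: z => a b; rewrite normc_def /= lecR -sqrtr_sqr ler_wsqrtr // lerDr sqr_ge0.
Qed.

Lemma real_cauchy_lim (u : nat -> R) :
  (forall e, 0 < e -> exists N, forall m n, (N <= m)%N -> (N <= n)%N ->
     `|u m - u n| <= e) ->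
  exists l, forall e, 0 < e -> exists N, forall n, (N <= n)%N -> `|u n - l| <= e.
Proof.
move=> uC.
have /cauchy_cvgP/cvg_ex[l ul] : cauchy (u @ \oo).
  apply: cauchy_exP => e e0; have e20 : 0 < e / 2 by rewrite divr_gt0.
  have [N HN] := uC _ e20; exists (u N); exists N => // n /= Nn.
  rewrite /ball /=; apply: le_lt_trans (HN _ _ _ Nn) _ => //.
  by rewrite ltr_pdivrMr // mulr_natr mulr2n ltrDl.
exists l => e e0; have /cvgrPdist_le /(_ e e0)[N _ HN] := ul.
by exists N => n Nn; rewrite distrC; exact: HN.
Qed.

Lemma cball_banach r : 0 < r -> banach_disk (cball r).
Proof.
move=> r0.
have dilE e (z : C) : 0 < e -> dil (cball r) e z <-> `|z : R[i]| <= (e * r)%:C.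
  move=> e0; split=> [[t tr ->]|zer].
    rewrite normrM normCr ?(ltW e0) // realCM.
    by apply: ler_wpM2l; [rewrite (lecR 0) ltW | exact: tr].
  exists (e^-1%:C *: z).
    rewrite /cball /= normrM normCr ?invr_ge0 ?(ltW e0) //.
    have -> : r%:C = e^-1%:C * (e * r)%:C by rewrite -realCM mulKf // gt_eqF.
    by apply: ler_wpM2l => //; rewrite (lecR 0) invr_ge0 ltW.
  by rewrite scalerA -rmorphM /= divff ?gt_eqF // scale1r.
apply: banach_diskI; first exact: cball_disk.
  move=> z zs; apply/eqP; rewrite -normr_eq0; apply/eqP.
  have zn : `|z : R[i]| = (Num.sqrt (complex.Re z ^+ 2 + complex.Im z ^+ 2))%:C.
    exact: normc_def.
  rewrite zn; congr (_%:C); apply/eqP; rewrite eq_le sqrtr_ge0 andbT.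
  apply/ler_addgt0Pr => e e0; rewrite add0r -lecR -zn.
  have er0 : 0 < e / r by rewrite divr_gt0.
  by have /(dilE _ _ er0) := zs _ er0; rewrite divfK // gt_eqF.
move=> u uC.
have uC' e : 0 < e -> exists N, forall m n, (N <= m)%N -> (N <= n)%N ->
    `|u m - u n : R[i]| <= e%:C.
  move=> e0; have er0 : 0 < e / r by rewrite divr_gt0.
  have [N HN] := uC _ er0; exists N => m n Nm Nn.
  by have /(dilE _ _ er0) := HN m n Nm Nn; rewrite divfK // gt_eqF.
have [a ua] : exists l, forall e, 0 < e -> exists N, forall n, (N <= n)%N ->
    `|complex.Re (u n) - l| <= e.
  apply: real_cauchy_lim => e /uC'[N HN]; exists N => m n Nm Nn.
  have [+ _] := normC_ReIm (HN m n Nm Nn).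
  by case: (u m) (u n) => [? ?] [? ?].
have [b ub] : exists l, forall e, 0 < e -> exists N, forall n, (N <= n)%N ->
    `|complex.Im (u n) - l| <= e.
  apply: real_cauchy_lim => e /uC'[N HN]; exists N => m n Nm Nn.
  have [_ +] := normC_ReIm (HN m n Nm Nn).
  by case: (u m) (u n) => [? ?] [? ?].
exists (a +i* b)%C => e e0.
have d0 : 0 < e * r / 2 by rewrite divr_gt0 // mulr_gt0.
have [N HN] := ua _ d0; have [M HM] := ub _ d0.
exists (maxn N M) => n; rewrite geq_max => /andP[Nn Mn].
apply/dilE => //; move: (HN n Nn) (HM n Mn); case: (u n) => x y /= xa yb.
rewrite (_ : _ - _ = (x - a)%:C + 'i * (y - b)%:C); last first.
  by simpc.
apply: le_trans (ler_normD _ _) _.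
have d0' := ltW d0.
rewrite normrM (_ : `|'i| = 1) ?mul1r; last first.
  by rewrite normc_def /= expr0n /= add0r expr1n sqrtr1.
have -> : (e * r)%:C = (e * r / 2)%:C + (e * r / 2)%:C :> R[i].
  by rewrite -rmorphD /= -splitr.
apply: lerD.
  by rewrite normc_def /= expr0n addr0 sqrtr_sqr lecR.
by rewrite normc_def /= expr0n addr0 sqrtr_sqr lecR.
Qed.

Let bs1 (v : C) : bounded_scalars [set v].
Proof. by have [s _ vs] := normC_bound v; exists s => _ ->. Qed.

Let bs_sub (A B : set C) : A `<=` B -> bounded_scalars B -> bounded_scalars A.
Proof. by move=> AB [r Br]; exists r => z /AB/Br. Qed.

Let bs_pos (A : set C) : bounded_scalars A -> exists2 r : R, 0 < r & A `<=` cball r.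
Proof.
move=> [r Ar]; exists (Num.max r 1); first by rewrite lt_max ltr01 orbT.
by move=> z /Ar zr; apply: le_trans zr _; rewrite lecR le_max lexx.
Qed.

Let bsU (A B : set C) :
  bounded_scalars A -> bounded_scalars B -> bounded_scalars (A `|` B).
Proof.
move=> [r Ar] [s Bs]; exists (Num.max r s) => z [/Ar|/Bs] h;
  by apply: le_trans h _; rewrite lecR le_max lexx ?orbT.
Qed.

Let bsD (A B : set C) : bounded_scalars A -> bounded_scalars B ->
  bounded_scalars [set a + b | a in A & b in B].
Proof.
move=> [r Ar] [s Bs]; exists (r + s) => _ [a /Ar ha [b /Bs hb <-]].
by rewrite rmorphD; apply: le_trans (ler_normD _ _) _; exact: lerD.
Qed.

Let bsZ (r : R) (A : set C) : bounded_scalars A ->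
  bounded_scalars [set z *: a | z in [set z : R[i] | `|z| <= r%:C] & a in A].
Proof.
move=> [s As]; exists (r * s) => _ [a /= ha [b /As hb <-]].
by rewrite normrM realCM; exact: ler_pM.
Qed.

Let bs_complete (A : set C) : bounded_scalars A ->
  exists T, [/\ bounded_scalars T, banach_disk T & A `<=` T].
Proof.
move=> /bs_pos[r r0 Ar]; exists (cball r); split => //; last exact: cball_banach.
by exists r.
Qed.

HB.instance Definition _ := isBornological.Build R C
  bs1 bs_sub bsU bsD bsZ bs_complete.

End Scalars.

Section Maps.
Context {R : realType}.
Implicit Types V W X Y : bornType R.

Record bhom V W := BHom {
  bhom_fun :> V -> W;
  bhom_lin : linear bhom_fun;
  bhom_bnd : forall A : set V, small A -> small (bhom_fun @` A) }.

HB.instance Definition _ V W (f : bhom V W) :=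
  GRing.isLinear.Build R[i] V W *:%R (bhom_fun f) (bhom_lin f).

Record biso V W := BIso {
  biso_hom :> bhom V W;
  biso_inv : bhom W V;
  bisoK : cancel biso_hom biso_inv;
  bisoVK : cancel biso_inv biso_hom }.

Record bbil V W X := BBil {
  bbil_fun :> V -> W -> X;
  bbil_linl : forall w, linear (fun v => bbil_fun v w);
  bbil_linr : forall v, linear (bbil_fun v);
  bbil_bnd : forall (A : set V) (B : set W), small A -> small B ->
    small [set bbil_fun v w | v in A & w in B] }.

Program Definition bid V : bhom V V := @BHom V V id _ _.
Next Obligation. by []. Qed.
Next Obligation. by move=> V A sA; apply: small_sub sA => _ [x Ax <-]. Qed.

Program Definition bcomp V W X (g : bhom W X) (f : bhom V W) : bhom V X :=
  @BHom V X (fun v => g (f v)) _ _.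
Next Obligation. by move=> V W X g f a x y; rewrite !linearP. Qed.
Next Obligation.
move=> V W X g f A sA; rewrite -(image_comp f g).
exact/bhom_bnd/bhom_bnd.
Qed.

Lemma small_lincomb V (a : R[i]) (A B : set V) : small A -> small B ->
  small [set a *: x + y | x in A & y in B].
Proof.
move=> sA sB; have [r _ ar] := normC_bound a.
apply: small_sub (smallD (smallZ r sA) sB) => _ [x Ax [y By <-]].
exists (a *: x); last by exists y.
by exists a => //; exists x.
Qed.

Program Definition blincomb V W (a : R[i]) (f g : bhom V W) : bhom V W :=
  @BHom V W (fun v => a *: f v + g v) _ _.
Next Obligation.
move=> V W a f g b x y /=; rewrite (bhom_lin f) (bhom_lin g) !scalerDr !scalerA (mulrC a b).
by rewrite addrACA.
Qed.
Next Obligation.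
move=> V W a f g A sA.
apply: small_sub (small_lincomb a (bhom_bnd f sA) (bhom_bnd g sA)).
by move=> _ [x Ax <-]; exists (f x); [exists x | exists (g x) => //; exists x].
Qed.

Program Definition bbil_l V W X (b : bbil V W X) (w : W) : bhom V X :=
  @BHom V X (fun v => b v w) (bbil_linl b w) _.
Next Obligation.
move=> V W X b w A sA; apply: small_sub (bbil_bnd b sA (small1 w)).
by move=> _ [x Ax <-]; exists x => //; exists w.
Qed.

Program Definition bbil_r V W X (b : bbil V W X) (v : V) : bhom W X :=
  @BHom W X (b v) (bbil_linr b v) _.
Next Obligation.
move=> V W X b v A sA; apply: small_sub (bbil_bnd b (small1 v) sA).
by move=> _ [x Ax <-]; exists v => //; exists x.
Qed.

Lemma bbil0r V W X (b : bbil V W X) v : b v 0 = 0.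
Proof. exact: (linear0 (bbil_r b v)). Qed.

Lemma bbilBr V W X (b : bbil V W X) v x y : b v (x - y) = b v x - b v y.
Proof. exact: (linearB (bbil_r b v)). Qed.

Program Definition bbil_comp V W X Y (h : bhom X Y) (b : bbil V W X) : bbil V W Y :=
  @BBil V W Y (fun v w => h (b v w)) _ _ _.
Next Obligation. by move=> V W X Y h b w a x y; rewrite bbil_linl linearP. Qed.
Next Obligation. by move=> V W X Y h b v a x y; rewrite bbil_linr linearP. Qed.
Next Obligation.
move=> V W X Y h b A B sA sB.
apply: small_sub (bhom_bnd h (bbil_bnd b sA sB)).
by move=> _ [v Av [w Bw <-]]; exists (b v w) => //; exists v => //; exists w.
Qed.

Program Definition bbil_pre V V' W W' X (b : bbil V W X) (f : bhom V' V)
    (g : bhom W' W) : bbil V' W' X :=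
  @BBil V' W' X (fun v w => b (f v) (g w)) _ _ _.
Next Obligation. by move=> *; move=> a x y; rewrite linearP bbil_linl. Qed.
Next Obligation. by move=> *; move=> a x y; rewrite linearP bbil_linr. Qed.
Next Obligation.
move=> V V' W W' X b f g A B sA sB.
apply: small_sub (bbil_bnd b (bhom_bnd f sA) (bhom_bnd g sB)).
by move=> _ [v Av [w Bw <-]]; exists (f v); [exists v | exists (g w) => //; exists w].
Qed.

Program Definition bbil_flip V W X (b : bbil V W X) : bbil W V X :=
  @BBil W V X (fun w v => b v w) (bbil_linr b) (bbil_linl b) _.
Next Obligation.
move=> V W X b A B sA sB; apply: small_sub (bbil_bnd b sB sA).
by move=> _ [v Av [w Bw <-]]; exists w => //; exists v.
Qed.

Program Definition bscale V : bbil (R[i]^o) V V :=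
  @BBil (R[i]^o) V V (fun a v => (a : R[i]) *: v) _ _ _.
Next Obligation. by move=> V w a x y; rewrite scalerDl -scalerA. Qed.
Next Obligation. by move=> V v a x y; rewrite scalerDr !scalerA (mulrC v a). Qed.
Next Obligation.
move=> V A B [r Ar] sB; apply: small_sub (smallZ r sB).
by move=> _ [a /Ar ar [v Bv <-]]; exists a => //; exists v.
Qed.

End Maps.

(* A completed bornological tensor product of V and W; the type determines it up
   to a unique isomorphism.  tensor_products R is a choice of one for each pair. *)
Record ctensor (R : realType) (V W : bornType R) := CTensor {
  ct_space :> bornType R;
  ct_pure : bbil V W ct_space;
  ct_exists : forall (X : bornType R) (b : bbil V W X),
    exists f : bhom ct_space X, forall v w, f (ct_pure v w) = b v w;
  ct_unique : forall (X : bornType R) (f g : bhom ct_space X),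
    (forall v w, f (ct_pure v w) = g (ct_pure v w)) -> f =1 g }.

Definition tensor_products (R : realType) := forall V W : bornType R, ctensor V W.

(* Families with small range; small sets are the uniformly small ones.  Used
   only to see that lifting to the tensor product preserves equiboundedness. *)
Section BoundedFamilies.
Context {R : realType} (I : Type) (X : bornType R).

Definition bfam_pred : {pred (I -> X)} := [pred x | `[< small (range x) >]].

Lemma bfam_submod : submod_closed bfam_pred.
Proof.
split; first by apply/asboolP; apply: small_sub (small1 0) => _ [i _ <-].
move=> a x y /asboolP sx /asboolP sy; apply/asboolP.
apply: small_sub (small_lincomb a sx sy).
by move=> _ [i _ <-]; exists (x i); [exists i | exists (y i) => //; exists i].
Qed.

HB.instance Definition _ :=
  GRing.isSubmodClosed.Build R[i] (I -> X) bfam_pred bfam_submod.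

Record bfam := BFam { bfam_val :> I -> X; _ : bfam_val \in bfam_pred }.
HB.instance Definition _ := [isSub for bfam_val].
HB.instance Definition _ := [Choice of bfam by <:].
HB.instance Definition _ := [SubChoice_isSubLmodule of bfam by <:].

Definition bfam_small (A : set bfam) :=
  exists2 S : set X, small S & forall x i, A x -> S (x i).

Lemma bfamP (x y : bfam) : (forall i, x i = y i) -> x = y.
Proof. by move=> h; apply/val_inj/funext. Qed.

Lemma bfam_range (x : bfam) : small (range x).
Proof. by case: x => x /= /asboolP. Qed.

Let bf1 (x : bfam) : bfam_small [set x].
Proof. by exists (range x); [exact: bfam_range | move=> _ i ->; exists i]. Qed.

Let bf_sub (A B : set bfam) : A `<=` B -> bfam_small B -> bfam_small A.
Proof. by move=> AB [S sS BS]; exists S => // x i /AB; exact: BS. Qed.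

Let bfU (A B : set bfam) : bfam_small A -> bfam_small B -> bfam_small (A `|` B).
Proof.
move=> [S sS AS] [T sT BT]; exists (S `|` T); first exact: smallU.
by move=> x i [/AS|/BT] h; [left|right].
Qed.

Let bfD (A B : set bfam) : bfam_small A -> bfam_small B ->
  bfam_small [set a + b | a in A & b in B].
Proof.
move=> [S sS AS] [T sT BT]; exists [set a + b | a in S & b in T]; first exact: smallD.
move=> _ i [x Ax [y By <-]].
by exists (x i); [exact: AS | exists (y i) => //; exact: BT].
Qed.

Let bfZ (r : R) (A : set bfam) : bfam_small A ->
  bfam_small [set z *: a | z in [set z : R[i] | `|z| <= r%:C] & a in A].
Proof.
move=> [S sS AS]; exists [set z *: a | z in [set z : R[i] | `|z| <= r%:C] & a in S].
  exact: smallZ.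
move=> _ i [z zr [y By <-]].
by exists z => //; exists (y i) => //; exact: AS.
Qed.

Definition bfam_ball (T : set X) : set bfam := [set x | forall i, T (x i)].

Lemma bfam_dil T e (x : bfam) : 0 < e -> small T ->
  dil (bfam_ball T) e x <-> forall i, dil T e (x i).
Proof.
move=> e0 sT; split=> [[t Tt ->] i|h]; first by exists (t i).
have e1 (z : X) : e^-1%:C *: (e%:C *: z) = z.
  by rewrite scalerA -rmorphM /= mulVf ?gt_eqF // scale1r.
have xT : (e^-1%:C *: x : bfam) = e^-1%:C *: x by [].
exists (e^-1%:C *: x); last by rewrite scalerA -rmorphM /= divff ?gt_eqF // scale1r.
move=> i; have [t Tt xi] := h i.
by rewrite (_ : (e^-1%:C *: x : bfam) i = e^-1%:C *: x i) // xi e1.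
Qed.

Lemma bfam_ball_disk T : disk T -> disk (bfam_ball T).
Proof.
move=> dT; split; first by exists 0 => i; exact: disk0.
by move=> x y a b Tx Ty ab i; exact: dT.2.
Qed.

Lemma bfam_ball_banach T : small T -> banach_disk T -> banach_disk (bfam_ball T).
Proof.
move=> sT bT; have dT : disk T by case: bT.
apply: banach_diskI; first exact: bfam_ball_disk.
  move=> x xs; apply: bfamP => i; apply: (banach_sep bT) => e e0.
  by have /(bfam_dil _ e0 sT) := xs e e0; apply.
move=> u uC.
have ui i : exists l, forall e, 0 < e -> exists N, forall n, (N <= n)%N -> dil T e (u n i - l).
  apply: banach_lim => // e e0; have [N HN] := uC e e0; exists N => m n Nm Nn.
  by have /(bfam_dil _ e0 sT)/(_ i) := HN m n Nm Nn.
have [l Hl] := choice ui.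
have lim e : 0 < e -> exists N, forall n i, (N <= n)%N -> dil T e (u n i - l i).
  move=> e0; have e20 : 0 < e / 2 by rewrite divr_gt0.
  have [N HN] := uC _ e20; exists N => n i Nn.
  have [M HM] := Hl i _ e20.
  have /(bfam_dil _ e20 sT)/(_ i) h1 := HN n (maxn N M) Nn (leq_maxl _ _).
  have h2 := HM (maxn N M) (leq_maxr _ _).
  rewrite [e]splitr -(subrK (u (maxn N M) i) (u n i)) -addrA.
  exact: dilD.
have lP : l \in bfam_pred.
  apply/asboolP; have [N HN] := lim 1 ltr01.
  apply: small_sub (small_lincomb (-1) sT (bfam_range (u N))).
  move=> _ [i _ <-]; have [t Tt E] := HN N i (leqnn N).
  exists t => //; exists (u N i); first by exists i.
  rewrite scale1r in E.
  by rewrite -E scaleN1r opprB subrK.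
exists (BFam lP) => e e0; have [N HN] := lim e e0; exists N => n Nn.
by apply/(bfam_dil _ e0 sT) => i; exact: HN.
Qed.

Let bf_complete (A : set bfam) : bfam_small A ->
  exists T, [/\ bfam_small T, banach_disk T & A `<=` T].
Proof.
move=> [S sS AS]; have [T [sT bT ST]] := small_complete sS.
exists (bfam_ball T); split; [by exists T | exact: bfam_ball_banach |].
by move=> x Ax i; exact/ST/AS.
Qed.

HB.instance Definition _ := isBornological.Build R bfam
  bf1 bf_sub bfU bfD bfZ bf_complete.

Program Definition bfam_ev (i : I) : bhom bfam X := @BHom R bfam X (fun x => x i) _ _.
Next Obligation. by []. Qed.
Next Obligation. by move=> i A [S sS AS]; apply: small_sub sS => _ [x Ax <-]; exact: AS. Qed.

End BoundedFamilies.

Section Tensor.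
Context {R : realType} (TP : tensor_products R).
Implicit Types U V W X Y Z : bornType R.
Local Notation C := (R[i]^o).
Local Notation "V ⊗ W" := (ct_space (TP V W)) (at level 40, left associativity).

Definition tens V W : bbil V W (V ⊗ W) := ct_pure (TP V W).
Arguments tens {V W}.

Definition tlift V W X (b : bbil V W X) : bhom (V ⊗ W) X := projT1 (cid (ct_exists (TP V W) b)).

Lemma tliftE V W X (b : bbil V W X) v w : tlift b (tens v w) = b v w.
Proof. exact: (projT2 (cid (ct_exists (TP V W) b))). Qed.

Lemma tens_ext V W X (f g : bhom (V ⊗ W) X) :
  (forall v w, f (tens v w) = g (tens v w)) -> f =1 g.
Proof. exact: ct_unique. Qed.

Lemma tlift_equi V W X (I : Type) (b : I -> bbil V W X) :
  (forall (A : set V) (B : set W), small A -> small B ->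
    exists2 S : set X, small S & forall i v w, A v -> B w -> S (b i v w)) ->
  forall T : set (V ⊗ W), small T ->
    exists2 S : set X, small S & forall i t, T t -> S (tlift (b i) t).
Proof.
move=> bS T sT.
have inP v w : (fun i => b i v w) \in @bfam_pred R I X.
  apply/asboolP; have [S sS bvw] := bS _ _ (small1 v) (small1 w).
  by apply: small_sub sS => _ [i _ <-]; exact: bvw.
pose B v w : bfam I X := BFam (inP v w).
have Bll w : linear (B ^~ w).
  by move=> a x y; apply: bfamP => i /=; exact: (bbil_linl (b i)).
have Blr v : linear (B v).
  by move=> a x y; apply: bfamP => i /=; exact: (bbil_linr (b i)).
have Bb (A : set V) (D : set W) : small A -> small D ->
    small [set B v w | v in A & w in D].
  move=> sA sD; have [S sS bAD] := bS _ _ sA sD; exists S => // _ i [v Av [w Dw <-]].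
  exact: bAD.
pose F := tlift (BBil Bll Blr Bb).
have [S sS FS] := bhom_bnd F sT; exists S => // i t Tt.
have /(_ t) <- : bcomp (bfam_ev X i) F =1 tlift (b i).
  by apply: tens_ext => v w /=; rewrite /F !tliftE.
by apply: FS; exists t.
Qed.

Lemma tcurry_subproof V W X Z (b : Z -> bbil V W X) :
  (forall v w, linear (fun z => b z v w)) ->
  (forall (A : set V) (B : set W) (D : set Z), small A -> small B -> small D ->
    exists2 S : set X, small S & forall z v w, D z -> A v -> B w -> S (b z v w)) ->
  {B : bbil (V ⊗ W) Z X | forall x z, B x z = tlift (b z) x}.
Proof.
move=> blin bS.
have ll z : linear (fun x => tlift (b z) x) by exact: bhom_lin.
have lr x : linear (fun z => tlift (b z) x).
  move=> a y z.
  have /(_ x) : tlift (b (a *: y + z)) =1 blincomb a (tlift (b y)) (tlift (b z)).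
    by apply: tens_ext => v w /=; rewrite !tliftE blin.
  by [].
have bd (A : set (V ⊗ W)) (D : set Z) : small A -> small D ->
    small [set tlift (b z) x | x in A & z in D].
  move=> sA sD.
  have [|S sS h] := @tlift_equi V W X {z | D z} (fun z => b (projT1 z)) _ A sA.
    move=> A' B' sA' sB'; have [S sS h] := bS _ _ _ sA' sB' sD.
    by exists S => // -[z Dz] v w /=; exact: h.
  apply: small_sub sS => _ [x Ax [z Dz <-]].
  exact: (h (exist _ z Dz) x Ax).
by exists (BBil ll lr bd).
Qed.

Definition tcurry V W X Z (b : Z -> bbil V W X) blin bS : bbil (V ⊗ W) Z X :=
  sval (@tcurry_subproof V W X Z b blin bS).

Lemma tcurryE V W X Z (b : Z -> bbil V W X) blin bS x z :
  tcurry (b := b) blin bS x z = tlift (b z) x.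
Proof. exact: (svalP (@tcurry_subproof V W X Z b blin bS)). Qed.

Definition tmap V V' W W' (f : bhom V V') (g : bhom W W') : bhom (V ⊗ W) (V' ⊗ W') :=
  tlift (bbil_pre tens f g).

Lemma tmapE V V' W W' (f : bhom V V') (g : bhom W W') v w :
  tmap f g (tens v w) = tens (f v) (g w).
Proof. exact: tliftE. Qed.

Definition tflip V W : bhom (V ⊗ W) (W ⊗ V) := tlift (bbil_flip tens).

(* (omega \otimes id) and (id \otimes omega), with C \otimes V = V = V \otimes C. *)
Definition slice_l V W (om : bhom V C) : bhom (V ⊗ W) W :=
  tlift (bbil_pre (bscale W) om (bid W)).

Definition slice_r V W (om : bhom W C) : bhom (V ⊗ W) V :=
  tlift (bbil_flip (bbil_pre (bscale V) om (bid V))).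

Definition assoc_bil U V W (w : W) : bbil U V (U ⊗ (V ⊗ W)) :=
  bbil_pre tens (bid U) (bbil_l tens w).

Lemma assoc_lin U V W (u : U) (v : V) : linear (fun w : W => assoc_bil U V w u v).
Proof. by move=> a x y /=; rewrite !bbil_linr. Qed.

Lemma assoc_bnd U V W (A : set U) (B : set V) (D : set W) :
  small A -> small B -> small D -> exists2 S : set (U ⊗ (V ⊗ W)), small S &
    forall w u v, D w -> A u -> B v -> S (assoc_bil U V w u v).
Proof.
move=> sA sB sD; exists [set tens u x | u in A & x in [set tens v w | v in B & w in D]].
  exact/bbil_bnd/bbil_bnd.
by move=> w u v Dw Au Bv /=; exists u => //; exists (tens v w) => //; exists v => //; exists w.
Qed.

Definition tassoc U V W : bhom (U ⊗ V ⊗ W) (U ⊗ (V ⊗ W)) :=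
  tlift (tcurry (b := @assoc_bil U V W) (@assoc_lin U V W) (@assoc_bnd U V W)).

Lemma tassocE U V W u v w :
  @tassoc U V W (tens (tens u v) w) = tens u (tens v w).
Proof. by rewrite /tassoc tliftE tcurryE tliftE. Qed.

(* By the universal property the bounded bilinear product is the same as a
   bounded linear map V ⊗ V -> V. *)
Record balg V := BAlg {
  amul : bbil V V V;
  amulA : forall x y z, amul x (amul y z) = amul (amul x y) z }.

Section TensorAlgebra.
Context {V W : bornType R} (A : balg V) (B : balg W).

Definition tmul_bil (c : V) (d : W) : bbil V W (V ⊗ W) :=
  bbil_pre tens (bbil_l (amul A) c) (bbil_l (amul B) d).

Lemma tmul_right_subproof (x : V ⊗ W) :
  {m : bbil V W (V ⊗ W) | forall c d, m c d = tlift (tmul_bil c d) x}.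
Proof.
have ll d : linear (fun c => tlift (tmul_bil c d) x).
  move=> a y z.
  have /(_ x) : tlift (tmul_bil (a *: y + z) d) =1
      blincomb a (tlift (tmul_bil y d)) (tlift (tmul_bil z d)).
    by apply: tens_ext => v w /=; rewrite !tliftE /= bbil_linr bbil_linl.
  by [].
have lr c : linear (fun d => tlift (tmul_bil c d) x).
  move=> a y z.
  have /(_ x) : tlift (tmul_bil c (a *: y + z)) =1
      blincomb a (tlift (tmul_bil c y)) (tlift (tmul_bil c z)).
    by apply: tens_ext => v w /=; rewrite !tliftE /= !bbil_linr.
  by [].
have bd (S : set V) (T : set W) : small S -> small T ->
    small [set tlift (tmul_bil c d) x | c in S & d in T].
  move=> sS sT.
  have [|D sD h] := @tlift_equi V W _ {cd : V * W | S cd.1 /\ T cd.2}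
      (fun cd => tmul_bil (projT1 cd).1 (projT1 cd).2) _ _ (small1 x).
    move=> S' T' sS' sT'.
    exists [set tens v w | v in [set amul A a c | a in S' & c in S]
                        & w in [set amul B b d | b in T' & d in T]].
      by apply: bbil_bnd; exact: bbil_bnd.
    move=> [[c d] /= [Sc Td]] a b Sa Tb.
    exists (amul A a c); first by exists a => //; exists c.
    by exists (amul B b d) => //; exists b => //; exists d.
  apply: small_sub sD => _ [c Sc [d Td <-]].
  exact: (h (exist _ (c, d) (conj Sc Td)) x).
by exists (BBil ll lr bd).
Qed.

Definition tmul_right (x : V ⊗ W) : bbil V W (V ⊗ W) := sval (tmul_right_subproof x).

Lemma tmul_rightE x c d : tmul_right x c d = tlift (tmul_bil c d) x.
Proof. exact: (svalP (tmul_right_subproof x)). Qed.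

Lemma tmul_lin c d : linear (fun x => tmul_right x c d).
Proof. by move=> a x y; rewrite !tmul_rightE linearP. Qed.

Lemma tmul_bnd (S : set V) (T : set W) (D : set (V ⊗ W)) :
  small S -> small T -> small D -> exists2 E : set (V ⊗ W), small E &
    forall x c d, D x -> S c -> T d -> E (tmul_right x c d).
Proof.
move=> sS sT sD.
have [|E sE h] := @tlift_equi V W _ {cd : V * W | S cd.1 /\ T cd.2}
      (fun cd => tmul_bil (projT1 cd).1 (projT1 cd).2) _ _ sD.
  move=> S' T' sS' sT'.
  exists [set tens v w | v in [set amul A a c | a in S' & c in S]
                      & w in [set amul B b d | b in T' & d in T]].
    by apply: bbil_bnd; exact: bbil_bnd.
  move=> [[c d] /= [Sc Td]] a b Sa Tb.
  exists (amul A a c); first by exists a => //; exists c.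
  by exists (amul B b d) => //; exists b => //; exists d.
exists E => // x c d Dx Sc Td; rewrite tmul_rightE.
exact: (h (exist _ (c, d) (conj Sc Td)) x Dx).
Qed.

Definition tmul : bbil (V ⊗ W) (V ⊗ W) (V ⊗ W) :=
  bbil_flip (tcurry (b := tmul_right) tmul_lin tmul_bnd).

Lemma tmulE a b c d : tmul (tens a b) (tens c d) = tens (amul A a c) (amul B b d).
Proof. by rewrite /tmul /= tcurryE tliftE tmul_rightE tliftE. Qed.

Lemma tmulA x y z : tmul x (tmul y z) = tmul (tmul x y) z.
Proof.
have /(_ x) : bbil_l tmul (tmul y z) =1 bcomp (bbil_l tmul z) (bbil_l tmul y).
  apply: tens_ext => a b /=.
  have /(_ y) : bcomp (bbil_r tmul (tens a b)) (bbil_l tmul z) =1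
      bcomp (bbil_l tmul z) (bbil_r tmul (tens a b)).
    apply: tens_ext => c d /=.
    have /(_ z) : bcomp (bbil_r tmul (tens a b)) (bbil_r tmul (tens c d)) =1
        bbil_r tmul (tmul (tens a b) (tens c d)).
      apply: tens_ext => e f.
      change (tmul (tens a b) (tmul (tens c d) (tens e f)) =
              tmul (tmul (tens a b) (tens c d)) (tens e f)).
      by rewrite !tmulE !amulA.
    by [].
  by [].
by [].
Qed.

Definition talg : balg (V ⊗ W) := BAlg tmulA.

End TensorAlgebra.

End Tensor.

Arguments tens {R} TP {V W}.
Arguments tflip {R} TP {V W}.
Arguments slice_l {R} TP {V W}.
Arguments slice_r {R} TP {V W}.
Arguments tassoc {R} TP {U V W}.

Section Approximation.
Context {R : realType}.
Implicit Types V W X Y : bornType R.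

(* Convergence in <T> for some small disk T; closed means closed under it. *)
Definition bcvg V (u : nat -> V) (l : V) :=
  exists T, [/\ small T, disk T & gauge_cvg T u l].

Definition bclosed V (N : set V) :=
  forall u l, (forall n, N (u n)) -> bcvg u l -> N l.

Definition bclosure V (A : set V) : set V :=
  [set x | forall N, bclosed N -> A `<=` N -> N x].

(* f induces an isomorphism X / N -> Y.  The small sets of X / N are the
   subsets of images of small sets of X, so the last condition says that the
   inverse is everywhere defined and bounded. *)
Definition quotient_iso X Y (f : bhom X Y) (N : set X) :=
  (forall x, N x <-> f x = 0) /\
  (forall B : set Y, small B -> exists2 A : set X, small A & B `<=` f @` A).

Definition gauge_open V (T U : set V) := U `<=` lspan T /\
  forall x, U x -> exists2 e : R, 0 < e &
    forall y, lspan T y -> gauge T (y - x) < e -> U y.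

Definition gauge_compact V (T S : set V) := S `<=` lspan T /\
  forall F : set (set V), (forall U, F U -> gauge_open T U) ->
    S `<=` \bigcup_(U in F) U ->
    exists n (U : 'I_n -> set V), (forall i, F (U i)) /\
      S `<=` \bigcup_(i in [set: 'I_n]) U i.

Definition compact_disk V (S : set V) := disk S /\
  exists T, [/\ small T, banach_disk T & gauge_compact T S].

Definition finite_rank V W (f : bhom V W) :=
  exists n (e : 'I_n -> W), forall x, exists c : 'I_n -> R[i],
    f x = \sum_(i < n) c i *: e i.

(* f_n -> id in Hom(<S>, V): for some set D of maps that is equibounded on <S>,
   the restriction of f_n - id lies in e D for n large. *)
Definition cvg_to_id V (S : set V) (f : nat -> bhom V V) :=
  exists2 D : set (V -> V), small [set d x | d in D & x in S] &
    forall e : R, 0 < e -> exists N, forall n, (N <= n)%N ->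
      exists2 d, D d & forall x, lspan S x -> f n x - x = e%:C *: d x.

Definition approximation_property V :=
  forall S : set V, compact_disk S -> exists f : nat -> bhom V V,
    (forall n, finite_rank (f n)) /\ cvg_to_id S f.

End Approximation.

Section Multipliers.
Context {R : realType}.
Implicit Types V W : bornType R.

Lemma bhomP V W (f g : bhom V W) : f =1 g -> f = g.
Proof.
case: f g => [f fl fb] [g gl gb] /= /funext fg; case: _ / fg in gl gb *.
by congr BHom; exact: Prop_irrelevance.
Qed.

Record multiplier V (A : balg V) := Mult {
  mulL : bhom V V;
  mulR : bhom V V;
  mulLM : forall f g, mulL (amul A f g) = amul A (mulL f) g;
  mulRM : forall f g, mulR (amul A f g) = amul A f (mulR g);
  mulLR : forall f g, amul A f (mulL g) = amul A (mulR f) g }.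

Lemma multP V (A : balg V) (m n : multiplier A) :
  mulL m =1 mulL n -> mulR m =1 mulR n -> m = n.
Proof.
case: m n => [L r p q s] [L' r' p' q' s'] /= /bhomP EL /bhomP ER.
subst L' r'; congr Mult; exact: Prop_irrelevance.
Qed.

Definition msmall V (A : balg V) (D : set (multiplier A)) :=
  forall B : set V, small B ->
    small [set mulL d x | d in D & x in B] /\ small [set mulR d x | d in D & x in B].

Program Definition mone V (A : balg V) : multiplier A := @Mult V A (bid V) (bid V) _ _ _.
Next Obligation. by []. Qed.
Next Obligation. by []. Qed.
Next Obligation. by []. Qed.

Program Definition mmul V (A : balg V) (m n : multiplier A) : multiplier A :=
  @Mult V A (bcomp (mulL m) (mulL n)) (bcomp (mulR n) (mulR m)) _ _ _.
Next Obligation. by move=> V A m n f g; cbn; rewrite !mulLM. Qed.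
Next Obligation. by move=> V A m n f g; cbn; rewrite !mulRM. Qed.
Next Obligation. by move=> V A m n f g; cbn; rewrite !mulLR. Qed.

Program Definition mlincomb V (A : balg V) (a : R[i]) (m n : multiplier A) :
    multiplier A :=
  @Mult V A (blincomb a (mulL m) (mulL n)) (blincomb a (mulR m) (mulR n)) _ _ _.
Next Obligation. by move=> V A a m n f g; cbn; rewrite !mulLM bbil_linl. Qed.
Next Obligation. by move=> V A a m n f g; cbn; rewrite !mulRM bbil_linr. Qed.
Next Obligation. by move=> V A a m n f g; cbn; rewrite bbil_linl bbil_linr !mulLR. Qed.

Program Definition mincl V (A : balg V) (x : V) : multiplier A :=
  @Mult V A (bbil_r (amul A) x) (bbil_l (amul A) x) _ _ _.
Next Obligation. by move=> V A x f g; cbn; rewrite amulA. Qed.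
Next Obligation. by move=> V A x f g; cbn; rewrite amulA. Qed.
Next Obligation. by move=> V A x f g; cbn; rewrite amulA. Qed.

Definition unital_mhom V W (A : balg V) (B : balg W)
    (G : multiplier A -> multiplier B) :=
  [/\ forall a m n, G (mlincomb a m n) = mlincomb a (G m) (G n),
      forall m n, G (mmul m n) = mmul (G m) (G n),
      G (mone A) = mone B &
      forall D, msmall D -> msmall (G @` D)].

Record mhom V W (A : balg V) (B : balg W) := MHom {
  mhom_fun :> V -> multiplier B;
  mhom_lin : forall a x y, mhom_fun (a *: x + y) = mlincomb a (mhom_fun x) (mhom_fun y);
  mhom_mul : forall x y, mhom_fun (amul A x y) = mmul (mhom_fun x) (mhom_fun y);
  mhom_bnd : forall S : set V, small S -> msmall (mhom_fun @` S) }.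

Program Definition mhom_lact V W (A : balg V) (B : balg W) (f : mhom A B) : bbil V W W :=
  @BBil R V W W (fun x k => mulL (f x) k) _ _ _.
Next Obligation. by move=> V W A B f k a x y; rewrite mhom_lin. Qed.
Next Obligation. by move=> V W A B f x a k l; rewrite linearP. Qed.
Next Obligation.
move=> V W A B f S T sS sT; apply: small_sub (mhom_bnd f sS sT).1.
by move=> _ [x Sx [k Tk <-]]; exists (f x); [exists x | exists k].
Qed.

Program Definition mhom_ract V W (A : balg V) (B : balg W) (f : mhom A B) : bbil W V W :=
  @BBil R W V W (fun k x => mulR (f x) k) _ _ _.
Next Obligation. by move=> V W A B f x a k l; rewrite linearP. Qed.
Next Obligation. by move=> V W A B f k a x y; rewrite mhom_lin. Qed.
Next Obligation.
move=> V W A B f S T sS sT; apply: small_sub (mhom_bnd f sT sS).2.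
by move=> _ [k Sk [x Tx <-]]; exists (f x); [exists x | exists k].
Qed.

End Multipliers.

Section QuantumGroups.
Context {R : realType} (TP : tensor_products R).
Implicit Types V W M : bornType R.
Local Notation C := (R[i]^o).
Local Notation "V ⊗ W" := (ct_space (TP V W)) (at level 40, left associativity).
Local Notation "v ⊠ w" := (tens TP v w) (at level 40, left associativity).

Definition essential_lmod V M (A : balg V) (act : bbil V M M) :=
  quotient_iso (tlift TP act) (bclosure (lspan
    [set z | exists f h m, z = amul A f h ⊠ m - f ⊠ act h m])).

Definition essential_rmod V M (A : balg V) (act : bbil M V M) :=
  quotient_iso (tlift TP act) (bclosure (lspan
    [set z | exists m h f, z = act m h ⊠ f - m ⊠ amul A h f])).

Definition essential_alg V (A : balg V) :=
  (exists x : V, x != 0) /\ essential_lmod A (amul A).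

Definition essential_mhom V W (A : balg V) (B : balg W) (f : mhom A B) :=
  essential_lmod A (mhom_lact f) /\ essential_rmod A (mhom_ract f).

Lemma mtens_subproof V W (A : balg V) (B : balg W) (m : multiplier A) (n : multiplier B) :
  {p : multiplier (talg TP A B) | mulL p = tmap TP (mulL m) (mulL n) /\
                                  mulR p = tmap TP (mulR m) (mulR n)}.
Proof.
set L := tmap TP _ _; set r := tmap TP _ _.
have ext (f g : bbil (V ⊗ W) (V ⊗ W) (V ⊗ W)) :
    (forall a b c d, f (a ⊠ b) (c ⊠ d) = g (a ⊠ b) (c ⊠ d)) -> forall x y, f x y = g x y.
  move=> fg x y.
  have /(_ x) : bbil_l f y =1 bbil_l g y; last by [].
  apply: tens_ext => a b; change (bbil_r f (a ⊠ b) y = bbil_r g (a ⊠ b) y).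
  by move: y; apply: tens_ext => c d; exact: fg.
have p1 : forall x y, L (amul (talg TP A B) x y) = amul (talg TP A B) (L x) y.
  apply: (ext (bbil_comp L (tmul TP A B)) (bbil_pre (tmul TP A B) L (bid _))) => a b c d.
  change (L (tmul TP A B (a ⊠ b) (c ⊠ d)) = tmul TP A B (L (a ⊠ b)) (c ⊠ d)).
  by rewrite /L tmulE !tmapE tmulE !mulLM.
have p2 : forall x y, r (amul (talg TP A B) x y) = amul (talg TP A B) x (r y).
  apply: (ext (bbil_comp r (tmul TP A B)) (bbil_pre (tmul TP A B) (bid _) r)) => a b c d.
  change (r (tmul TP A B (a ⊠ b) (c ⊠ d)) = tmul TP A B (a ⊠ b) (r (c ⊠ d))).
  by rewrite /r tmulE !tmapE tmulE !mulRM.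
have p3 : forall x y, amul (talg TP A B) x (L y) = amul (talg TP A B) (r x) y.
  apply: (ext (bbil_pre (tmul TP A B) (bid _) L) (bbil_pre (tmul TP A B) r (bid _))) => a b c d.
  change (tmul TP A B (a ⊠ b) (L (c ⊠ d)) = tmul TP A B (r (a ⊠ b)) (c ⊠ d)).
  by rewrite /L /r !tmapE !tmulE !mulLR.
by exists (Mult p1 p2 p3).
Qed.

Definition mtens V W (A : balg V) (B : balg W) (m : multiplier A) (n : multiplier B) :
  multiplier (talg TP A B) := sval (mtens_subproof m n).

(* (Delta \otimes id) Delta = (id \otimes Delta) Delta, where G1 and G2 are the
   extensions of Delta \otimes id and id \otimes Delta to M(A \otimes A), and the
   two triple tensor products are identified by the associator. *)
Definition coassociative V (A : balg V) (D : mhom A (talg TP A A)) :=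
  exists (G1 : multiplier (talg TP A A) -> multiplier (talg TP (talg TP A A) A))
         (G2 : multiplier (talg TP A A) -> multiplier (talg TP A (talg TP A A))),
  [/\ unital_mhom G1 /\ unital_mhom G2,
      forall f g, G1 (mincl _ (f ⊠ g)) = mtens (D f) (mincl A g),
      forall f g, G2 (mincl _ (f ⊠ g)) = mtens (mincl A f) (D g),
      forall f x, tassoc TP (mulL (G1 (D f)) x) = mulL (G2 (D f)) (tassoc TP x) &
      forall f x, tassoc TP (mulR (G1 (D f)) x) = mulR (G2 (D f)) (tassoc TP x)].

Definition faithful V (A : balg V) (om : bhom V C) :=
  (forall f, (forall g, om (amul A f g) = 0) -> f = 0) /\
  (forall g, (forall f, om (amul A f g) = 0) -> g = 0).

(* slice_r_is: m = (id \otimes om) Delta(f); slice_l_is: m = (om \otimes id) Delta(f).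
   These multipliers are defined through the Galois maps gl, rl and gr, rr. *)
Definition slice_r_is V (A : balg V) (gl rl : bhom (V ⊗ V) (V ⊗ V)) (om : bhom V C)
    (f : V) (m : multiplier A) := forall g,
  slice_r TP om (gl (f ⊠ g)) = mulL m g /\ slice_r TP om (rl (g ⊠ f)) = mulR m g.

Definition slice_l_is V (A : balg V) (gr rr : bhom (V ⊗ V) (V ⊗ V)) (om : bhom V C)
    (f : V) (m : multiplier A) := forall g,
  slice_l TP om (gr (f ⊠ g)) = mulL m g /\ slice_l TP om (rr (g ⊠ f)) = mulR m g.

(* The multiplier a 1; the summand mincl A 0 vanishes. *)
Definition mscal V (A : balg V) (a : R[i]) : multiplier A :=
  mlincomb a (mone A) (mincl A 0).

Record bqg V := BQG {
  bqg_alg :> balg V;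
  bqg_essential : essential_alg bqg_alg;
  bqg_approx : approximation_property V;
  comul : mhom bqg_alg (talg TP bqg_alg bqg_alg);
  comul_essential : essential_mhom comul;
  comul_coassoc : coassociative comul;
  gamma_l : biso (V ⊗ V) (V ⊗ V);
  gamma_r : biso (V ⊗ V) (V ⊗ V);
  rho_l : biso (V ⊗ V) (V ⊗ V);
  rho_r : biso (V ⊗ V) (V ⊗ V);
  gamma_lE : forall f g, mincl _ (gamma_l (f ⊠ g)) =
    mmul (comul f) (mtens (mincl bqg_alg g) (mone bqg_alg));
  gamma_rE : forall f g, mincl _ (gamma_r (f ⊠ g)) =
    mmul (comul f) (mtens (mone bqg_alg) (mincl bqg_alg g));
  rho_lE : forall f g, mincl _ (rho_l (f ⊠ g)) =
    mmul (mtens (mincl bqg_alg f) (mone bqg_alg)) (comul g);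
  rho_rE : forall f g, mincl _ (rho_r (f ⊠ g)) =
    mmul (mtens (mone bqg_alg) (mincl bqg_alg f)) (comul g);
  haar : bhom V C;
  haar_faithful : faithful bqg_alg haar;
  haar_left_invariant : forall f,
    slice_r_is gamma_l rho_l haar f (mscal bqg_alg (haar f)) }.

Definition right_invariant V (Q : bqg V) (psi : bhom V C) :=
  forall f, slice_l_is (gamma_r Q) (rho_r Q) psi f (mscal Q (psi f)).

Definition scal_lact V (eps : bhom V C) : bbil V C C :=
  bbil_pre (bscale C) eps (bid C).

Definition scal_ract V (eps : bhom V C) : bbil C V C := bbil_flip (scal_lact eps).

(* An essential homomorphism V -> C = M(C), counital for comul. *)
Definition counit V (Q : bqg V) (eps : bhom V C) :=
  [/\ forall f g, eps (amul Q f g) = (eps f : R[i]) * eps g,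
      essential_lmod Q (scal_lact eps) /\ essential_rmod Q (scal_ract eps),
      forall f, slice_l_is (gamma_r Q) (rho_r Q) eps f (mincl Q f) &
      forall f, slice_r_is (gamma_l Q) (rho_l Q) eps f (mincl Q f)].

(* Isomorphisms of quantum groups; P \otimes P intertwines the multipliers
   comul Q f and comul Q' (P f). *)
Definition bqg_iso V W (Q : bqg V) (Q' : bqg W) (P : biso V W) :=
  [/\ forall f g, P (amul Q f g) = amul Q' (P f) (P g),
      forall f x, mulL (comul Q' (P f)) (tmap TP P P x) = tmap TP P P (mulL (comul Q f) x) &
      forall f x, mulR (comul Q' (P f)) (tmap TP P P x) = tmap TP P P (mulR (comul Q f) x)].

End QuantumGroups.

Arguments slice_r_is {R TP V A}.
Arguments slice_l_is {R TP V A}.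

(* The functionals h |-> haar (h f), with the bornology transported from V. *)
Section DualSpace.
Context {R : realType} (TP : tensor_products R) (V : bornType R) (Q : bqg TP V).
Local Notation C := (R[i]^o).

Definition dual_pred : {pred (V -> C)} :=
  [pred w | `[< exists f, forall h, w h = haar Q (amul Q h f) >]].

Lemma dual_submod : submod_closed dual_pred.
Proof.
split; first by apply/asboolP; exists 0 => h; rewrite bbil0r linear0.
move=> a w z /asboolP[f wf] /asboolP[g zg]; apply/asboolP; exists (a *: f + g) => h.
rewrite bbil_linr linearP (_ : (a *: w + z) h = a *: w h + z h) //.
by rewrite wf zg.
Qed.

HB.instance Definition _ :=
  GRing.isSubmodClosed.Build R[i] (V -> C) dual_pred dual_submod.

Record dual_space := Dual { dual_val :> V -> C; _ : dual_val \in dual_pred }.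
HB.instance Definition _ := [isSub for dual_val].
HB.instance Definition _ := [Choice of dual_space by <:].
HB.instance Definition _ := [SubChoice_isSubLmodule of dual_space by <:].

Lemma dualP (w z : dual_space) : (forall h, w h = z h) -> w = z.
Proof. by move=> h; apply/val_inj/funext. Qed.

Lemma four_l_subproof (f : V) : (fun h => haar Q (amul Q h f)) \in dual_pred.
Proof. by apply/asboolP; exists f. Qed.

Definition four_l (f : V) : dual_space := Dual (four_l_subproof f).

Lemma four_l_linear : linear four_l.
Proof. by move=> a f g; apply: dualP => h /=; rewrite bbil_linr linearP. Qed.

HB.instance Definition _ := GRing.isLinear.Build R[i] V dual_space *:%R four_l four_l_linear.

Lemma four_l_inj : injective four_l.
Proof.
move=> f g fg; apply/eqP; rewrite -subr_eq0; apply/eqP.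
apply: (haar_faithful Q).2 => h.
rewrite bbilBr linearB; apply/eqP; rewrite subr_eq0; apply/eqP.
exact: (congr1 (fun w : dual_space => w h) fg).
Qed.

Lemma four_l_surj (w : dual_space) : exists f, four_l f = w.
Proof.
case: w => w wP; have /asboolP[f wf] := wP; exists f.
by apply: dualP => h /=; rewrite wf.
Qed.

Definition four_l_inv (w : dual_space) : V := projT1 (cid (four_l_surj w)).

Lemma four_l_invK : cancel four_l_inv four_l.
Proof. by move=> w; exact: (projT2 (cid (four_l_surj w))). Qed.

Lemma four_lK : cancel four_l four_l_inv.
Proof. by move=> f; apply: four_l_inj; rewrite four_l_invK. Qed.

Definition dual_small (A : set dual_space) := small (four_l @^-1` A).

Let preim (A : set dual_space) : four_l @^-1` A = four_l_inv @` A.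
Proof.
apply/seteqP; split => [f Af|_ [w Aw <-]]; last by rewrite /preimage /= four_l_invK.
by exists (four_l f) => //; rewrite four_lK.
Qed.

Let ds1 (w : dual_space) : dual_small [set w].
Proof. by rewrite /dual_small preim image_set1; exact: small1. Qed.

Let ds_sub (A B : set dual_space) : A `<=` B -> dual_small B -> dual_small A.
Proof. by move=> AB; apply: small_sub => f; exact: AB. Qed.

Let dsU (A B : set dual_space) : dual_small A -> dual_small B -> dual_small (A `|` B).
Proof. exact: smallU. Qed.

Let dsD (A B : set dual_space) : dual_small A -> dual_small B ->
  dual_small [set a + b | a in A & b in B].
Proof.
move=> sA sB; apply: small_sub (smallD sA sB) => f [w Aw [z Bz E]].
exists (four_l_inv w); first by rewrite /preimage /= four_l_invK.
exists (four_l_inv z); first by rewrite /preimage /= four_l_invK.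
by apply: four_l_inj; rewrite linearD /= !four_l_invK.
Qed.

Let dsZ (r : R) (A : set dual_space) : dual_small A ->
  dual_small [set z *: a | z in [set z : R[i] | `|z| <= r%:C] & a in A].
Proof.
move=> sA; apply: small_sub (smallZ r sA) => f [z zr [w Aw E]].
exists z => //; exists (four_l_inv w); first by rewrite /preimage /= four_l_invK.
by apply: four_l_inj; rewrite linearZ /= four_l_invK.
Qed.

Lemma four_l_dil T e f : dil (four_l @` T) e (four_l f) <-> dil T e f.
Proof.
split=> [[_ [t Tt <-] E]|[t Tt ->]]; last first.
  by exists (four_l t); [exists t | rewrite linearZ].
by exists t => //; apply: four_l_inj; rewrite linearZ.
Qed.

Lemma four_l_banach T : banach_disk T -> banach_disk (four_l @` T).
Proof.
move=> bT; have dT : disk T by case: bT.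
apply: banach_diskI.
- split; first by exists (four_l 0); exists 0 => //; exact: disk0.
  move=> _ _ a b [x Tx <-] [y Ty <-] ab; exists (a *: x + b *: y); first exact: dT.2.
  by rewrite linearD !linearZ.
- move=> w ws; rewrite -(four_l_invK w) (_ : four_l_inv w = 0) ?linear0 //.
  apply: (banach_sep bT) => e e0; apply/four_l_dil.
  by rewrite four_l_invK; exact: ws.
- move=> u uC; have [|l ul] := banach_lim (u := four_l_inv \o u) bT.
    move=> e /uC[N HN]; exists N => m n Nm Nn; apply/four_l_dil.
    by rewrite linearB /= !four_l_invK; exact: HN.
  exists (four_l l) => e /ul[N HN]; exists N => n Nn.
  by have /four_l_dil := HN n Nn; rewrite linearB /= four_l_invK.
Qed.

Let ds_complete (A : set dual_space) : dual_small A ->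
  exists T, [/\ dual_small T, banach_disk T & A `<=` T].
Proof.
move=> /small_complete[T [sT bT AT]]; exists (four_l @` T); split.
- by apply: small_sub sT => f [g Tg /four_l_inj <-].
- exact: four_l_banach.
- move=> w Aw; exists (four_l_inv w); last exact: four_l_invK.
  by apply: AT; rewrite /preimage /= four_l_invK.
Qed.

HB.instance Definition _ := isBornological.Build R dual_space
  ds1 ds_sub dsU dsD dsZ ds_complete.

Definition F_l_hom : bhom V dual_space.
Proof.
exists four_l; first exact: four_l_linear.
by move=> A sA; apply: small_sub sA => f [g Ag /four_l_inj <-].
Defined.

Definition F_l_inv_hom : bhom dual_space V.
Proof.
exists four_l_inv.
  by move=> a w z; apply: four_l_inj; rewrite linearP /= !four_l_invK.
by move=> A; rewrite -preim.
Defined.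

Definition F_l : biso V dual_space := @BIso R V dual_space F_l_hom F_l_inv_hom four_lK four_l_invK.

Lemma F_lE f h : F_l f h = haar Q (amul Q h f).
Proof. by []. Qed.

End DualSpace.

Section Dual.
Context {R : realType} (TP : tensor_products R) (V : bornType R).
Local Notation C := (R[i]^o).
Local Notation "v ⊠ w" := (tens TP v w) (at level 40, left associativity).

(* Qd is the dual quantum group structure of Q on dual_space Q.  That
   psi, G_r and eps exist is part of the theory; they are unique up to the
   scaling of psi. *)
Definition is_dual (Q : bqg TP V) (Qd : bqg TP (dual_space Q)) :=
  (forall f g, amul Qd (F_l Q f) (F_l Q g) =
     F_l Q (slice_r TP (haar Q) (biso_inv (gamma_l Q) (f ⊠ g)))) /\
  exists (psi : bhom V C) (G_r : biso V (dual_space Q)) (eps : bhom V C),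
    [/\ [/\ faithful Q psi, right_invariant Q psi,
            forall f h, G_r f h = psi (amul Q f h) & counit Q eps],
        forall f g, gamma_r Qd (F_l Q f ⊠ F_l Q g) =
          tmap TP (F_l Q) (F_l Q) (tflip TP (biso_inv (gamma_l Q) (f ⊠ g))),
        forall f g, rho_l Qd (G_r g ⊠ G_r f) =
          tmap TP G_r G_r (tflip TP (biso_inv (rho_r Q) (g ⊠ f))) &
        forall f, haar Qd (G_r f) = eps f].

End Dual.

Arguments is_dual {R TP V} Q Qd.

(* Main.v *)
(* Write <f, w> = w f for the pairing of H with its dual.  The approximation
   property makes <., .> ⊗ <., .> separate the points of H ⊗ H: by the universal
   property every element of H ⊗ H is the sum of a series whose first legs lie in
   one compact disk K, and finite rank operators tending to the identity on K
   reduce the claim to finite rank tensors.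

   Hence identities can be tested against the pairing, where
     <f ⊗ g, gamma_r (w ⊗ e)> = <rho_l (f ⊗ g), w ⊗ e>,
     <f ⊗ g, rho_l (w ⊗ e)> = <gamma_r (f ⊗ g), w ⊗ e>
   (dual Galois maps on the left).  Evaluating (psi ⊗ phi)(t Delta(x)) in two ways
   gives F_r(H) = G_r(H), and strong left invariance gives an isomorphism S of H
   with dual_phi (G_r (S f) w) = <f, w>.  So P = F_r' G_r S, where F_r' is the map
   F_r of the dual, sends f to the evaluation at f.  P is multiplicative because
   the first adjunction identifies the product of the bidual with that of H, and
   it is compatible with the comultiplications because applying both adjunctions
   twice shows that P intertwines gamma_r and rho_l. *)

From HB Require Import structures.
Require Import Defs.
From mathcomp Require Import all_boot all_order all_algebra.
From mathcomp Require Import complex.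
From mathcomp Require Import boolp classical_sets.
From mathcomp Require Import reals.
From mathcomp Require Import ring lra.

Set Implicit Arguments.
Unset Strict Implicit.
Unset Printing Implicit Defensive.

Import Order.TTheory GRing.Theory Num.Theory.
Local Open Scope classical_set_scope.
Local Open Scope ring_scope.
Local Open Scope complex_scope.

(** * Dilations of disks and convergent series *)

Section Dilations.
Context {R : realType} {V : lmodType R[i]}.
Implicit Types (T B G : set V) (x y : V) (u v : nat -> V).

Lemma dil0 T r : disk T -> dil T r 0.
Proof. by move=> /disk0 T0; exists 0; rewrite ?scaler0. Qed.

Lemma dil_mono T B r x : T `<=` B -> dil T r x -> dil B r x.
Proof. by move=> TB [t /TB Bt ->]; exists t. Qed.

Lemma dil_le T r s x : disk T -> 0 <= r <= s -> dil T r x -> dil T s x.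
Proof.
move=> dT /andP[r0 rs]; have [s0|s0] := ltP 0 s; first exact: dilS.
by have -> : r = s by apply/eqP; rewrite eq_le rs (le_trans s0).
Qed.

Lemma dil_add T r s x y : disk T -> 0 <= r -> 0 <= s ->
  dil T r x -> dil T s y -> dil T (r + s) (x + y).
Proof.
move=> dT; rewrite le_eqVlt => /predU1P[<-|r0].
  by move=> _ [t _ ->]; rewrite scale0r !add0r.
rewrite le_eqVlt => /predU1P[<-|s0].
  by move=> xr [t _ ->]; rewrite scale0r !addr0.
exact: dilD.
Qed.

Lemma dil_sub T r s x y : disk T -> 0 <= r -> 0 <= s ->
  dil T r x -> dil T s y -> dil T (r + s) (x - y).
Proof. by move=> dT r0 s0 xr ys; apply: dil_add => //; exact: dilN. Qed.

Lemma dil_scale T r s x : dil T r x -> dil T (s * r) (s%:C *: x).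
Proof. by move=> [t Tt ->]; exists t => //; rewrite scalerA realCM. Qed.

Lemma dil1 T x : T x -> dil T 1 x.
Proof. by move=> Tx; exists x => //; rewrite scale1r. Qed.

Lemma dil1E T x : dil T 1 x -> T x.
Proof. by move=> [t Tt ->]; rewrite scale1r. Qed.

Lemma dil_dil T r s x : dil (dil T r) s x -> dil T (s * r) x.
Proof. by move=> [_ [t Tt ->] ->]; exists t => //; rewrite scalerA realCM. Qed.

Lemma dil_sum T (n : nat) (r : nat -> R) (x : nat -> V) : disk T ->
  (forall i, 0 <= r i) -> (forall i, (i < n)%N -> dil T (r i) (x i)) ->
  dil T (\sum_(i < n) r i) (\sum_(i < n) x i).
Proof.
move=> dT r0; elim: n => [|n IH] xr; first by rewrite !big_ord0; exact: dil0.
rewrite !big_ord_recr /=; apply: dil_add => //; first exact: sumr_ge0.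
  by apply: IH => i ni; apply: xr; exact: ltnW.
exact: xr.
Qed.

Lemma dil_disk T r : disk T -> disk (dil T r).
Proof.
move=> dT; split; first by exists 0; exact: dil0.
move=> _ _ a b [t Tt ->] [s Ts ->] ab; exists (a *: t + b *: s); first exact: dT.2.
by rewrite scalerDr !scalerA ![_ * r%:C]mulrC.
Qed.

Lemma dil_scaleC T (a : R[i]) (s : R) x : disk T -> `|a| <= s%:C -> T x -> dil T s (a *: x).
Proof.
move=> dT as_ Tx; have s0 : 0 <= s by rewrite -(lecR 0); exact: le_trans (normr_ge0 a) as_.
move: s0; rewrite le_eqVlt => /predU1P[s0|s0].
  by move: as_; rewrite -s0 normr_le0 => /eqP ->; rewrite scale0r; exact: dil0.
rewrite -(mulr1 s); apply: dilZ => //; exact: dil1.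
Qed.

(** Convergence for the gauge of [B], stated by membership in [e B]; this avoids the infimum in
    [gauge] and a separate condition on the span. *)
Definition dcvg B (u : nat -> V) l := forall e : R, 0 < e ->
  exists N, forall n, (N <= n)%N -> dil B e (u n - l).

Lemma dcvg_mono T B u l : T `<=` B -> dcvg T u l -> dcvg B u l.
Proof.
move=> TB ul e /ul[N HN]; exists N => n /HN; exact: dil_mono.
Qed.

Lemma dcvgD B u v l m : disk B -> dcvg B u l -> dcvg B v m ->
  dcvg B (fun n => u n + v n) (l + m).
Proof.
move=> dB ul vm e e0; have e2 : 0 < e / 2 by rewrite divr_gt0.
have [N HN] := ul _ e2; have [M HM] := vm _ e2; exists (maxn N M) => n.
rewrite geq_max => /andP[/HN h1 /HM h2]; rewrite [e]splitr opprD addrACA.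
exact: dilD.
Qed.

Lemma dcvgZ B u l (a : R[i]) : disk B -> dcvg B u l -> dcvg B (fun n => a *: u n) (a *: l).
Proof.
move=> dB ul e e0; have [s s0 as_] := normC_bound a.
have [|N HN] := ul (e / s); first by rewrite divr_gt0.
exists N => n /HN h; rewrite -scalerBr (_ : e = s * (e / s)); first exact: dilZ.
by rewrite mulrC divfK // gt_eqF.
Qed.

Lemma dcvg_uniq B u l m : banach_disk B -> dcvg B u l -> dcvg B u m -> l = m.
Proof.
move=> bB ul um; have dB : disk B by case: bB.
apply/eqP; rewrite -subr_eq0; apply/eqP; apply: (banach_sep bB) => e e0.
have e2 : 0 < e / 2 by rewrite divr_gt0.
have [N HN] := ul _ e2; have [M HM] := um _ e2.
have -> : l - m = (u (maxn N M) - m) - (u (maxn N M) - l).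
  by rewrite opprB [RHS]addrC addrA subrK.
rewrite [e]splitr; apply: dil_sub => //; try exact: ltW.
  by apply: HM; exact: leq_maxr.
by apply: HN; exact: leq_maxl.
Qed.

Lemma dcvg_shift B u l k : dcvg B u l -> dcvg B (fun n => u (n - k)%N) l.
Proof.
move=> ul e /ul[N HN]; exists (N + k)%N => n Nn; apply: HN.
by rewrite leq_subRL ?(leq_trans _ Nn) ?leq_addl // addnC.
Qed.

(** [dil B r] need not be closed for the gauge of [B], so a limit of its points is only placed in
    every larger dilate. *)
Lemma dcvg_le B u l r : disk B -> 0 <= r -> (forall n, dil B r (u n)) -> dcvg B u l ->
  forall s, r < s -> dil B s l.
Proof.
move=> dB r0 ur ul s rs; have [|N /(_ N (leqnn N)) h] := ul (s - r); first by rewrite subr_gt0.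
have -> : l = u N - (u N - l) by rewrite opprB addrC subrK.
have -> : s = r + (s - r) by rewrite addrC subrK.
by apply: dil_sub => //; rewrite subr_ge0 ltW.
Qed.

Lemma half_pow (e : R) : 0 < e -> exists n, 2^-1 ^+ n <= e.
Proof.
move=> e0; have [n ne] : exists n : nat, e^-1 < n%:R.
  by exists (Num.bound e^-1); rewrite archi_boundP // invr_ge0 ltW.
exists n; rewrite exprVn -[leRHS]invrK lef_pV2 ?posrE ?invr_gt0 ?exprn_gt0 //.
rewrite (le_trans (ltW ne)) // -natrX ler_nat; exact/ltnW/ltn_expl.
Qed.

Lemma half_pow_le m n : (m <= n)%N -> 2^-1 ^+ n <= 2^-1 ^+ m :> R.
Proof. by move=> mn; rewrite ler_wiXn2l //; lra. Qed.

Lemma half_pow_gt0 n : 0 < 2^-1 ^+ n :> R.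
Proof. by rewrite exprn_gt0 // invr_gt0. Qed.

Lemma half_sum n : \sum_(i < n) 2^-1 ^+ i = 2 - 2 * 2^-1 ^+ n :> R.
Proof.
elim: n => [|n IH]; first by rewrite big_ord0 expr0 mulr1 subrr.
by rewrite big_ord_recr /= IH exprS; field.
Qed.

(** The half powers sum to at most 2, so the partial sums lie in [2 c B]. Passing to the limit by
    [dcvg_le] needs strictly more room, whence the constant 3. *)
Lemma series_cvg B (y : nat -> V) c : banach_disk B -> 0 < c ->
  (forall k, dil B (c * 2^-1 ^+ k) (y k)) ->
  exists l, dcvg B (fun n => \sum_(i < n) y i) l /\ dil B (3 * c) l.
Proof.
move=> bB c0 yc; have dB : disk B by case: bB.
have c2 k : 0 <= c * 2^-1 ^+ k by rewrite mulr_ge0 ?ltW ?half_pow_gt0.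
have tail N k : dil B (c * (2 * 2^-1 ^+ N)) (\sum_(i < N + k) y i - \sum_(i < N) y i).
  rewrite big_split_ord /= addrAC subrr add0r.
  apply: (@dil_le _ (\sum_(i < k) c * 2^-1 ^+ (N + i))) => //; last first.
    by apply: (@dil_sum B k (fun i => c * 2^-1 ^+ (N + i)) (fun i => y (N + i)%N)).
  rewrite sumr_ge0 //= -mulr_sumr ler_wpM2l ?ltW //.
  under eq_bigr do rewrite exprD.
  rewrite -mulr_sumr half_sum; have := half_pow_gt0 N; have := half_pow_gt0 k; nra.
have [|l Hl] := @banach_lim _ _ B (fun n => \sum_(i < n) y i) bB.
  move=> e e0; have [|N HN] := half_pow (e := e / (4 * c)).
    by rewrite divr_gt0 // mulr_gt0.
  exists N => m n Nm Nn; rewrite -(subnKC Nm) -(subnKC Nn).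
  set a := \sum_(_ < _) _; set b := \sum_(_ < _) _.
  have -> : a - b = (a - \sum_(i < N) y i) - (b - \sum_(i < N) y i).
    by rewrite opprB addrA subrK.
  apply: (@dil_le _ (c * (2 * 2^-1 ^+ N) + c * (2 * 2^-1 ^+ N))) => //; last first.
    by apply: dil_sub => //; try exact: tail; rewrite !mulr_ge0 ?ltW ?half_pow_gt0.
  apply/andP; split; first by rewrite addr_ge0 ?mulr_ge0 ?ltW ?half_pow_gt0.
  move: HN; rewrite ler_pdivlMr ?mulr_gt0 //; set p := _ ^+ N => HN.
  by apply: le_trans HN; rewrite le_eqVlt; apply/orP; left; apply/eqP; ring.
exists l; split => //; apply: (@dcvg_le B (fun n => \sum_(i < n) y i) l (2 * c)) => //; try lra.
  by move=> n; have := tail 0 n; rewrite big_ord0 subr0 add0n expr0 mulr1 [c * 2]mulrC.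
Qed.

End Dilations.

(** * Banach disks made of rapidly convergent series *)

Section SeriesHull.
Context {R : realType} {V : lmodType R[i]}.
Implicit Types (T B G A : set V) (x : V).

Definition ahull A : set V := [set x | exists n (c : 'I_n -> R[i]) (a : 'I_n -> V),
  [/\ forall i, A (a i), \sum_(i < n) `|c i| <= 1 & x = \sum_(i < n) c i *: a i]].

Lemma sub_ahull A : A `<=` ahull A.
Proof.
move=> a Aa; exists 1%N, (fun=> 1), (fun=> a).
by split => //; rewrite big_ord1 ?normr1 ?scale1r.
Qed.

Lemma ahull_disk A : disk (ahull A).
Proof.
split; first by exists 0, 0%N, (fun=> 0), (fun=> 0); split => [[]//||];
  rewrite big_ord0 ?ler01.
move=> _ _ a b [n [c [x [Ax c1 ->]]]] [m [d [y [Ay d1 ->]]]] ab.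
exists (n + m)%N, (fun i => match fintype.split i with inl j => a * c j | inr j => b * d j end),
  (fun i => match fintype.split i with inl j => x j | inr j => y j end).
have sl (j : 'I_n) : fintype.split (lshift m j) = inl j by exact: (unsplitK (inl j)).
have sr (j : 'I_m) : fintype.split (rshift n j) = inr j by exact: (unsplitK (inr j)).
split.
- by move=> i; case: fintype.split.
- rewrite big_split_ord /=.
  under eq_bigr do rewrite sl normrM.
  under [X in _ + X]eq_bigr do rewrite sr normrM.
  rewrite -!mulr_sumr; apply: le_trans ab.
  by apply: lerD; rewrite ler_piMr.
- rewrite big_split_ord /=.
  under [X in _ = X + _]eq_bigr do rewrite sl -scalerA.
  under [X in _ = _ + X]eq_bigr do rewrite sr -scalerA.
  by rewrite !scaler_sumr.
Qed.

Lemma ahull_min A T : disk T -> A `<=` T -> ahull A `<=` T.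
Proof.
move=> dT AT _ [n [c [a [Aa c1 ->]]]].
pose r i := complex.Re `|c i|.
have cr i : `|c i| = (r i)%:C by rewrite /r normc_def.
have r0 i : 0 <= r i by rewrite -(lecR 0) -cr; exact: normr_ge0.
apply: dil1E; apply: (@dil_le _ _ _ (\sum_(i < n) r i)) => //.
  rewrite sumr_ge0 //= -leC1 rmorph_sum /=.
  by under eq_bigr do rewrite -cr.
clear c1; have {}Aa i : T (a i) by exact/AT/Aa.
elim: n c a r cr r0 Aa => [|n IH] c a r cr r0 Aa; first by rewrite !big_ord0; exact: dil0.
rewrite !big_ord_recr /=; apply: dil_add => //; first exact: sumr_ge0.
  by apply: IH.
by apply: dil_scaleC => //; rewrite cr.
Qed.

Lemma ahull_sub A A' : A `<=` A' -> ahull A `<=` ahull A'.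
Proof.
by move=> AA'; apply: ahull_min; [exact: ahull_disk | move=> x /AA'; exact: sub_ahull].
Qed.

(* Sums of series with k-th term in 4^-k G. Unlike the closure of G in B, this is
   again a Banach disk for its own gauge. *)
Definition shull G B : set V := [set x | exists y : nat -> V,
  (forall k, dil G (4^-1 ^+ k) (y k)) /\ dcvg B (fun n => \sum_(i < n) y i) x].

Lemma dil_shull G B r x : disk B -> 0 < r ->
  dil (shull G B) r x <-> exists y : nat -> V,
    (forall k, dil G (r * 4^-1 ^+ k) (y k)) /\ dcvg B (fun n => \sum_(i < n) y i) x.
Proof.
move=> dB r0; split=> [[t [y [Gy yt]] ->]|[y [Gy yx]]].
  exists (fun k => r%:C *: y k); split=> [k|]; first exact: dil_scale.
  under eq_fun do rewrite -scaler_sumr.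
  exact: dcvgZ.
exists (r^-1%:C *: x); last by rewrite scalerA -realCM divff ?gt_eqF // scale1r.
exists (fun k => r^-1%:C *: y k); split=> [k|].
  by rewrite -(mulKf (lt0r_neq0 r0) (4^-1 ^+ k)); exact: dil_scale.
under eq_fun do rewrite -scaler_sumr.
exact: dcvgZ.
Qed.

Lemma shull_mono G G' B B' : G `<=` G' -> B `<=` B' -> shull G B `<=` shull G' B'.
Proof.
move=> GG BB x [y [Gy yx]]; exists y; split; last exact: dcvg_mono yx.
by move=> k; exact: dil_mono (Gy k).
Qed.

Lemma quarter_gt0 k : 0 < 4^-1 ^+ k :> R.
Proof. by rewrite exprn_gt0 // invr_gt0. Qed.

Lemma quarter_le k : 4^-1 ^+ k <= 2^-1 ^+ k :> R.
Proof. by rewrite lerXn2r ?nnegrE //; lra. Qed.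

Section Banach.
Variables (G B : set V).
Hypotheses (dG : disk G) (bB : banach_disk B) (GB : G `<=` B).

Let dB : disk B. Proof. by case: bB. Qed.

Lemma sub_shull : G `<=` shull G B.
Proof.
move=> x Gx; exists (fun k => if k == 0%N then x else 0); split=> [[|k]|].
- by rewrite expr0; exact: dil1.
- exact: dil0.
- move=> e e0; exists 1%N => -[//|n] _; rewrite big_ord_recl /= big1 // addr0 subrr.
  exact: dil0.
Qed.

(** Quarter powers are dominated by half powers, so [series_cvg] applies with [c = 1]; 3 is its
    constant. *)
Lemma shull_bnd : shull G B `<=` dil B 3.
Proof.
move=> x [y [Gy yx]].
have [|k|l [yl l3]] := @series_cvg R V B y 1 bB; first exact: ltr01.
  apply: (@dil_le _ _ _ (4^-1 ^+ k)) => //; last exact: dil_mono (Gy k).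
  by rewrite mul1r quarter_le ltW ?quarter_gt0.
by rewrite (dcvg_uniq bB yx yl) -(mulr1 3).
Qed.

Lemma shull_disk : disk (shull G B).
Proof.
split; first by exists 0; apply: sub_shull; exact: disk0.
move=> x1 x2 a b [y1 [G1 c1]] [y2 [G2 c2]] ab.
exists (fun k => a *: y1 k + b *: y2 k); split=> [k|].
  by apply: (dil_disk _ dG).2.
under eq_fun do rewrite big_split /= -!scaler_sumr.
by apply: dcvgD => //; exact: dcvgZ.
Qed.

(* Diagonal summation: the double series is summed along i + j = n. *)
Lemma shull_series (v : nat -> V) : (forall j, dil (shull G B) (8^-1 ^+ j) (v j)) ->
  exists l, forall J, dil (shull G B) (3 * 2^-1 ^+ J) (l - \sum_(j < J) v j).
Proof.
move=> vG.
have e8 j : 0 < 8^-1 ^+ j :> R by rewrite exprn_gt0 // invr_gt0.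
have /choice[y Hy] : forall j, exists y : nat -> V,
    (forall k, dil G (8^-1 ^+ j * 4^-1 ^+ k) (y k)) /\ dcvg B (fun n => \sum_(i < n) y i) (v j).
  by move=> j; apply/dil_shull.
(* The [n]-th antidiagonal sum of the double series, with the rows [j < J] deleted. *)
pose z J n := \sum_(j < n.+1) (if (J <= j)%N then y j (n - j)%N else 0).
(* On the antidiagonal [8^-j 4^-(n-j) = 2^-j 4^-n]: the rate 8 for [v] leaves a geometric factor,
   whose sum over [j >= J] is at most [2 2^-J]. *)
have zG J n : dil G (3 * 2^-1 ^+ J * 4^-1 ^+ n) (z J n).
  pose r j : R := if (J <= j)%N then 2^-1 ^+ j * 4^-1 ^+ n else 0.
  have r0 j : 0 <= r j.
    by rewrite /r; case: ifP => // _; rewrite mulr_ge0 // ltW ?half_pow_gt0 ?quarter_gt0.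
  have sr m : \sum_(j < m) r j <= (2 * 2^-1 ^+ J - 2 * 2^-1 ^+ (maxn J m)) * 4^-1 ^+ n.
    elim: m => [|m IH]; first by rewrite big_ord0 maxn0 subrr mul0r.
    rewrite big_ord_recr /=; apply: le_trans (lerD IH (lexx _)) _.
    rewrite /r; case: ifP => [Jm|/negbT]; last rewrite -ltnNge => Jm.
      rewrite (maxn_idPr Jm) (maxn_idPr (leqW Jm)) -mulrDl ler_wpM2r //.
        by rewrite ltW // quarter_gt0.
      by rewrite exprS; have := half_pow_gt0 (R := R) m; lra.
    by rewrite (maxn_idPl (ltnW Jm)) (maxn_idPl Jm) addr0.
  apply: (@dil_le _ _ _ (\sum_(j < n.+1) r j)) => //.
    apply/andP; split; first exact: sumr_ge0.
    apply: le_trans (sr _) _; rewrite ler_wpM2r ?ltW ?quarter_gt0 //.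
    have := half_pow_gt0 (R := R) J; have := half_pow_gt0 (R := R) (maxn J n.+1); lra.
  apply: (@dil_sum _ _ G n.+1 r (fun j => if (J <= j)%N then y j (n - j)%N else 0)) => //.
  move=> j jn; rewrite /r; case: ifP => _; last exact: dil0.
  apply: (@dil_le _ _ _ (8^-1 ^+ j * 4^-1 ^+ (n - j))) => //; last by case: (Hy j).
  apply/andP; split; first by rewrite mulr_ge0 // ltW ?e8 ?quarter_gt0.
  have -> : n = (j + (n - j))%N :> nat by rewrite subnKC.
  rewrite addKn exprD mulrA -exprMn (_ : 2^-1 * 4^-1 = 8^-1) //.
  by rewrite -invfM; congr (_^-1); ring.
have /choice[L HL] : forall J, exists L, dcvg B (fun n => \sum_(i < n) z J i) L.
  move=> J; have [||l [? _]] := @series_cvg R V B (z J) (3 * 2^-1 ^+ J) bB; last by exists l.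
    by rewrite mulr_gt0 // half_pow_gt0.
  move=> k; apply: (@dil_le _ _ _ (3 * 2^-1 ^+ J * 4^-1 ^+ k)) => //; last exact: dil_mono (zG J k).
  apply/andP; split; first by rewrite !mulr_ge0 // ltW ?half_pow_gt0 ?quarter_gt0.
  by rewrite ler_wpM2l ?quarter_le // mulr_ge0 // ltW // half_pow_gt0.
have LG J : dil (shull G B) (3 * 2^-1 ^+ J) (L J).
  apply/dil_shull => //; first by rewrite mulr_gt0 // half_pow_gt0.
  by exists (z J).
(* [L J] is the sum of the rows from [J] on. Row [J] enters at antidiagonal [J], so its partial sums
   are shifted by [J] when it is split off. *)
have LS J : L J = v J + L J.+1.
  apply: (dcvg_uniq bB (HL J)).
  have : dcvg B (fun n => \sum_(i < n - J) y J i + \sum_(i < n) z J.+1 i) (v J + L J.+1).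
    by apply: dcvgD => //; exact: (dcvg_shift J (Hy J).2).
  congr dcvg; apply/funext => n; elim: n => [|n IH]; first by rewrite !big_ord0 addr0.
  rewrite [X in _ + X]big_ord_recr [in RHS]big_ord_recr /= -IH.
  have zS : z J n = (if (J <= n)%N then y J (n - J)%N else 0) + z J.+1 n.
    rewrite /z; case: (leqP J n) => Jn.
      rewrite (bigD1 (Ordinal (Jn : (J < n.+1)%N))) //= leqnn.
      rewrite [in RHS](bigD1 (Ordinal (Jn : (J < n.+1)%N))) //= ltnn add0r.
      congr (_ + _); apply: eq_bigr => j; rewrite -val_eqE /= => jJ.
      by rewrite [(J < j)%N]ltn_neqAle eq_sym jJ.
    rewrite add0r; apply: eq_bigr => j _.
    have jJ : (j < J)%N := leq_trans (ltn_ord j) Jn.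
    by rewrite [(J <= j)%N]leqNgt jJ [(J < j)%N]ltnNge (ltnW jJ).
  rewrite zS; case: ifP => [Jn|/negbT].
    by rewrite subSn // big_ord_recr /= -!addrA; congr (_ + _); rewrite addrCA.
  rewrite -ltnNge => nJ; have /eqP -> : (n.+1 - J == 0)%N by rewrite subn_eq0.
  have /eqP -> : (n - J == 0)%N by rewrite subn_eq0 ltnW.
  by rewrite !big_ord0 !add0r.
exists (L 0%N) => J; rewrite (_ : _ - _ = L J) //.
elim: J => [|J IH]; first by rewrite big_ord0 subr0.
by rewrite big_ord_recr /= opprD addrA IH LS addrC addrA addNr add0r.
Qed.

(** Separation is inherited from [B] because the hull lies in [3 B]. For completeness, a Cauchy
    sequence is thinned out until its increments satisfy the hypothesis of [shull_series]. *)
Lemma shull_banach : banach_disk (shull G B).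
Proof.
have dS := shull_disk; apply: banach_diskI => //.
  move=> x xs; apply: (banach_sep bB) => e e0.
  have e3 : 0 < e / 3 by rewrite divr_gt0.
  rewrite -(divfK (x := 3) _ e) ?pnatr_eq0 //.
  by apply: dil_dil; apply: dil_mono (xs _ e3); exact: shull_bnd.
move=> u uC.
have e8 j : 0 < 8^-1 ^+ j :> R by rewrite exprn_gt0 // invr_gt0.
have /choice[N HN] : forall j, exists N, forall m n, (N <= m)%N -> (N <= n)%N ->
    dil (shull G B) (8^-1 ^+ j) (u m - u n).
  by move=> j; exact: uC.
(* The maximum over all earlier indices makes [k] nondecreasing, so both ends of the [j]-th
   increment lie beyond [N j]. *)
pose k j := (\max_(i < j.+1) N i)%N.
have kN j : (N j <= k j)%N by apply: (@leq_bigmax _ (fun i : 'I_j.+1 => N i) ord_max).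
have kS j : (k j <= k j.+1)%N by rewrite {2}/k big_ord_recr /= leq_maxl.
have [j|l Hl] := @shull_series (fun j => u (k j.+1) - u (k j)).
  by apply: HN => //; exact: leq_trans (kS j).
have tele J : \sum_(j < J) (u (k j.+1) - u (k j)) = u (k J) - u (k 0%N).
  elim: J => [|J IH]; first by rewrite big_ord0 subrr.
  by rewrite big_ord_recr /= IH addrC addrA subrK.
exists (l + u (k 0%N)) => e e0.
have [J HJ] := half_pow (divr_gt0 e0 (ltr0n _ 4)).
exists (k J) => n kn.
have -> : u n - (l + u (k 0%N)) = (u n - u (k J)) - (l - (u (k J) - u (k 0%N))).
  by rewrite opprB [RHS]addrA [X in _ = X - _]addrA subrK opprD addrA addrAC.
rewrite -tele.
have p0 := half_pow_gt0 (R := R) J.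
apply: (@dil_le _ _ _ (8^-1 ^+ J + 3 * 2^-1 ^+ J)) => //.
  apply/andP; split; first by rewrite addr_ge0 ?mulr_ge0 // ltW.
  have : 8^-1 ^+ J <= 2^-1 ^+ J :> R by rewrite lerXn2r ?nnegrE //; lra.
  by move: HJ; rewrite ler_pdivlMr //; lra.
apply: dil_sub => //; rewrite ?mulr_ge0 // ?ltW //.
by apply: HN => //; exact: leq_trans kn.
Qed.

End Banach.

End SeriesHull.

(** * Totally bounded sets *)

Section TotallyBounded.
Context {R : realType} {V : bornType R}.
Implicit Types (T A K S : set V) (x : V) (u : nat -> V).

(** The centres [z i] are arbitrary vectors, so a net can be reused for another set close to [A]. *)
Definition tbounded T A := forall e : R, 0 < e -> exists n (z : nat -> V),
  forall a, A a -> exists2 i, (i < n)%N & dil T e (a - z i).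

(** The net is the grid [-1, -1 + d, ...], and [x] is matched with the grid point just below it. *)
Lemma interval_net (d : R) : 0 < d -> exists n (z : nat -> R),
  forall x : R, `|x| <= 1 -> exists2 i, (i < n)%N & `|x - z i| <= d.
Proof.
move=> d0; exists (Num.truncn (2 / d)).+1, (fun i => i%:R * d - 1) => x.
rewrite ler_norml => /andP[x1 x2]; have x0 : 0 <= (x + 1) / d by rewrite divr_ge0 ?(ltW d0) //; lra.
exists (Num.truncn ((x + 1) / d)).
  by rewrite ltnS; apply: le_truncn; rewrite ler_pM2r ?invr_gt0 //; lra.
have /andP[] := truncn_itv x0; rewrite ler_pdivlMr // ltr_pdivrMr // -natr1 [X in _ < X]mulrDl mul1r.
rewrite ler_norml; set t := _ * d => h1 h2.
 apply/andP; split; lra.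
Qed.

Lemma normC_le_ReIm (z : R[i]) : `|z| <= (`|complex.Re z| + `|complex.Im z|)%:C.
Proof.
case: z => a b /=; rewrite normc_def /= lecR -[leRHS]ger0_norm ?addr_ge0 //.
rewrite -sqrtr_sqr ler_wsqrtr // sqrrD !real_normK ?num_real // addrAC lerDl.
by rewrite mulrn_wge0 // mulr_ge0.
Qed.

Lemma disc_net (d : R) : 0 < d -> exists n (z : nat -> R[i]),
  forall c : R[i], `|c| <= 1 -> exists2 i, (i < n)%N & `|c - z i| <= d%:C.
Proof.
move=> d0; have [n [z Hz]] := interval_net (divr_gt0 d0 (ltr0n _ 2)).
exists (n * n)%N, (fun i => (z (i %/ n)%N +i* z (i %% n)%N)%C) => c c1.
have [/Hz[i ni Hi] /Hz[j nj Hj]] := normC_ReIm (c1 : `|c| <= 1%:C).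
have n0 : (0 < n)%N by exact: leq_ltn_trans ni.
exists (i * n + j)%N.
  by rewrite (@leq_trans (i * n + n)%N) ?ltn_add2l // -mulSnr leq_pmul2r.
rewrite divnMDl // divn_small // addn0 modnMDl modn_small //.
case: c c1 Hi Hj => a b _ /= Hi Hj; apply: le_trans (normC_le_ReIm _) _.
by rewrite lecR /= [d]splitr lerD.
Qed.

(** The enlarged disk is the sum of [K] and the disc of multiples [c p] with [|c| <= 1]; nets of the
    two summands are added. *)
Lemma tbounded_point T K p : disk T -> T p -> disk K -> tbounded T K ->
  exists K', [/\ disk K', tbounded T K', K `<=` K' & K' p].
Proof.
move=> dT Tp dK tK.
exists [set x | exists k c, [/\ K k, `|c| <= 1 & x = k + c *: p]]; split.
- split; first by exists 0, 0, 0; split; [exact: disk0 | rewrite normr0 | rewrite scale0r addr0].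
  move=> _ _ a b [k [c [Kk c1 ->]]] [l [d [Kl d1 ->]]] ab.
  exists (a *: k + b *: l), (a * c + b * d); split.
  + exact: dK.2.
  + apply: le_trans ab; apply: le_trans (ler_normD _ _) _.
    by rewrite !normrM; apply: lerD; rewrite ler_piMr.
  + by rewrite scalerDl !scalerDr !scalerA addrACA.
- move=> e e0; have e2 := divr_gt0 e0 (ltr0n R 2).
  have [n [z Hz]] := tK _ e2; have [m [w Hw]] := disc_net e2.
  exists (n * m)%N, (fun i => z (i %/ m)%N + w (i %% m)%N *: p).
  move=> _ [k [c [/Hz[i ni Hi] /Hw[j mj Hj] ->]]].
  have m0 : (0 < m)%N by exact: leq_ltn_trans mj.
  exists (i * m + j)%N.
    by rewrite (@leq_trans (i * m + m)%N) ?ltn_add2l // -mulSnr leq_pmul2r.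
  rewrite divnMDl // divn_small // addn0 modnMDl modn_small //.
  rewrite opprD addrACA -scalerBl [e]splitr; apply: dil_add => //; try exact: ltW.
  exact: dil_scaleC.
- by move=> k Kk; exists k, 0; rewrite normr0 scale0r addr0 ler01.
- by exists 0, 1; rewrite normr1 scale1r add0r; split => //; exact: disk0.
Qed.

Lemma tbounded_points T (n : nat) (p : nat -> V) K : disk T -> (forall i, T (p i)) ->
  disk K -> tbounded T K ->
  exists K', [/\ disk K', tbounded T K', K `<=` K' & forall i, (i < n)%N -> K' (p i)].
Proof.
move=> dT Tp dK tK; elim: n => [|n [K1 [dK1 tK1 KK1 pK1]]]; first by exists K; split.
have [K2 [dK2 tK2 K12 pK2]] := tbounded_point dT (Tp n) dK1 tK1.
exists K2; split => // [k /KK1/K12 //|i].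
by rewrite ltnS leq_eqVlt => /predU1P[->//|/pK1/K12].
Qed.

Section Compact.
Variables (T S : set V).
Hypotheses (bT : banach_disk T) (ST : S `<=` lspan T) (tS : tbounded T S).
Hypothesis closedS : forall u l, (forall n, S (u n)) -> dcvg T u l -> S l.
Let dT : disk T. Proof. by case: bT. Qed.

Let fincov (F : set (set V)) A := exists n (U : nat -> set V),
  (forall i, (i < n)%N -> F (U i)) /\ forall x, A x -> exists2 i, (i < n)%N & U i x.

Let fincovU F A B : fincov F A -> fincov F B -> fincov F (A `|` B).
Proof.
move=> [n [U [FU AU]]] [m [W [FW BW]]].
exists (n + m)%N, (fun i => if (i < n)%N then U i else W (i - n)%N); split=> [i|x].
  by case: ifP => [/FU //|/negbT]; rewrite -leqNgt => ni im; apply: FW; rewrite ltn_subLR.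
case=> [/AU[i ni Ui]|/BW[i ni Wi]].
  by exists i; rewrite ?ni // ltn_addr.
by exists (n + i)%N; rewrite ?ltn_add2l // ifN ?addKn // -leqNgt leq_addr.
Qed.

(** A net cuts [A] into finitely many pieces of radius [e / 2]. If each of them had a finite
    subcover, their union [A] would have one. *)
Let bad_step F A e : 0 < e -> A `<=` S -> ~ fincov F A ->
  exists B, [/\ B `<=` A, ~ fincov F B & forall x y, B x -> B y -> dil T e (x - y)].
Proof.
move=> e0 AS bA; have e2 := divr_gt0 e0 (ltr0n R 2).
have [n [z Hz]] := tS e2.
apply: contrapT => H; apply: bA.
have step m : fincov F [set x | A x /\ exists2 i, (i < m)%N & dil T (e / 2) (x - z i)].
  elim: m => [|m IH]; first by exists 0%N, (fun=> set0); split => // x [_ []].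
  have /(fincovU IH) : fincov F [set x | A x /\ dil T (e / 2) (x - z m)].
    apply: contrapT => bm; apply: H; eexists; split; [|exact: bm|].
      by move=> x [].
    move=> x y [_ xz] [_ yz]; rewrite (_ : x - y = (x - z m) - (y - z m)).
      by rewrite [e]splitr; apply: dil_sub => //; exact: ltW.
    by rewrite opprB addrA subrK.
  move=> [k [U [FU HU]]]; exists k, U; split => // x [Ax [i im xz]].
  move: im xz; rewrite ltnS leq_eqVlt => /predU1P[->|im] xz; apply: HU; first by right.
  by left; split => //; exists i.
have [k [U [FU HU]]] := step n; exists k, U; split => // x Ax.
by apply: HU; split => //; exact/Hz/AS.
Qed.

(** Iterating [bad_step] gives nested sets without finite subcover whose diameters tend to 0. Points
    chosen in them converge to a point of the closed set [S], and one open set around the limit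
    contains a late member of the sequence. *)
Lemma tbounded_compact : gauge_compact T S.
Proof.
split => // F Fo SF; apply: contrapT => H.
have bS : ~ fincov F S.
  move=> [n [U [FU SU]]]; apply: H; exists n, (fun i => U i); split => [i|x /SU[i ni Ui]].
    exact: FU.
  by exists (Ordinal ni).
(* The conditions are premises of the conclusion, so [f] is total on pairs of a set and a stage and
   can be iterated. *)
have /choice[f Hf] : forall Ae : set V * nat, exists B, Ae.1 `<=` S -> ~ fincov F Ae.1 ->
    [/\ B `<=` Ae.1, ~ fincov F B & forall x y, B x -> B y -> dil T (2^-1 ^+ Ae.2) (x - y)].
  move=> [A k]; have [AS|nAS] := pselect (A `<=` S); last by exists A => /nAS.
  have [bA|nbA] := pselect (~ fincov F A); last by exists A => _ /nbA.
  by have [B HB] := bad_step (half_pow_gt0 k) AS bA; exists B.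
pose A := fix A k := if k is k'.+1 then f (A k', k') else S.
have HA k : A k `<=` S /\ ~ fincov F (A k).
  elim: k => [|k [AS bA]] /=; first by split.
  have [BA bB _] := Hf (A k, k) AS bA.
  by split => // x /BA/AS.
have AA k m : (k <= m)%N -> A m `<=` A k.
  elim: m => [|m IH]; first by rewrite leqn0 => /eqP ->.
  rewrite leq_eqVlt => /predU1P[-> //|]; rewrite ltnS => /IH; apply: subset_trans.
  by have [AS bA] := HA m; have [BA _ _] := Hf (A m, m) AS bA.
have Ad k x y : A k.+1 x -> A k.+1 y -> dil T (2^-1 ^+ k) (x - y).
  by have [AS bA] := HA k; have [_ _] := Hf (A k, k) AS bA; apply.
have /choice[u Hu] : forall k, exists x, A k x.
  move=> k; apply: contrapT => Ax; case: (HA k) => _; apply.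
  by exists 0%N, (fun=> set0); split => // x kx; case: Ax; exists x.
have [|l Hl] := banach_lim (u := u) bT.
  move=> e /half_pow[k ke]; exists k.+1 => m n km kn.
  apply: (@dil_le _ _ _ (2^-1 ^+ k)) => //; first by rewrite ke ltW // half_pow_gt0.
  by apply: Ad; [exact: AA (Hu m) | exact: AA (Hu n)].
have Sl : S l by apply: closedS Hl => n; exact: (HA n).1.
have [U FU Ul] := SF _ Sl; have [UT Uo] := Fo _ FU; have [e e0 He] := Uo _ Ul.
have e4 : 0 < e / 4 by rewrite divr_gt0.
have [N HN] := Hl _ e4; have [k ke] := half_pow e4.
have [_] := HA (maxn N k).+1; apply; exists 1%N, (fun=> U); split => // x Ax.
exists 0%N => //.
have xl : dil T (e / 2) (x - l).
  have -> : x - l = (x - u (maxn N k).+1) + (u (maxn N k).+1 - l) by rewrite addrA subrK.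
  apply: (@dil_le _ _ _ (e / 4 + e / 4)) => //; first by apply/andP; split; lra.
  apply: dil_add => //; try exact: ltW; last first.
    by apply: HN; rewrite (leq_trans (leq_maxl N k)).
  apply: (@dil_le _ _ _ (2^-1 ^+ maxn N k)) => //; last exact: Ad.
  apply/andP; split; first by rewrite ltW // half_pow_gt0.
  by apply: le_trans ke; apply: half_pow_le; exact: leq_maxr.
apply: He; last by apply: le_lt_trans (gauge_dil _ xl) _; lra.
exact/ST/(HA (maxn N k).+1).1.
Qed.

End Compact.

(* S is the closed absolutely convex hull of the null sequence 2^-k p k i. *)
Lemma null_hull_compact T (n : nat -> nat) (p : nat -> nat -> V) : banach_disk T ->
  (forall k i, T (p k i)) ->
  exists S, [/\ disk S, gauge_compact T S &
    forall k i, (i < n k)%N -> S ((2^-1 ^+ k)%:C *: p k i)].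
Proof.
move=> bT Tp; have dT : disk T by case: bT.
pose A : set V := [set x | exists k i, (i < n k)%N /\ x = (2^-1 ^+ k)%:C *: p k i].
have AT : ahull A `<=` T.
  apply: ahull_min => // _ [k [i [_ ->]]]; apply: dil1E.
  apply: (@dil_le _ _ _ (2^-1 ^+ k)) => //; last by exists (p k i).
  by rewrite ltW ?half_pow_gt0 // -(expr0 2^-1) half_pow_le.
have blocks N : exists K, [/\ disk K, tbounded T K &
    forall k i, (k < N)%N -> (i < n k)%N -> K ((2^-1 ^+ k)%:C *: p k i)].
  elim: N => [|N [K [dK tK HK]]].
    exists [set 0]; split => //; last first.
      move=> e e0; exists 1%N, (fun=> 0) => _ ->; exists 0%N => //.
      by rewrite subrr; exact: dil0.
    by split; [exists 0 | move=> _ _ a b -> ->; rewrite !scaler0 addr0].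
  have [i|K' [dK' tK' KK' pK']] :=
    @tbounded_points T (n N) (fun i => (2^-1 ^+ N)%:C *: p N i) K dT _ dK tK.
    apply: diskZ => //; rewrite normCr ?(ltW (half_pow_gt0 _)) // leC1.
    by rewrite -(expr0 2^-1) half_pow_le.
  exists K'; split => // k i; rewrite ltnS leq_eqVlt => /predU1P[->|kN] ik; first exact: pK'.
  exact/KK'/HK.
have tA : tbounded T (ahull A).
  move=> e e0; have e2 := divr_gt0 e0 (ltr0n R 2); have [N HN] := half_pow e2.
  have [K [dK tK HK]] := blocks N; have [m [z Hz]] := tK _ e2; exists m, z.
  (* [M] is [K + 2^-N T]: [K] takes the blocks before [N], and the later ones already lie in
     [2^-N T]. *)
  pose M : set V := [set x | exists k y, [/\ K k, dil T (2^-1 ^+ N) y & x = k + y]].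
  have dM : disk M.
    split; first by exists 0, 0, 0; rewrite addr0; split => //; [exact: disk0 | exact: dil0].
    move=> _ _ a b [k [x [Kk Tx ->]]] [l [y [Kl Ty ->]]] ab.
    exists (a *: k + b *: l), (a *: x + b *: y); rewrite !scalerDr addrACA; split => //.
      exact: dK.2.
    exact: (dil_disk _ dT).2.
  have AM : ahull A `<=` M.
    apply: ahull_min => // _ [k [i [ik ->]]]; have [kN|Nk] := ltnP k N.
      exists ((2^-1 ^+ k)%:C *: p k i), 0; rewrite addr0; split => //; first exact: HK.
      exact: dil0.
    exists 0, ((2^-1 ^+ k)%:C *: p k i); rewrite add0r; split => //; first exact: disk0.
    apply: (@dil_le _ _ _ (2^-1 ^+ k)) => //; last by exists (p k i).
    by rewrite half_pow_le // ltW // half_pow_gt0.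
  move=> _ /AM[k [y [/Hz[i im Hi] Ty ->]]]; exists i => //.
  rewrite addrAC [e]splitr; apply: dil_add => //; try exact: ltW.
  apply: (@dil_le _ _ _ (2^-1 ^+ N)) => //.
  by rewrite HN ltW // half_pow_gt0.
pose S : set V := [set v | forall e : R, 0 < e -> exists2 h, ahull A h & dil T e (v - h)].
have AS : ahull A `<=` S by move=> h Ah e e0; exists h => //; rewrite subrr; exact: dil0.
exists S; split.
- split; first by exists 0; apply: AS; exact: disk0 (ahull_disk A).
  move=> x y a b Sx Sy ab e e0; have [h Ah xh] := Sx e e0; have [g Ag yg] := Sy e e0.
  exists (a *: h + b *: g); first by apply: (ahull_disk A).2.
  by rewrite opprD addrACA -!scalerBr; apply: (dil_disk _ dT).2.
- apply: tbounded_compact => //.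
  + move=> v /(_ 1 ltr01)[h /AT Th vh]; apply/lspan_dil => //; exists (1 + 1).
      exact: addr_gt0.
    rewrite -(subrK h v); apply: dil_add => //; exact: dil1.
  + move=> e e0; have e2 := divr_gt0 e0 (ltr0n R 2); have [m [z Hz]] := tA _ e2.
    exists m, z => v /(_ _ e2)[h /Hz[i im hz] vh]; exists i => //.
    rewrite -(subrK h v) -addrA [e]splitr; apply: dil_add => //; exact: ltW.
  + move=> u l Su ul e e0; have e2 := divr_gt0 e0 (ltr0n R 2).
    have [N /(_ N (leqnn N)) HN] := ul _ e2; have [h Ah uh] := Su N _ e2; exists h => //.
    rewrite (_ : l - h = (u N - h) - (u N - l)); last by rewrite opprB [RHS]addrC addrA subrK.
    rewrite [e]splitr; apply: dil_sub => //; exact: ltW.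
- by move=> k i ik; apply/AS/sub_ahull; exists k, i.
Qed.

End TotallyBounded.

(** * Elements of the completed tensor product *)

Section TensorSeries.
Context {R : realType} (TP : tensor_products R) (V W : bornType R).
Local Notation "V ⊗ W" := (ct_space (TP V W)) (at level 40, left associativity).
Local Notation "v ⊠ w" := (tens TP v w) (at level 40, left associativity).

Definition pures (S : set V) (T : set W) : set (V ⊗ W) := [set v ⊠ w | v in S & w in T].

(** [S] is a Banach disk because the first legs of a series will be enclosed in a compact disk of
    its span; [B] is the ambient disk in which the series converges. *)
Definition tframe (S : set V) (T : set W) (B : set (V ⊗ W)) :=
  [/\ small S /\ banach_disk S, small T, small B /\ banach_disk B & pures S T `<=` B].

Definition tball S T B : set (V ⊗ W) := shull (ahull (pures S T)) B.

Lemma ahull_tframe S T B : tframe S T B -> ahull (pures S T) `<=` B.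
Proof. by move=> [_ _ [_ [dB _ _]] PB]; exact: ahull_min. Qed.

Lemma tball_banach S T B : tframe S T B -> banach_disk (tball S T B).
Proof.
move=> F; have PB := ahull_tframe F; case: F => _ _ [_ bB] _.
by apply: shull_banach => //; exact: ahull_disk.
Qed.

Lemma tball_disk S T B : tframe S T B -> disk (tball S T B).
Proof. by case/tball_banach. Qed.

Lemma tball_pure S T B v w : tframe S T B -> S v -> T w -> tball S T B (v ⊠ w).
Proof.
move=> [_ _ [_ bB] _] Sv Tw; apply: sub_shull => //; first exact: ahull_disk.
by apply: sub_ahull; exists v => //; exists w.
Qed.

Lemma tframe_ex (S : set V) (T : set W) (B : set (V ⊗ W)) : small S -> small T -> small B ->
  exists S' T' B', [/\ tframe S' T' B', S `<=` S', T `<=` T' & B `<=` B'].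
Proof.
move=> /small_complete[S' [sS' bS' SS']] sT sB.
have [B' [sB' bB' BB']] := small_complete (smallU sB (bbil_bnd (tens TP) sS' sT)).
exists S', T, B'; split => //; last by move=> x Bx; apply: BB'; left.
by split => // x Px; apply: BB'; right.
Qed.

Lemma pures_mono S S' T T' : S `<=` S' -> T `<=` T' -> pures S T `<=` pures S' T'.
Proof. by move=> SS TT _ [v Sv [w Tw <-]]; exists v; [exact: SS | exists w => //; exact: TT]. Qed.

Lemma tball_mono S S' T T' B B' : S `<=` S' -> T `<=` T' -> B `<=` B' ->
  tball S T B `<=` tball S' T' B'.
Proof. by move=> SS TT; apply: shull_mono; apply: ahull_sub; exact: pures_mono. Qed.

Lemma tframe2 S1 T1 B1 S2 T2 B2 : tframe S1 T1 B1 -> tframe S2 T2 B2 ->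
  exists S T B, [/\ tframe S T B, tball S1 T1 B1 `<=` tball S T B &
                    tball S2 T2 B2 `<=` tball S T B].
Proof.
move=> [[sS1 _] sT1 [sB1 _] _] [[sS2 _] sT2 [sB2 _] _].
have [S [T [B [F SS TT BB]]]] := tframe_ex (smallU sS1 sS2) (smallU sT1 sT2) (smallU sB1 sB2).
exists S, T, B; split => //.
  by apply: tball_mono => x h; [apply: SS|apply: TT|apply: BB]; left.
by apply: tball_mono => x h; [apply: SS|apply: TT|apply: BB]; right.
Qed.

Definition tser (x : V ⊗ W) := exists S T B, tframe S T B /\
  exists2 r : R, 0 < r & dil (tball S T B) r x.

Definition tser_pred : {pred V ⊗ W} := [pred x | `[< tser x >]].

Lemma tser_submod : submod_closed tser_pred.
Proof.
split.
  apply/asboolP.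
  have [S [T [B [F _ _ _]]]] := tframe_ex (small1 0) (small1 0) (small1 (0 : V ⊗ W)).
  by exists S, T, B; split => //; exists 1 => //; apply: dil0; exact: tball_disk.
move=> a x y /asboolP[S1 [T1 [B1 [F1 [r1 r10 x1]]]]] /asboolP[S2 [T2 [B2 [F2 [r2 r20 y2]]]]].
apply/asboolP; have [S [T [B [F h1 h2]]]] := tframe2 F1 F2.
have dS := tball_disk F; have [s s0 as_] := normC_bound a.
exists S, T, B; split => //; exists (s * r1 + r2); first by rewrite addr_gt0 ?mulr_gt0.
apply: dilD => //; first exact: mulr_gt0.
  by apply: dilZ => //; exact: dil_mono x1.
exact: dil_mono y2.
Qed.

HB.instance Definition _ :=
  GRing.isSubmodClosed.Build R[i] (V ⊗ W) tser_pred tser_submod.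

Record tser_space := TSer { tser_val :> V ⊗ W; _ : tser_val \in tser_pred }.
HB.instance Definition _ := [isSub for tser_val].
HB.instance Definition _ := [Choice of tser_space by <:].
HB.instance Definition _ := [SubChoice_isSubLmodule of tser_space by <:].

(** The bornology is generated by the disks [tball] instead of being induced from the tensor
    product; as they are Banach disks, it is complete. *)
Definition tser_small (A : set tser_space) := exists S T B, tframe S T B /\
  exists2 r : R, 0 < r & forall x, A x -> dil (tball S T B) r (x : V ⊗ W).

Let ts1 (x : tser_space) : tser_small [set x].
Proof.
case: x => x xP; have /asboolP[S [T [B [F [r r0 rx]]]]] := xP.
by exists S, T, B; split => //; exists r => // _ ->.
Qed.

Let ts_sub (A D : set tser_space) : A `<=` D -> tser_small D -> tser_small A.
Proof.
by move=> AD [S [T [B [F [r r0 Dr]]]]]; exists S, T, B; split => //; exists r => // x /AD/Dr.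
Qed.

Let tsU (A D : set tser_space) : tser_small A -> tser_small D -> tser_small (A `|` D).
Proof.
move=> [S1 [T1 [B1 [F1 [r1 r10 A1]]]]] [S2 [T2 [B2 [F2 [r2 r20 D2]]]]].
have [S [T [B [F h1 h2]]]] := tframe2 F1 F2; have dS := tball_disk F.
exists S, T, B; split => //; exists (r1 + r2); first exact: addr_gt0.
move=> x [/A1|/D2] h.
  by apply: (@dil_le _ _ _ r1) => //; [rewrite ltW // lerDl ltW | exact: dil_mono h].
by apply: (@dil_le _ _ _ r2) => //; [rewrite ltW // lerDr ltW | exact: dil_mono h].
Qed.

Let tsD (A D : set tser_space) : tser_small A -> tser_small D ->
  tser_small [set a + b | a in A & b in D].
Proof.
move=> [S1 [T1 [B1 [F1 [r1 r10 A1]]]]] [S2 [T2 [B2 [F2 [r2 r20 D2]]]]].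
have [S [T [B [F h1 h2]]]] := tframe2 F1 F2; have dS := tball_disk F.
exists S, T, B; split => //; exists (r1 + r2); first exact: addr_gt0.
move=> _ [x /A1 Ax [y /D2 Dy <-]].
by apply: dilD => //; [exact: dil_mono Ax | exact: dil_mono Dy].
Qed.

Let tsZ (r : R) (A : set tser_space) : tser_small A ->
  tser_small [set z *: a | z in [set z : R[i] | `|z| <= r%:C] & a in A].
Proof.
move=> [S [T [B [F [s s0 As]]]]]; have dS := tball_disk F.
exists S, T, B; split => //; exists (Num.max r 1 * s).
  by rewrite mulr_gt0 // lt_max ltr01 orbT.
move=> _ [z /= zr [x /As xs <-]]; apply: dilZ => //.
  by rewrite lt_max ltr01 orbT.
by apply: le_trans zr _; rewrite lecR le_max lexx.
Qed.

Let ts_complete (A : set tser_space) : tser_small A ->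
  exists T, [/\ tser_small T, banach_disk T & A `<=` T].
Proof.
move=> [S [T [B [F [r r0 Ar]]]]]; have dS := tball_disk F; have bS := tball_banach F.
pose E : set tser_space := [set x | dil (tball S T B) r (x : V ⊗ W)].
have EE e (x : tser_space) : 0 < e -> dil E e x <-> dil (tball S T B) (e * r) (x : V ⊗ W).
  move=> e0; split=> [[y Ey ->]|ex].
    by have [t Tt Et] := (Ey : dil _ _ _); exists t => //; rewrite realCM -scalerA -Et.
  exists (e^-1%:C *: x); last by rewrite scalerA -realCM divff ?gt_eqF // scale1r.
  by have := dil_scale e^-1 ex; rewrite mulKf // gt_eqF.
exists E; split => //; first by exists S, T, B; split => //; exists r.
apply: banach_diskI.
- split; first by exists 0; exact: dil0.
  by move=> x y a b Ex Ey ab; exact: (dil_disk r dS).2.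
- move=> x xE; apply: val_inj; apply: (banach_sep bS) => e e0.
  by rewrite -(divfK (lt0r_neq0 r0) e); apply/EE; [exact: divr_gt0|apply: xE; exact: divr_gt0].
move=> u uC; have [|l Hl] := banach_lim (u := fun n => u n : V ⊗ W) bS.
  move=> e e0; have [|N HN] := uC (e / r); first exact: divr_gt0.
  exists N => m n Nm Nn; rewrite -(divfK (lt0r_neq0 r0) e).
  by apply/(EE _ (u m - u n)); [exact: divr_gt0 | exact: HN].
have lP : l \in tser_pred.
  have [N /(_ N (leqnn N)) HN] := Hl 1 ltr01; rewrite -(subKr (u N : V ⊗ W) l).
  apply: rpredB; first by case: (u N).
  by apply/asboolP; exists S, T, B; split => //; exists 1.
exists (TSer lP) => e e0; have [|N HN] := Hl (e * r); first exact: mulr_gt0.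
by exists N => n /HN h; apply/EE.
Qed.

HB.instance Definition _ := isBornological.Build R tser_space
  ts1 ts_sub tsU tsD tsZ ts_complete.

Let tser_incl : bhom tser_space (V ⊗ W).
Proof.
exists tser_val => // A [S [T [B [F [r r0 Ar]]]]].
have PB := ahull_tframe F; have [_ _ [sB bB] _] := F.
apply: small_sub (smallZ (r * 3) sB) => _ [x /Ar xr <-].
have [b Bb ->] : dil B (r * 3) (x : V ⊗ W).
  apply: dil_dil; apply: dil_mono xr; apply: shull_bnd => //; exact: ahull_disk.
exists (r * 3)%:C; last by exists b.
by rewrite /= normCr // mulr_ge0 // ltW.
Defined.

Let tser_tens : {b : bbil V W tser_space | forall v w, tser_val (b v w) = v ⊠ w}.
Proof.
have tP v w : v ⊠ w \in tser_pred.
  apply/asboolP.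
  have [S [T [B [F Sv Tw _]]]] := tframe_ex (small1 v) (small1 w) (small1 (0 : V ⊗ W)).
  exists S, T, B; split => //; exists 1 => //; apply: dil1.
  by apply: tball_pure => //; [exact: Sv | exact: Tw].
have ll w : linear (fun v => TSer (tP v w)).
  by move=> a x y; apply: val_inj; exact: bbil_linl.
have lr v : linear (fun w => TSer (tP v w)).
  by move=> a x y; apply: val_inj; exact: bbil_linr.
have bd (A : set V) (D : set W) : small A -> small D ->
    small [set TSer (tP v w) | v in A & w in D].
  move=> sA sD; have [S [T [B [F AS DT _]]]] := tframe_ex sA sD (small1 (0 : V ⊗ W)).
  exists S, T, B; split => //; exists 1 => // _ [v Av [w Dw <-]].
  by apply/dil1/tball_pure => //; [exact: AS | exact: DT].
by exists (BBil ll lr bd).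
Qed.

(* By the universal property, the bornological subspace of sums of series is
   everything. *)
Lemma tser_all (x : V ⊗ W) : tser x.
Proof.
have [b bE] := tser_tens.
have E : bcomp tser_incl (tlift TP b) =1 bid (V ⊗ W).
  by apply: tens_ext => v w; rewrite /= tliftE bE.
rewrite -[x]/(bid _ x) -E /=; case: (tlift TP b x) => y yP; exact/asboolP.
Qed.

End TensorSeries.

(** * Separation of points by slices, from the approximation property *)

Section SliceInjectivity.
Context {R : realType} (TP : tensor_products R).
Implicit Types V W X : bornType R.
Local Notation C := (R[i]^o).
Local Notation "V ⊗ W" := (ct_space (TP V W)) (at level 40, left associativity).
Local Notation "v ⊠ w" := (tens TP v w) (at level 40, left associativity).

Definition separating V (P : set (bhom V C)) :=
  forall v, (forall om, P om -> om v = 0) -> v = 0.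

(** The coefficients in [finite_rank] are mere numbers; here they become bounded functionals. A
    functional that does not vanish at the last vector splits off one coordinate, and if there is
    none that vector is 0 by separation. *)
Lemma finite_rank_coord V W (f : bhom V W) : separating [set: bhom W C] -> finite_rank f ->
  exists n (c : 'I_n -> bhom V C) (e : 'I_n -> W),
    forall x, f x = \sum_(i < n) (c i x : R[i]) *: e i.
Proof.
move=> sepW [n [e fe]]; elim: n f e fe => [|n IH] f e fe.
  by exists 0%N, (fun i : 'I_0 => False_rect _ (elimF idP (ltn0 i) (ltn_ord i))), e => x; have [c ->] := fe x; rewrite !big_ord0.
have [[om omk]|H] := pselect (exists om : bhom W C, om (e ord_max) != 0); last first.
  have ek : e ord_max = 0.
    by apply: sepW => om _; apply: contrapT => /eqP omk; apply: H; exists om.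
  apply: (IH f (fun i => e (widen_ord (leqnSn n) i))) => x.
  have [c ->] := fe x; exists (fun i => c (widen_ord (leqnSn n) i)).
  by rewrite big_ord_recr /= ek scaler0 addr0.
pose a : R[i] := (om (e ord_max) : R[i])^-1.
pose c0 : bhom V C := bcomp (bbil_r (bscale C) a) (bcomp om f).
(* [f] followed by the projection onto the kernel of [om] along the last vector. *)
pose g := blincomb (-1) (bcomp (bbil_l (bscale W) (e ord_max)) c0) f.
have gE x : f x = g x + (c0 x : R[i]) *: e ord_max.
  by rewrite /= scaleN1r addrAC addNr add0r.
have [x|m [c [e' Hc]]] := IH g (fun i => e (widen_ord (leqnSn n) i) -
    (a * om (e (widen_ord (leqnSn n) i))) *: e ord_max).
  have [c fx] := fe x; exists (fun i => c (widen_ord (leqnSn n) i)).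
  pose w i := widen_ord (leqnSn n) i.
  have omf : om (f x) = (\sum_(i < n) c (w i) * (om (e (w i)) : R[i])) + c ord_max * om (e ord_max).
    rewrite fx linear_sum big_ord_recr /= linearZ; congr (_ + _).
    by apply: eq_bigr => i _; rewrite linearZ.
  have E : a * (om (f x) : R[i]) = a * (\sum_(i < n) c (w i) * (om (e (w i)) : R[i])) + c ord_max.
    by rewrite omf mulrDr mulrCA mulVf // mulr1.
  change (-1 *: ((a * (om (f x) : R[i])) *: e ord_max) + f x = \sum_(i < n) c (w i) *:
    (e (w i) - (a * (om (e (w i)) : R[i])) *: e ord_max)).
  rewrite E scaleN1r fx big_ord_recr /= scalerDl opprD addrACA addNr addr0 addrC.
  under [RHS]eq_bigr do rewrite scalerBr.
  rewrite sumrB; congr (_ - _); rewrite mulr_sumr scaler_suml.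
  by apply: eq_bigr => i _; rewrite scalerA mulrCA.
exists m.+1, (fun i => oapp c c0 (unlift ord_max i)), (fun i => oapp e' (e ord_max) (unlift ord_max i)).
move=> x; rewrite gE Hc big_ord_recr /= unlift_none /=; congr (_ + _).
apply: eq_bigr => i _.
have -> : widen_ord (leqnSn m) i = lift ord_max i.
  by apply: val_inj; rewrite /= /bump leqNgt ltn_ord.
by rewrite liftK.
Qed.

Lemma bbilZl V W X (b : bbil V W X) (a : R[i]) v w : b (a *: v) w = a *: b v w.
Proof. exact: (linearZZ (bbil_l b w)). Qed.

Lemma bbilZr V W X (b : bbil V W X) (a : R[i]) v w : b v (a *: w) = a *: b v w.
Proof. exact: (linearZZ (bbil_r b v)). Qed.

Lemma bbilBl V W X (b : bbil V W X) v v' w : b (v - v') w = b v w - b v' w.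
Proof. exact: (linearB (bbil_l b w)). Qed.

Lemma bbil_suml V W X (b : bbil V W X) n (v : 'I_n -> V) w :
  b (\sum_(i < n) v i) w = \sum_(i < n) b (v i) w.
Proof. exact: (linear_sum (bbil_l b w)). Qed.

Lemma bhom_sum V W n (F : 'I_n -> bhom V W) :
  exists g : bhom V W, forall x, g x = \sum_(i < n) F i x.
Proof.
elim: n F => [|n IH] F.
  have l0 : linear (fun _ : V => 0 : W) by move=> a x y; rewrite scaler0 addr0.
  have b0 (A : set V) : small A -> small [set (0 : W) | _ in A].
    by move=> _; apply: small_sub (small1 0) => _ [_ _ <-].
  by exists (BHom l0 b0) => x; rewrite big_ord0.
have [g Hg] := IH (fun i => F (widen_ord (leqnSn n) i)).
by exists (blincomb 1 g (F ord_max)) => x; rewrite /= scale1r Hg big_ord_recr.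
Qed.

Lemma dcvg_img V W (h : bhom V W) B (u : nat -> V) l : dcvg B u l ->
  dcvg (h @` B) (fun n => h (u n)) (h l).
Proof.
move=> ul e /ul[N HN]; exists N => n /HN[b Bb E].
by exists (h b); [exists b | rewrite -linearB E linearZ].
Qed.

(** Expand [x] in a series of finite tensors with first legs in [S]; scaled by [2^-k], these legs
    lie in a compact disk [S']. For [f N] of finite rank and close to the identity on [S'],
    [(f N ⊗ id) x] is a finite sum of terms [g_i ⊗ (c_i ⊗ id) x = 0], yet it is as close to [x] as
    desired. *)
Lemma slice_l_inj V W (x : V ⊗ W) :
  approximation_property V -> separating [set: bhom V C] ->
  (forall om : bhom V C, slice_l TP om x = 0) -> x = 0.
Proof.
move=> apV sepV x0.
have [S [T [B [F [r r0 rx]]]]] := tser_all x.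
have [[sS bS] sT [sB bB] PB] := F.
have [dS _ _] := bS; have [dB _ _] := bB.
have [y [yG yx]] := (dil_shull (ahull (pures S T)) x dB r0).1 rx.
have /choice[q Hq] : forall k, exists q : nat * (nat -> R[i]) * (nat -> V) * (nat -> W),
    let: (n, l, a, b) := q in
    [/\ forall i, S (a i), forall i, (i < n)%N -> T (b i), \sum_(i < n) `|l i| <= 1 &
        y k = (r * 4^-1 ^+ k)%:C *: \sum_(i < n) l i *: (a i ⊠ b i)].
  move=> k; have [_ [n [l [z [Pz l1 ->]]]] ->] := yG k.
  have /choice[ab Hab] : forall i, exists ab : V * W, [/\ S ab.1, T ab.2 & z i = ab.1 ⊠ ab.2].
    by move=> i; have [a Sa [b Tb <-]] := Pz i; exists (a, b).
  (* Families on ['I_n] are continued by a default to all indices. For first legs it is 0, a point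
     of [S], as [null_hull_compact] wants every index to give a point of the disk. *)
  pose ex (Z : Type) (d : Z) (g : 'I_n -> Z) i := oapp g d (insub i).
  have exE (Z : Type) (d : Z) g (i : 'I_n) : ex Z d g i = g i by rewrite /ex valK.
  exists (n, ex R[i] 0 l, ex V 0 (fun i => (ab i).1), ex W 0 (fun i => (ab i).2)); split.
  - move=> i; rewrite /ex; case: insubP => [j _ _|_] /=; last exact: disk0.
    by have [] := Hab j.
  - by move=> i ni; rewrite (exE _ _ _ (Ordinal ni)); have [] := Hab (Ordinal ni).
  - by under eq_bigr do rewrite exE.
  - by congr (_ *: _); apply: eq_bigr => i _; rewrite !exE; have [_ _ ->] := Hab i.
pose n k := (q k).1.1.1; pose l k := (q k).1.1.2; pose a k := (q k).1.2; pose b k := (q k).2.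
have {}Hq k : [/\ forall i, S (a k i), forall i, (i < n k)%N -> T (b k i),
    \sum_(i < n k) `|l k i| <= 1 &
    y k = (r * 4^-1 ^+ k)%:C *: \sum_(i < n k) l k i *: (a k i ⊠ b k i)].
  by have := Hq k; rewrite /n /l /a /b; case: (q k) => [[[? ?] ?] ?].
have [S' [dS' cS' S'a]] := @null_hull_compact R V S n a bS (fun k => let: And4 h _ _ _ := Hq k in h).
have [|f [ff [D sD Df]]] := apV S'; first by split => //; exists S.
(* [B2] contains the tensors of values of [D] on [S'] with elements of [T]. It is fixed before [e],
   so separation of its gauge can conclude. *)
have [S2 [T2 [B2 [[_ _ [sB2 bB2] PB2] DS2 TT2 _]]]] := tframe_ex (TP := TP) sD sT (small1 0).
have [dB2 _ _] := bB2.
apply: (banach_sep bB2) => e e0; rewrite -[x]opprK; apply: dilN => //.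
(* The 3 anticipates the constant of [series_cvg], and [r] is the radius of [x]. *)
have e' : 0 < e / (3 * r) by rewrite divr_gt0 // mulr_gt0.
have [N /(_ N (leqnn N))[d Dd fd]] := Df _ e'.
set e1 := e / (3 * r) in e' fd.
have [m [c [g cg]]] := finite_rank_coord sepV (ff N).
pose h := blincomb (-1) (bid (V ⊗ W)) (tmap TP (f N) (bid W)).
have hx : h x = - x.
  rewrite /h /= scaleN1r -[RHS]addr0; congr (_ + _).
  pose Fi i : bhom (V ⊗ W) (V ⊗ W) := bcomp (bbil_r (tens TP) (g i)) (slice_l TP (c i)).
  have [G HG] := bhom_sum Fi.
  have /(_ x) -> : tmap TP (f N) (bid W) =1 G.
    apply: tens_ext => v w; rewrite tmapE HG cg bbil_suml.
    by apply: eq_bigr => i _; rewrite /= /slice_l tliftE /= bbilZl bbilZr.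
  by rewrite HG big1 // => i _; rewrite /= x0 bbil0r.
have hE v w : h (v ⊠ w) = (f N v - v) ⊠ w.
  rewrite /h /= tmapE /= scaleN1r addrC.
  by rewrite bbilBl.
(* The factor [4^-k] of the series outweighs the [2^k] lost in scaling the first legs back from
   [S']; the remaining [2^-k] is summable. *)
have hy k : dil B2 (e1 * r * 2^-1 ^+ k) (h (y k)).
  have [Sa Tb l1 ->] := Hq k.
  have hab i : (i < n k)%N -> dil B2 (2 ^+ k * e1) (h (a k i ⊠ b k i)).
    move=> ik; pose p := (2^-1 ^+ k)%:C *: a k i.
    have S'p : S' p by exact: S'a.
    have ap : a k i = (2 ^+ k)%:C *: p.
      by rewrite /p scalerA -realCM -exprMn divff ?pnatr_eq0 // expr1n scale1r.
    have lp : lspan S' p by apply/lspan_dil => //; exists 1 => //; exact: dil1.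
    rewrite hE ap linearZ -scalerBr fd // scalerA -realCM.
    rewrite bbilZl.
    exists (d p ⊠ b k i) => //; apply: PB2; exists (d p).
      by apply: DS2; exists d => //; exists p.
    by exists (b k i) => //; exact/TT2/Tb.
  rewrite linearZ linear_sum.
  have -> : e1 * r * 2^-1 ^+ k = r * 4^-1 ^+ k * (2 ^+ k * e1).
    have -> : 2^-1 ^+ k = 4^-1 ^+ k * 2 ^+ k :> R by rewrite -exprMn; congr (_ ^+ k); field.
    by move: (4^-1 ^+ k) (2 ^+ k) => p' q'; ring.
  apply: dil_scale.
  pose E : set (V ⊗ W) := [set u | exists2 i, (i < n k)%N & u = h (a k i ⊠ b k i)].
  have EB : E `<=` dil B2 (2 ^+ k * e1) by move=> _ [i ik ->]; exact: hab.
  apply: (ahull_min (dil_disk _ dB2) EB).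
  exists (n k), (fun i => l k i), (fun i => h (a k i ⊠ b k i)); split => // [i|].
    by exists i.
  by apply: eq_bigr => i _; exact: (linearZZ h).
have [|z [yz z3]] := series_cvg bB2 _ hy; first by rewrite mulr_gt0.
have -> : - x = z.
  rewrite -hx.
  (* The series of the [h (y k)] converges to [h x] in the image of [B] and to [z] in [B2]; [B3]
     contains both disks, so the limits can be compared. *)
  have [B3 [_ bB3 B23]] := small_complete (smallU (bhom_bnd h sB) sB2).
  apply: (@dcvg_uniq _ _ B3 (fun m => \sum_(i < m) h (y i))) => //; last first.
    by apply: dcvg_mono yz => u Bu; apply: B23; right.
  under eq_fun do rewrite -linear_sum.
  by apply: (dcvg_mono _ (dcvg_img h yx)) => u Bu; apply: B23; left.
suff <- : 3 * (e1 * r) = e by [].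
by rewrite /e1; field; exact: lt0r_neq0.
Qed.

End SliceInjectivity.

(** * Galois maps *)

Section TensorFunctionals.
Context {R : realType} (TP : tensor_products R).
Implicit Types V W X : bornType R.
Local Notation C := (R[i]^o).
Local Notation "V ⊗ W" := (ct_space (TP V W)) (at level 40, left associativity).
Local Notation "v ⊠ w" := (tens TP v w) (at level 40, left associativity).

Lemma slice_lE V W (om : bhom V C) v (w : W) : slice_l TP om (v ⊠ w) = (om v : R[i]) *: w.
Proof. exact: tliftE. Qed.

Lemma slice_rE V W (om : bhom W C) (v : V) w : slice_r TP om (v ⊠ w) = (om w : R[i]) *: v.
Proof. exact: tliftE. Qed.

Lemma tflipE V W (v : V) (w : W) : tflip TP (v ⊠ w) = w ⊠ v.
Proof. exact: tliftE. Qed.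

Definition tpair V W (om : bhom V C) (et : bhom W C) : bhom (V ⊗ W) C :=
  bcomp om (slice_r TP et).

Lemma tpairE V W (om : bhom V C) (et : bhom W C) v w :
  tpair om et (v ⊠ w) = (om v : R[i]) * et w.
Proof. by rewrite /= slice_rE linearZ /= [RHS]mulrC. Qed.

Lemma tpair_l V W (om : bhom V C) (et : bhom W C) x : tpair om et x = et (slice_l TP om x).
Proof.
have /(_ x) : tpair om et =1 bcomp et (slice_l TP om); last by [].
by apply: tens_ext => v w; rewrite tpairE /= slice_lE linearZ.
Qed.

Lemma tpair_map V V' W W' (om : bhom V' C) (et : bhom W' C) (f : bhom V V') (g : bhom W W') x :
  tpair om et (tmap TP f g x) = tpair (bcomp om f) (bcomp et g) x.
Proof.
have /(_ x) : bcomp (tpair om et) (tmap TP f g) =1 tpair (bcomp om f) (bcomp et g); last by [].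
by apply: tens_ext => v w; rewrite tpairE /= tmapE slice_rE linearZ /= [RHS]mulrC.
Qed.

(** [slice_l_inj] asks for all functionals on [V], while [P] is only separating. By [tpair_l] the
    second leg can be sliced first, which leaves a vector of [V] that [P] can test. *)
Lemma tpair_sep V W (P : set (bhom V C)) (Q : set (bhom W C)) (x y : V ⊗ W) :
  approximation_property V -> separating P -> separating Q ->
  (forall om et, P om -> Q et -> tpair om et x = tpair om et y) -> x = y.
Proof.
move=> apV sP sQ xy; apply/eqP; rewrite -subr_eq0; apply/eqP.
apply: slice_l_inj => // [v v0|om]; first by apply: sP => om _; exact: v0.
apply: sQ => et Qet; rewrite -tpair_l.
change (om (slice_r TP et (x - y)) = 0).
rewrite (_ : slice_r TP et (x - y) = 0 :> V) ?linear0 //.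
apply: sP => om' Pom'; change (tpair om' et (x - y) = 0).
by rewrite linearB /= [X in X - _]xy // subrr.
Qed.

End TensorFunctionals.

Section GaloisMaps.
Context {R : realType} (TP : tensor_products R) (V : bornType R) (Q : bqg TP V).
Local Notation C := (R[i]^o).
Local Notation "V ⊗ W" := (ct_space (TP V W)) (at level 40, left associativity).
Local Notation "v ⊠ w" := (tens TP v w) (at level 40, left associativity).
Local Notation phi := (haar Q).
Local Notation "x ∘ y" := (amul Q x y) (at level 40, left associativity).
Local Notation "x ∙ y" := (amul (talg TP Q Q) x y) (at level 40, left associativity).
Local Notation ml a := (bbil_r (amul Q) a).
Local Notation mr a := (bbil_l (amul Q) a).

(** Multiplication by [a ⊗ 1] or [1 ⊗ a], from the left for [legl] and from the right for [legr]. *)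
Definition legl1 a : bhom (V ⊗ V) (V ⊗ V) := tmap TP (ml a) (bid V).
Definition legl2 a : bhom (V ⊗ V) (V ⊗ V) := tmap TP (bid V) (ml a).
Definition legr1 a : bhom (V ⊗ V) (V ⊗ V) := tmap TP (mr a) (bid V).
Definition legr2 a : bhom (V ⊗ V) (V ⊗ V) := tmap TP (bid V) (mr a).

Lemma talgE a b c d : (a ⊠ b) ∙ (c ⊠ d) = (a ∘ c) ⊠ (b ∘ d).
Proof. exact: tmulE. Qed.

Let mt1 a := mtens TP (mincl Q a) (mone Q).
Let mt2 a := mtens TP (mone Q) (mincl Q a).
Let mt1L a : mulL (mt1 a) = legl1 a. Proof. by rewrite /mt1 /mtens; case: mtens_subproof => m []. Qed.
Let mt1R a : mulR (mt1 a) = legr1 a. Proof. by rewrite /mt1 /mtens; case: mtens_subproof => m []. Qed.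
Let mt2L a : mulL (mt2 a) = legl2 a. Proof. by rewrite /mt2 /mtens; case: mtens_subproof => m []. Qed.
Let mt2R a : mulR (mt2 a) = legr2 a. Proof. by rewrite /mt2 /mtens; case: mtens_subproof => m []. Qed.

Lemma legl1M a x y : legl1 a (x ∙ y) = legl1 a x ∙ y. Proof. by rewrite -mt1L mulLM. Qed.
Lemma legl2M a x y : legl2 a (x ∙ y) = legl2 a x ∙ y. Proof. by rewrite -mt2L mulLM. Qed.
Lemma legr1M a x y : legr1 a x ∙ y = x ∙ legl1 a y. Proof. by rewrite -mt1L -mt1R mulLR. Qed.
Lemma legr2M a x y : legr2 a x ∙ y = x ∙ legl2 a y. Proof. by rewrite -mt2L -mt2R mulLR. Qed.

Lemma gamma_lM f g x : gamma_l Q (f ⊠ g) ∙ x = mulL (comul Q f) (legl1 g x).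
Proof. by have /(congr1 (fun m => mulL m x)) := gamma_lE Q f g; rewrite /= -mt1L. Qed.

Lemma gamma_rM f g x : gamma_r Q (f ⊠ g) ∙ x = mulL (comul Q f) (legl2 g x).
Proof. by have /(congr1 (fun m => mulL m x)) := gamma_rE Q f g; rewrite /= -mt2L. Qed.

Lemma rho_lM f g x : rho_l Q (f ⊠ g) ∙ x = legl1 f (mulL (comul Q g) x).
Proof. by have /(congr1 (fun m => mulL m x)) := rho_lE Q f g; rewrite /= -mt1L. Qed.

Lemma rho_rM f g x : rho_r Q (f ⊠ g) ∙ x = legl2 f (mulL (comul Q g) x).
Proof. by have /(congr1 (fun m => mulL m x)) := rho_rE Q f g; rewrite /= -mt2L. Qed.

Lemma mul_rho_l f g x : x ∙ rho_l Q (f ⊠ g) = mulR (comul Q g) (legr1 f x).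
Proof. by have /(congr1 (fun m => mulR m x)) := rho_lE Q f g; rewrite /= -mt1R. Qed.

Lemma mul_rho_r f g x : x ∙ rho_r Q (f ⊠ g) = mulR (comul Q g) (legr2 f x).
Proof. by have /(congr1 (fun m => mulR m x)) := rho_rE Q f g; rewrite /= -mt2R. Qed.

Lemma haar_sep_l : separating [set bcomp phi (mr a) | a in [set: V]].
Proof. by move=> v h; apply: (haar_faithful Q).1 => g; apply: (h (bcomp phi (mr g))); exists g. Qed.

Lemma haar_sep_r : separating [set bcomp phi (ml a) | a in [set: V]].
Proof. by move=> v h; apply: (haar_faithful Q).2 => g; apply: (h (bcomp phi (ml g))); exists g. Qed.

Lemma tpair_mulr (om et : bhom V C) x c d :
  tpair TP om et (x ∙ (c ⊠ d)) = tpair TP (bcomp om (mr c)) (bcomp et (mr d)) x.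
Proof.
have /(_ x) : bcomp (tpair TP om et) (bbil_l (amul (talg TP Q Q)) (c ⊠ d)) =1
  tpair TP (bcomp om (mr c)) (bcomp et (mr d)); last by [].
apply: tens_ext => v w; rewrite tpairE.
by change (tpair TP om et ((v ⊠ w) ∙ (c ⊠ d)) = (om (v ∘ c) : R[i]) * et (w ∘ d)); rewrite talgE tpairE.
Qed.

Lemma tpair_mull (om et : bhom V C) x c d :
  tpair TP om et ((c ⊠ d) ∙ x) = tpair TP (bcomp om (ml c)) (bcomp et (ml d)) x.
Proof.
have /(_ x) : bcomp (tpair TP om et) (bbil_r (amul (talg TP Q Q)) (c ⊠ d)) =1
  tpair TP (bcomp om (ml c)) (bcomp et (ml d)); last by [].
apply: tens_ext => v w; rewrite tpairE.
by change (tpair TP om et ((c ⊠ d) ∙ (v ⊠ w)) = (om (c ∘ v) : R[i]) * et (d ∘ w)); rewrite talgE tpairE.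
Qed.

(** The functionals [phi(- c) ⊗ phi(- d)] separate points, so the product of [H ⊗ H] is
    nondegenerate. Identities between Galois maps thus reduce to identities between multipliers. *)
Lemma talg_ext_r x y : (forall c d, x ∙ (c ⊠ d) = y ∙ (c ⊠ d)) -> x = y.
Proof.
move=> xy; apply: (tpair_sep (bqg_approx Q) haar_sep_l haar_sep_l).
by move=> _ _ [c _ <-] [d _ <-]; rewrite -!tpair_mulr xy.
Qed.

Lemma talg_ext_l x y : (forall c d, (c ⊠ d) ∙ x = (c ⊠ d) ∙ y) -> x = y.
Proof.
move=> xy; apply: (tpair_sep (bqg_approx Q) haar_sep_r haar_sep_r).
by move=> _ _ [c _ <-] [d _ <-]; rewrite -!tpair_mull xy.
Qed.

(** Both sides are [(q ⊗ 1) Delta(p) (1 ⊗ q')]. *)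
Lemma legl1_gamma_r q p q' : legl1 q (gamma_r Q (p ⊠ q')) = legr2 q' (rho_l Q (q ⊠ p)).
Proof. by apply: talg_ext_r => c d; rewrite -legl1M gamma_rM legr2M rho_lM. Qed.

Lemma legl2_gamma_l q p q' : legl2 q (gamma_l Q (p ⊠ q')) = legr1 q' (rho_r Q (q ⊠ p)).
Proof. by apply: talg_ext_r => c d; rewrite -legl2M gamma_lM legr1M rho_rM. Qed.

Lemma legl2_rho_r b q a : legl2 b (rho_r Q (q ⊠ a)) = rho_r Q ((b ∘ q) ⊠ a).
Proof.
apply: talg_ext_l => c d; rewrite -legr2M !mul_rho_r; congr (mulR _ _).
by rewrite !tmapE /= amulA.
Qed.

Lemma comul_gamma_l g x y : mulL (comul Q g) (gamma_l Q (x ⊠ y)) = gamma_l Q ((g ∘ x) ⊠ y).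
Proof. by apply: talg_ext_r => c d; rewrite -mulLM !gamma_lM mhom_mul. Qed.

Lemma comul_gamma_r g x y : mulL (comul Q g) (gamma_r Q (x ⊠ y)) = gamma_r Q ((g ∘ x) ⊠ y).
Proof. by apply: talg_ext_r => c d; rewrite -mulLM !gamma_rM mhom_mul. Qed.

Lemma rho_r_comul x p q : mulR (comul Q x) (rho_r Q (p ⊠ q)) = rho_r Q (p ⊠ (q ∘ x)).
Proof. by apply: talg_ext_l => c d; rewrite -mulRM !mul_rho_r mhom_mul. Qed.

Lemma rho_l_comul x p q : mulR (comul Q x) (rho_l Q (p ⊠ q)) = rho_l Q (p ⊠ (q ∘ x)).
Proof. by apply: talg_ext_l => c d; rewrite -mulRM !mul_rho_l mhom_mul. Qed.

Lemma legl1_rho_r h y x : legl1 h (rho_r Q (y ⊠ x)) = mulR (comul Q x) (h ⊠ y).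
Proof.
apply: talg_ext_l => c d; rewrite -legr1M mul_rho_r -mulRM; congr (mulR _ _).
by rewrite !tmapE talgE.
Qed.

Let mscalL a x : mulL (mscal Q a) x = a *: x.
Proof. by rewrite /= addrC (_ : amul Q 0 x = 0) ?add0r //; exact: (linear0 (mr x)). Qed.

Let mscalR a x : mulR (mscal Q a) x = a *: x.
Proof. by rewrite /= addrC bbil0r add0r. Qed.

Lemma haar_gamma_l f g : slice_r TP phi (gamma_l Q (f ⊠ g)) = (phi f : R[i]) *: g.
Proof. by have [-> _] := haar_left_invariant Q f g; rewrite mscalL. Qed.

Lemma haar_rho_l g f : slice_r TP phi (rho_l Q (g ⊠ f)) = (phi f : R[i]) *: g.
Proof. by have [_ ->] := haar_left_invariant Q f g; rewrite mscalR. Qed.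

Lemma right_gamma_r psi f g : right_invariant Q psi ->
  slice_l TP psi (gamma_r Q (f ⊠ g)) = (psi f : R[i]) *: g.
Proof. by move=> /(_ f g)[-> _]; rewrite mscalL. Qed.

Lemma right_rho_r psi f g : right_invariant Q psi ->
  slice_l TP psi (rho_r Q (g ⊠ f)) = (psi f : R[i]) *: g.
Proof. by move=> /(_ f g)[_ ->]; rewrite mscalR. Qed.

(** As [H] is essential, multiplication maps [H ⊗ H] onto [H], and bounded maps on [H ⊗ H] are
    determined by elementary tensors. *)
Lemma prod_ext (X : bornType R) (f g : bhom V X) : (forall x y, f (x ∘ y) = g (x ∘ y)) -> f =1 g.
Proof.
move=> fg v; have [_ [_ /(_ _ (small1 v))[A _ /(_ v erefl)[t _ <-]]]] := bqg_essential Q.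
have /(_ t) : bcomp f (tlift TP (amul Q)) =1 bcomp g (tlift TP (amul Q)); last by [].
by apply: tens_ext => x y; rewrite /= tliftE.
Qed.

Lemma faithful_unit om : faithful Q om -> exists x, om x = 1.
Proof.
move=> [fom _]; have [[x /eqP x0] _] := bqg_essential Q.
have [y oy] : exists y, om y <> 0.
  apply: contrapT => H; apply: x0; apply: fom => g; apply: contrapT => h.
  by apply: H; exists (x ∘ g).
exists ((om y : R[i])^-1 *: y); rewrite linearZ /=; apply: mulVf; exact/eqP.
Qed.

End GaloisMaps.

(** * The dual as a space of functionals *)

Section DualFunctionals.
Context {R : realType} (TP : tensor_products R) (V : bornType R) (Q : bqg TP V).
Local Notation C := (R[i]^o).
Local Notation "x ∘ y" := (amul Q x y) (at level 40, left associativity).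
Local Notation "v ⊠ w" := (tens TP v w) (at level 40, left associativity).
Local Notation phi := (haar Q).
Local Notation ml a := (bbil_r (amul Q) a).
Local Notation mr a := (bbil_l (amul Q) a).

Definition dual_fun (w : dual_space Q) : bhom V C := bcomp phi (mr (biso_inv (F_l Q) w)).

Lemma dual_funE w h : dual_fun w h = w h.
Proof. by rewrite -[in RHS](bisoVK (F_l Q) w). Qed.

Lemma dual_fun_F_l a : dual_fun (F_l Q a) = bcomp phi (mr a).
Proof. by rewrite /dual_fun bisoK. Qed.

Definition dual_ev (f : V) : bhom (dual_space Q) C :=
  bcomp (bcomp phi (ml f)) (biso_inv (F_l Q)).

Lemma dual_evE f w : dual_ev f w = w f.
Proof. by rewrite -[in RHS](bisoVK (F_l Q) w). Qed.

Lemma dual_fun_sep : separating (range dual_fun).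
Proof.
move=> v h; apply: haar_sep_l => _ [a _ <-]; apply: h; exists (F_l Q a) => //.
exact: dual_fun_F_l.
Qed.

Lemma dual_ev_sep : separating (range dual_ev).
Proof.
move=> w h; apply: dualP => f; rewrite -dual_evE; apply: h; exact: imageT.
Qed.

Lemma dual_sep f g : (forall w : dual_space Q, w f = w g) -> f = g.
Proof.
move=> fg; apply/eqP; rewrite -subr_eq0; apply/eqP; apply: dual_fun_sep => _ [w _ <-].
have -> : dual_fun w (f - g) = dual_fun w f - dual_fun w g by exact: linearB.
by rewrite !dual_funE fg subrr.
Qed.

Definition dpair (w e : dual_space Q) := tpair TP (dual_fun w) (dual_fun e).

Lemma dpairE w e f g : dpair w e (f ⊠ g) = (w f : R[i]) * e g.
Proof. by rewrite tpairE !dual_funE. Qed.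

Lemma dpair_sep x y : (forall w e, dpair w e x = dpair w e y) -> x = y.
Proof.
move=> xy; apply: (tpair_sep (bqg_approx Q) dual_fun_sep dual_fun_sep).
by move=> _ _ [w _ <-] [e _ <-]; exact: xy.
Qed.

End DualFunctionals.

(** * Comparison of the right Fourier transforms of [phi] and [psi] *)

Section RightFourier.
Context {R : realType} (TP : tensor_products R) (V : bornType R) (Q : bqg TP V).
Context (psi : bhom V (R[i]^o)) (G_r : biso V (dual_space Q)).
Hypotheses (psiF : faithful Q psi) (psiR : right_invariant Q psi).
Hypothesis G_rE : forall f h, G_r f h = psi (amul Q f h).
Local Notation C := (R[i]^o).
Local Notation "x ∘ y" := (amul Q x y) (at level 40, left associativity).
Local Notation "v ⊠ w" := (tens TP v w) (at level 40, left associativity).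
Local Notation phi := (haar Q).
Local Notation ml a := (bbil_r (amul Q) a).
Local Notation mr a := (bbil_l (amul Q) a).

(** For [t = (1 ⊗ p) Delta(q)] one has [t Delta(x) = (1 ⊗ p) Delta(q x)], and right invariance gives
    [phi(p) psi(q x)]. *)
Lemma psi_slice_rho_r t x : psi (slice_l TP phi (biso_inv (rho_r Q) t) ∘ x) =
  tpair TP psi phi (mulR (comul Q x) t).
Proof.
rewrite -[in RHS](bisoVK (rho_r Q) t); move: (biso_inv _ t) => s.
have /(_ s) : bcomp psi (bcomp (mr x) (slice_l TP phi)) =1
    bcomp (tpair TP psi phi) (bcomp (mulR (comul Q x)) (rho_r Q)); last by [].
apply: tens_ext => p q.
change (psi (slice_l TP phi (p ⊠ q) ∘ x) =
  tpair TP psi phi (mulR (comul Q x) (rho_r Q (p ⊠ q)))).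
rewrite rho_r_comul tpair_l right_rho_r // slice_lE bbilZl [LHS]linearZ [RHS]linearZ; exact: mulrC.
Qed.

(** For [t = (p ⊗ 1) Delta(q)], left invariance gives [psi(p) phi(q x)]. *)
Lemma haar_slice_rho_l t x : phi (slice_l TP psi (biso_inv (rho_l Q) t) ∘ x) =
  tpair TP psi phi (mulR (comul Q x) t).
Proof.
rewrite -[in RHS](bisoVK (rho_l Q) t); move: (biso_inv _ t) => s.
have /(_ s) : bcomp phi (bcomp (mr x) (slice_l TP psi)) =1
    bcomp (tpair TP psi phi) (bcomp (mulR (comul Q x)) (rho_l Q)); last by [].
apply: tens_ext => p q.
change (phi (slice_l TP psi (p ⊠ q) ∘ x) =
  psi (slice_r TP phi (mulR (comul Q x) (rho_l Q (p ⊠ q))))).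
rewrite rho_l_comul haar_rho_l slice_lE bbilZl [LHS]linearZ [RHS]linearZ; exact: mulrC.
Qed.

(** If [psi(p0) = 1], then [t = (p0 ⊗ 1) Delta(f)] in the two preceding formulas turns [phi(f x)]
    into some [psi(f' x)], a value of [G_r]. The inverse uses [t = (1 ⊗ q0) Delta(f)] with
    [phi(q0) = 1]. *)
Lemma F_r_ex : exists F : biso V (dual_space Q), forall f h, F f h = phi (f ∘ h).
Proof.
have [p0 p1] := faithful_unit psiF; have [q0 q1] := faithful_unit (haar_faithful Q).
pose F := bcomp G_r (bcomp (slice_l TP phi) (bcomp (biso_inv (rho_r Q))
  (bcomp (rho_l Q) (bbil_r (tens TP) p0)))).
pose G := bcomp (bcomp (slice_l TP psi) (bcomp (biso_inv (rho_l Q))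
  (bcomp (rho_r Q) (bbil_r (tens TP) q0)))) (biso_inv G_r).
have FE f h : F f h = phi (f ∘ h).
  rewrite [LHS]G_rE /= psi_slice_rho_r -haar_slice_rho_l bisoK slice_lE.
  by rewrite p1 scale1r.
have GE w h : phi (G w ∘ h) = w h.
  rewrite /= haar_slice_rho_l -psi_slice_rho_r bisoK slice_lE q1 scale1r.
  by rewrite -G_rE bisoVK.
have FG : cancel G F by move=> w; apply: dualP => h; rewrite FE GE.
have GF : cancel F G.
  move=> f; apply/eqP; rewrite -subr_eq0; apply/eqP; apply: (haar_faithful Q).1 => h.
  by rewrite bbilBl linearB /= GE FE subrr.
by exists (BIso GF FG).
Qed.

End RightFourier.

(** * Pairing with the dual quantum group *)

Section DualQuantumGroup.
Context {R : realType} (TP : tensor_products R) (V : bornType R).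
Context (Q : bqg TP V) (Qd : bqg TP (dual_space Q)).
Context (psi eps : bhom V (R[i]^o)) (G_r : biso V (dual_space Q)).
Local Notation C := (R[i]^o).
Local Notation "V ⊗ W" := (ct_space (TP V W)) (at level 40, left associativity).
Local Notation "v ⊠ w" := (tens TP v w) (at level 40, left associativity).
Local Notation "x ∘ y" := (amul Q x y) (at level 40, left associativity).
Local Notation "x ∙ y" := (amul (talg TP Q Q) x y) (at level 40, left associativity).
Local Notation "w ⋆ e" := (amul Qd w e) (at level 40, left associativity).
Local Notation phi := (haar Q).
Local Notation ml a := (bbil_r (amul Q) a).
Local Notation mr a := (bbil_l (amul Q) a).
Local Notation F_l := (F_l Q).

Hypothesis dual_mul : forall f g,
  F_l f ⋆ F_l g = F_l (slice_r TP phi (biso_inv (gamma_l Q) (f ⊠ g))).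
Hypotheses (psiF : faithful Q psi) (psiR : right_invariant Q psi).
Hypothesis G_rE : forall f h, G_r f h = psi (f ∘ h).
Hypothesis epsC : counit Q eps.
Hypothesis dual_gamma_r : forall f g, gamma_r Qd (F_l f ⊠ F_l g) =
  tmap TP F_l F_l (tflip TP (biso_inv (gamma_l Q) (f ⊠ g))).
Hypothesis dual_rho_l : forall f g, rho_l Qd (G_r g ⊠ G_r f) =
  tmap TP G_r G_r (tflip TP (biso_inv (rho_r Q) (g ⊠ f))).
Hypothesis dual_haar : forall f, haar Qd (G_r f) = eps f.

Lemma F_l_ind (P : dual_space Q -> Prop) : (forall a, P (F_l a)) -> forall w, P w.
Proof. by move=> PF w; rewrite -(bisoVK F_l w). Qed.

Lemma slice_r_leg2 (om : bhom V C) (f : bhom V V) (x : V ⊗ V) :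
  slice_r TP om (tmap TP (bid V) f x) = slice_r TP (bcomp om f) x.
Proof.
have /(_ x) : bcomp (slice_r TP om) (tmap TP (bid V) f) =1 slice_r TP (bcomp om f); last by [].
by apply: tens_ext => v w; rewrite /= tmapE !slice_rE.
Qed.

Lemma slice_r_leg1 (om : bhom V C) (f : bhom V V) (x : V ⊗ V) :
  slice_r TP om (tmap TP f (bid V) x) = f (slice_r TP om x).
Proof.
have /(_ x) : bcomp (slice_r TP om) (tmap TP f (bid V)) =1 bcomp f (slice_r TP om); last by [].
by apply: tens_ext => v w; rewrite /= tmapE !slice_rE linearZ.
Qed.

Lemma slice_l_leg2 (om : bhom V C) (f : bhom V V) (x : V ⊗ V) :
  slice_l TP om (tmap TP (bid V) f x) = f (slice_l TP om x).
Proof.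
have /(_ x) : bcomp (slice_l TP om) (tmap TP (bid V) f) =1 bcomp f (slice_l TP om); last by [].
by apply: tens_ext => v w; rewrite /= tmapE !slice_lE linearZ.
Qed.

Lemma dpair_l (w e : dual_space Q) x : dpair w e x = e (slice_l TP (dual_fun w) x).
Proof. by rewrite /dpair tpair_l dual_funE. Qed.

Lemma dpair_r (w e : dual_space Q) x : dpair w e x = w (slice_r TP (dual_fun e) x).
Proof. exact: dual_funE. Qed.

Lemma dpair_F_l c b (x : V ⊗ V) : dpair (F_l c) (F_l b) x = tpair TP phi phi (x ∙ (c ⊠ b)).
Proof. by rewrite /dpair !dual_fun_F_l tpair_mulr. Qed.

(** The dual product is convolution: with [gamma_l(p ⊗ q)] in place of [f ⊗ g], both sides are
    [phi(h p) phi(q)] by left invariance. *)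
Lemma conv_F_l_l f g h : (F_l f ⋆ F_l g) h = tpair TP phi phi (mulL (comul Q h) (f ⊠ g)).
Proof.
rewrite dual_mul F_lE -[in RHS](bisoVK (gamma_l Q) (f ⊠ g)); move: (biso_inv _ _) => s.
have /(_ s) : bcomp phi (bcomp (ml h) (slice_r TP phi)) =1
    bcomp (tpair TP phi phi) (bcomp (mulL (comul Q h)) (gamma_l Q)); last by [].
apply: tens_ext => p q.
change (phi (h ∘ slice_r TP phi (p ⊠ q)) =
  phi (slice_r TP phi (mulL (comul Q h) (gamma_l Q (p ⊠ q))))).
rewrite comul_gamma_l haar_gamma_l slice_rE bbilZr [LHS]linearZ [RHS]linearZ; exact: mulrC.
Qed.

(** The translates [w(- q)] and [w(q -)]. They go through different Fourier maps because [F_l] turns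
    the first into left multiplication by [q] and [G_r] the second into right multiplication. *)
Definition actl q : bhom (dual_space Q) (dual_space Q) := bcomp F_l (bcomp (ml q) (biso_inv F_l)).
Definition actr q : bhom (dual_space Q) (dual_space Q) := bcomp G_r (bcomp (mr q) (biso_inv G_r)).

Lemma actl_F_l q a : actl q (F_l a) = F_l (q ∘ a).
Proof. by rewrite /actl /= four_lK. Qed.

Lemma actlE q w h : actl q w h = w (h ∘ q).
Proof. by elim/F_l_ind: w => a; rewrite actl_F_l !F_lE amulA. Qed.

Lemma actrE q w h : actr q w h = w (q ∘ h).
Proof. by rewrite -[in RHS](bisoVK G_r w) /actr [LHS]G_rE G_rE -amulA. Qed.

Lemma dpair_legl1 q w e x : dpair w e (legl1 Q q x) = dpair (actr q w) e x.
Proof.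
rewrite /dpair /legl1 tpair_map; congr (tpair _ _ _ _); apply: bhomP => h //.
by rewrite /= [LHS]dual_funE [RHS]dual_funE actrE.
Qed.

Lemma dpair_legl2 q w e x : dpair w e (legl2 Q q x) = dpair w (actr q e) x.
Proof.
rewrite /dpair /legl2 tpair_map; congr (tpair _ _ _ _); apply: bhomP => h //.
by rewrite /= [LHS]dual_funE [RHS]dual_funE actrE.
Qed.

Lemma dpair_legr1 q w e x : dpair w e (legr1 Q q x) = dpair (actl q w) e x.
Proof.
rewrite /dpair /legr1 tpair_map; congr (tpair _ _ _ _); apply: bhomP => h //.
by rewrite /= [LHS]dual_funE [RHS]dual_funE actlE.
Qed.

Lemma dpair_legr2 q w e x : dpair w e (legr2 Q q x) = dpair w (actl q e) x.
Proof.
rewrite /dpair /legr2 tpair_map; congr (tpair _ _ _ _); apply: bhomP => h //.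
by rewrite /= [LHS]dual_funE [RHS]dual_funE actlE.
Qed.

Lemma conv_gamma_l q w e p : (actl q w ⋆ e) p = dpair w e (gamma_l Q (p ⊠ q)).
Proof.
elim/F_l_ind: w => c; elim/F_l_ind: e => b.
by rewrite actl_F_l conv_F_l_l dpair_F_l gamma_lM tmapE.
Qed.

Lemma conv_gamma_r q w e p : (w ⋆ actl q e) p = dpair w e (gamma_r Q (p ⊠ q)).
Proof.
elim/F_l_ind: w => c; elim/F_l_ind: e => b.
by rewrite actl_F_l conv_F_l_l dpair_F_l gamma_rM tmapE.
Qed.

(** The convolution formula only reaches factors to the right of [Delta(p)]. By [prod_ext] one may
    take [e = e'(- q')]; then both sides are [w ⊗ e'] evaluated at [(q ⊗ 1) Delta(p) (1 ⊗ q')]. *)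
Lemma conv_rho_l q w e p : (actr q w ⋆ e) p = dpair w e (rho_l Q (q ⊠ p)).
Proof.
elim/F_l_ind: e => b; rewrite dpair_l -!dual_evE.
set x := slice_l _ _ _.
have /(_ b) : bcomp (dual_ev Q p) (bcomp (bbil_r (amul Qd) (actr q w)) F_l) =1
  bcomp (dual_ev Q x) F_l; last by [].
apply: (prod_ext (Q := Q)) => q' b'.
change (dual_ev Q p (actr q w ⋆ F_l (q' ∘ b')) = dual_ev Q x (F_l (q' ∘ b'))).
rewrite !dual_evE -dpair_l -!actl_F_l conv_gamma_r.
by rewrite -dpair_legl1 legl1_gamma_r dpair_legr2.
Qed.

Lemma conv_rho_r q w e p : (w ⋆ actr q e) p = dpair w e (rho_r Q (q ⊠ p)).
Proof.
elim/F_l_ind: w => b; rewrite dpair_r -!dual_evE.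
set x := slice_r _ _ _.
have /(_ b) : bcomp (dual_ev Q p) (bcomp (bbil_l (amul Qd) (actr q e)) F_l) =1
  bcomp (dual_ev Q x) F_l; last by [].
apply: (prod_ext (Q := Q)) => q' b'.
change (dual_ev Q p (F_l (q' ∘ b') ⋆ actr q e) = dual_ev Q x (F_l (q' ∘ b'))).
rewrite !dual_evE -dpair_r -!actl_F_l conv_gamma_l.
by rewrite -dpair_legl2 legl2_gamma_l dpair_legr1.
Qed.

(** * Strong left invariance *)

Section Fourier_r.
Context (F_r : biso V (dual_space Q)).
Hypothesis F_rE : forall f h, F_r f h = phi (f ∘ h).

(** For a product [b = b' q], the functional [F_r b] is the translate of [F_r b'] by [q], so
    [conv_rho_r] applies; [prod_ext] reduces to this case. *)
Lemma conv_F_r w b a : (w ⋆ F_r b) a = w (slice_r TP phi (rho_r Q (b ⊠ a))).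
Proof.
rewrite -[LHS]dual_evE.
have /(_ b) : bcomp (dual_ev Q a) (bcomp (bbil_r (amul Qd) w) F_r) =1
  bcomp (dual_fun w) (bcomp (slice_r TP phi) (bcomp (rho_r Q) (bbil_l (tens TP) a))).
  apply: (prod_ext (Q := Q)) => b' q.
  change (dual_ev Q a (w ⋆ F_r (b' ∘ q)) = dual_fun w (slice_r TP phi (rho_r Q ((b' ∘ q) ⊠ a)))).
  have -> : F_r (b' ∘ q) = actr q (F_r b').
    by apply: dualP => h; rewrite actrE !F_rE amulA.
  rewrite dual_evE conv_rho_r dpair_r -legl2_rho_r.
  rewrite [RHS]dual_funE /legl2 slice_r_leg2; congr (w (slice_r TP _ _)).
  by apply: bhomP => h; rewrite [LHS]dual_funE F_rE.
by move=> E; exact: (etrans E (dual_funE _ _)).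
Qed.

Let kap : bhom (V ⊗ V) C := bcomp eps (bcomp (slice_l TP phi) (biso_inv (rho_r Q))).

(** By [conv_F_r] the product is [x |-> (psi ⊗ phi)((h ⊗ y) Delta(x))]. [psi_slice_rho_r] rewrites
    it as a value of [G_r], on which the dual Haar functional is the counit. *)
Let kapE h y : kap (h ⊠ y) = haar Qd (G_r h ⋆ F_r y).
Proof.
rewrite (_ : G_r h ⋆ F_r y = G_r (slice_l TP phi (biso_inv (rho_r Q) (h ⊠ y)))) ?dual_haar //.
apply: dualP => x; rewrite conv_F_r !G_rE psi_slice_rho_r // -legl1_rho_r.
by rewrite /= /legl1 slice_r_leg1.
Qed.

(** Its values are the functionals [x |-> (e ⊗ phi)(t Delta(x))]; building it from the dual product
    shows that they lie in the dual. *)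
Let conv_tensor (e : dual_space Q) : bhom (V ⊗ V) (dual_space Q) :=
  tlift TP (bbil_pre (amul Qd) (bcomp G_r (bcomp (bbil_r (amul Q) (biso_inv G_r e)) (bid V))) F_r).

Let conv_tensorE e y z : conv_tensor e (y ⊠ z) = actr y e ⋆ F_r z.
Proof. by rewrite /conv_tensor tliftE. Qed.

Let conv_tensor_ev e t x : conv_tensor e t x = tpair TP (dual_fun e) phi (mulR (comul Q x) t).
Proof.
rewrite -dual_evE.
have /(_ t) : bcomp (dual_ev Q x) (conv_tensor e) =1
    bcomp (tpair TP (dual_fun e) phi) (mulR (comul Q x)); last by [].
apply: tens_ext => y z.
change (dual_ev Q x (conv_tensor e (y ⊠ z)) =
  dual_fun e (slice_r TP phi (mulR (comul Q x) (y ⊠ z)))).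
rewrite dual_evE conv_tensorE conv_F_r actrE [RHS]dual_funE -legl1_rho_r.
by rewrite /legl1 slice_r_leg1.
Qed.

Let conv_tensor_rho_l e c a : conv_tensor e (rho_l Q (c ⊠ a)) = (e c : R[i]) *: F_r a.
Proof.
apply: dualP => x; rewrite conv_tensor_ev rho_l_comul.
change (dual_fun e (slice_r TP phi (rho_l Q (c ⊠ (a ∘ x)))) = (e c : R[i]) * F_r a x).
rewrite -(dual_funE e) F_rE [RHS]mulrC haar_rho_l; exact: (linearZZ (dual_fun e)).
Qed.

Let slice_rho_r b : bhom V V :=
  bcomp (slice_r TP phi) (bcomp (rho_r Q) (bbil_l (tens TP) b)).

(** By associativity of the dual product, [w ⊗ e] takes the value [(w ⋆ conv_tensor e t) b] at
    [rho_r (id ⊗ slice_rho_r b) t]. For [t = rho_l(c ⊗ a)], left invariance collapses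
    [conv_tensor e t] to [e(c) F_r a]. *)
Let rho_r_rho_l a b c :
  rho_r Q (tmap TP (bid V) (slice_rho_r b) (rho_l Q (c ⊠ a))) = slice_rho_r b a ⊠ c.
Proof.
apply: dpair_sep => w e.
have E t : dpair w e (rho_r Q (tmap TP (bid V) (slice_rho_r b) t)) = (w ⋆ conv_tensor e t) b.
  rewrite -dual_evE.
  have /(_ t) : bcomp (dpair w e) (bcomp (rho_r Q) (tmap TP (bid V) (slice_rho_r b))) =1
    bcomp (dual_ev Q b) (bcomp (bbil_r (amul Qd) w) (conv_tensor e)); last by [].
  apply: tens_ext => y z.
  change (dpair w e (rho_r Q (tmap TP (bid V) (slice_rho_r b) (y ⊠ z))) =
    dual_ev Q b (w ⋆ conv_tensor e (y ⊠ z))).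
  by rewrite tmapE -conv_rho_r dual_evE conv_tensorE amulA conv_F_r.
rewrite E conv_tensor_rho_l dpairE bbilZr.
change ((e c : R[i]) * (w ⋆ F_r a) b = (w (slice_rho_r b a) : R[i]) * e c).
by rewrite conv_F_r mulrC.
Qed.

(** [kap] undoes [rho_r], and the counit turns [(id ⊗ phi)((1 ⊗ z) Delta(b))] into [phi(z b)]. For
    [t = a ⊗ b] both sides become [(phi ⊗ phi)((c ⊗ 1) Delta(a) (1 ⊗ b))]. *)
Lemma haar_G_r_rho_r t c :
  haar Qd (G_r (slice_r TP phi (rho_r Q t)) ⋆ F_r c) = phi (c ∘ slice_r TP phi (gamma_r Q t)).
Proof.
have /(_ t) : bcomp (haar Qd) (bcomp (bbil_l (amul Qd) (F_r c)) (bcomp G_r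
    (bcomp (slice_r TP phi) (rho_r Q)))) =1
  bcomp phi (bcomp (ml c) (bcomp (slice_r TP phi) (gamma_r Q))); last by [].
apply: tens_ext => a b.
change (haar Qd (G_r (slice_rho_r b a) ⋆ F_r c) = phi (c ∘ slice_r TP phi (gamma_r Q (a ⊠ b)))).
rewrite -kapE -rho_r_rho_l.
have E s : kap (rho_r Q (tmap TP (bid V) (slice_rho_r b) s)) = tpair TP phi phi (legr2 Q b s).
  have /(_ s) : bcomp kap (bcomp (rho_r Q) (tmap TP (bid V) (slice_rho_r b))) =1
    bcomp (tpair TP phi phi) (legr2 Q b); last by [].
  apply: tens_ext => y z.
  change (eps (slice_l TP phi (biso_inv (rho_r Q) (rho_r Q
     (tmap TP (bid V) (slice_rho_r b) (y ⊠ z))))) = tpair TP phi phi (legr2 Q b (y ⊠ z))).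
  rewrite bisoK !tmapE slice_lE tpairE [LHS]linearZ; congr (_ * _).
  change (tpair TP eps phi (rho_r Q (z ⊠ b)) = phi (z ∘ b)).
  by rewrite tpair_l; have [_ _ /(_ b z)[_ ->] _] := epsC.
rewrite E -legl1_gamma_r.
by rewrite /= /legl1 slice_r_leg1.
Qed.

End Fourier_r.

(* S plays the role of the antipode; both it and its inverse come from strong
   left invariance, S((id ⊗ phi)(Delta(a)(1 ⊗ b))) = (id ⊗ phi)((1 ⊗ a)Delta(b)). *)
Lemma antipode_ex : exists S : biso V V, forall k w, haar Qd (G_r (S k) ⋆ w) = w k.
Proof.
have [F_r F_rE] := F_r_ex psiF psiR G_rE.
have [y0 y1] := faithful_unit (haar_faithful Q).
(* Since [phi(y0) = 1], applying [id ⊗ phi] to [k ⊗ y0] returns [k]; [haar_G_r_rho_r] is used at the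
   preimage of [k ⊗ y0] under [gamma_r] for [S], under [rho_r] for [T]. *)
pose S : bhom V V := bcomp (slice_r TP phi) (bcomp (rho_r Q) (bcomp (biso_inv (gamma_r Q))
  (bbil_l (tens TP) y0))).
pose T : bhom V V := bcomp (slice_r TP phi) (bcomp (gamma_r Q) (bcomp (biso_inv (rho_r Q))
  (bbil_l (tens TP) y0))).
have SE k w : haar Qd (G_r (S k) ⋆ w) = w k.
  rewrite -(bisoVK F_r w) F_rE; move: (biso_inv F_r w) => c.
  rewrite [LHS](haar_G_r_rho_r F_rE) bisoVK slice_rE y1 scale1r //.
have TE k w : haar Qd (G_r k ⋆ w) = w (T k).
  rewrite -(bisoVK F_r w) F_rE; move: (biso_inv F_r w) => c.
  by rewrite -[RHS](haar_G_r_rho_r F_rE) bisoVK slice_rE y1 scale1r.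
have ST : cancel S T by move=> k; apply: (dual_sep (Q := Q)) => w; rewrite -TE SE.
(* [G_r (S (T k))] and [G_r k] have the same products under the dual Haar functional, which is
   faithful. *)
have TS : cancel T S.
  move=> k; apply: (can_inj (bisoK G_r)); apply/eqP; rewrite -subr_eq0; apply/eqP.
  apply: (haar_faithful Qd).1 => w; rewrite bbilBl linearB /=.
  by rewrite [X in X - _]SE TE subrr.
by exists (BIso ST TS).
Qed.

(** With [gamma_l(x ⊗ y)] in place of [a ⊗ b], both sides are [phi(f y) phi(g x)]; on the right this
    is left invariance applied to [(f ⊗ 1) Delta(g x) (y ⊗ 1)]. *)
Lemma pair_gamma_r f g (w e : dual_space Q) :
  tpair TP (dual_ev Q f) (dual_ev Q g) (gamma_r Qd (w ⊠ e)) = dpair w e (rho_l Q (f ⊠ g)).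
Proof.
elim/F_l_ind: w => a; elim/F_l_ind: e => b.
rewrite dual_gamma_r dpair_F_l tpair_map -[in RHS](bisoVK (gamma_l Q) (a ⊠ b)).
move: (biso_inv _ _) => s.
have /(_ s) : bcomp (tpair TP (bcomp (dual_ev Q f) F_l) (bcomp (dual_ev Q g) F_l)) (tflip TP) =1
   bcomp (tpair TP phi phi) (bcomp (bbil_r (amul (talg TP Q Q)) (rho_l Q (f ⊠ g))) (gamma_l Q));
  last by [].
apply: tens_ext => x y.
change (tpair TP (bcomp (dual_ev Q f) F_l) (bcomp (dual_ev Q g) F_l) (tflip TP (x ⊠ y)) =
  tpair TP phi phi (rho_l Q (f ⊠ g) ∙ gamma_l Q (x ⊠ y))).
rewrite tflipE tpairE rho_lM comul_gamma_l.
change ((dual_ev Q f (F_l y) : R[i]) * dual_ev Q g (F_l x) =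
  phi (slice_r TP phi (legl1 Q f (gamma_l Q ((g ∘ x) ⊠ y))))).
by rewrite !dual_evE !F_lE /legl1 slice_r_leg1 haar_gamma_l /= bbilZr linearZ mulrC.
Qed.

(** Here right invariance, applied to [(1 ⊗ x) Delta(y f) (1 ⊗ g)], gives [psi(y f) psi(x g)]. *)
Lemma pair_rho_l f g (w e : dual_space Q) :
  tpair TP (dual_ev Q f) (dual_ev Q g) (rho_l Qd (w ⊠ e)) = dpair w e (gamma_r Q (f ⊠ g)).
Proof.
rewrite -(bisoVK G_r w) -(bisoVK G_r e); move: (biso_inv G_r w) (biso_inv G_r e) => a b.
have dG c : dual_fun (G_r c) = bcomp psi (ml c).
  by apply: bhomP => h; rewrite dual_funE G_rE.
rewrite dual_rho_l tpair_map /dpair !dG -tpair_mull.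
rewrite -[in RHS](bisoVK (rho_r Q) (a ⊠ b)).
move: (biso_inv _ _) => s.
have /(_ s) : bcomp (tpair TP (bcomp (dual_ev Q f) G_r) (bcomp (dual_ev Q g) G_r)) (tflip TP) =1
   bcomp (tpair TP psi psi) (bcomp (bbil_l (amul (talg TP Q Q)) (gamma_r Q (f ⊠ g))) (rho_r Q));
  last by [].
apply: tens_ext => x y.
change (tpair TP (bcomp (dual_ev Q f) G_r) (bcomp (dual_ev Q g) G_r) (tflip TP (x ⊠ y)) =
  tpair TP psi psi (rho_r Q (x ⊠ y) ∙ gamma_r Q (f ⊠ g))).
rewrite tflipE tpairE rho_rM comul_gamma_r tpair_l /legl2 slice_l_leg2 right_gamma_r //.
change ((dual_ev Q f (G_r y) : R[i]) * dual_ev Q g (G_r x) =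
  psi (x ∘ ((psi (y ∘ f) : R[i]) *: g))).
by rewrite !dual_evE !G_rE bbilZr linearZ.
Qed.

End DualQuantumGroup.

(** * The map to the bidual *)

Section BidualMap.
Context {R : realType} (TP : tensor_products R).
Implicit Types V W X : bornType R.
Local Notation "v ⊠ w" := (tens TP v w) (at level 40, left associativity).

Lemma biso_comp_ex V W X (f : biso V W) (g : biso W X) :
  exists h : biso V X, forall v, h v = g (f v).
Proof.
have K : cancel (bcomp g f) (bcomp (biso_inv f) (biso_inv g)).
  by move=> v; rewrite /= !bisoK.
have VK : cancel (bcomp (biso_inv f) (biso_inv g)) (bcomp g f).
  by move=> v; rewrite /= !bisoVK.
by exists (BIso K VK).
Qed.

Lemma tmap_mul V W (A : balg V) (B : balg W) (f : bhom V W) :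
  (forall x y, f (amul A x y) = amul B (f x) (f y)) ->
  forall x y, tmap TP f f (amul (talg TP A A) x y) =
    amul (talg TP B B) (tmap TP f f x) (tmap TP f f y).
Proof.
move=> fM x y.
have /(_ x) : bcomp (tmap TP f f) (bbil_l (amul (talg TP A A)) y) =1
  bcomp (bbil_l (amul (talg TP B B)) (tmap TP f f y)) (tmap TP f f); last by [].
apply: tens_ext => a b.
have /(_ y) : bcomp (tmap TP f f) (bbil_r (amul (talg TP A A)) (a ⊠ b)) =1
  bcomp (bbil_r (amul (talg TP B B)) (tmap TP f f (a ⊠ b))) (tmap TP f f); last by [].
apply: tens_ext => c d.
change (tmap TP f f (tmul TP A A (a ⊠ b) (c ⊠ d)) =
  tmul TP B B (tmap TP f f (a ⊠ b)) (tmap TP f f (c ⊠ d))).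
by rewrite !tmapE !tmulE tmapE !fM.
Qed.

Context (V : bornType R) (H : bqg TP V) (Hd : bqg TP (dual_space H))
  (Hdd : bqg TP (dual_space Hd)).
Hypotheses (dH : is_dual H Hd) (dHd : is_dual Hd Hdd).

Lemma bidual_ex : exists P : biso V (dual_space Hd), forall f w, P f w = w f.
Proof.
have [m1 [psi [G_r [eps [[pF pR GE eC] g1 r1 h1]]]]] := dH.
have [_ [psi' [G_r' [_ [[pF' pR' GE' _] _ _ _]]]]] := dHd.
have [S SE] := antipode_ex m1 pF pR GE eC h1.
have [F FE] := F_r_ex pF' pR' GE'.
have [SG SGE] := biso_comp_ex S G_r; have [P PE] := biso_comp_ex SG F.
by exists P => f w; rewrite PE SGE FE SE.
Qed.

Context (P : biso V (dual_space Hd)).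
Hypothesis PE : forall f w, P f w = w f.

(** Together with [dual_ev_P], this matches the pairing of the dual and the bidual with that of [H]
    and the dual, so that adjunctions can be composed. *)
Let dual_fun_P f : dual_fun (P f) = dual_ev H f.
Proof. by apply: bhomP => w; rewrite dual_funE dual_evE PE. Qed.

Let dual_ev_P w : bcomp (dual_ev Hd w) P = dual_fun w.
Proof. by apply: bhomP => f; rewrite dual_funE -PE -dual_evE. Qed.

(** The elements [(id ⊗ phi)((1 ⊗ b) Delta(k))] determine the product, since slicing after [rho_r]
    is onto [H]. On such an element [P] is the translate of [P k] by [F b], so [conv_gamma_r] for
    the dual computes the product in the bidual. *)
Lemma bidual_mul f g : P (amul H f g) = amul Hdd (P f) (P g).
Proof.
have [m1 [psi [G_r [eps [[pF pR GE eC] g1 r1 h1]]]]] := dH.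
have [m2 _] := dHd.
have [F FE] := F_r_ex pF pR GE.
have [y0 y1] := faithful_unit (haar_faithful H).
pose sl := bcomp (slice_r TP (haar H)) (rho_r H).
suff E w : bcomp (dual_fun w) (bcomp (bbil_r (amul H) f) sl) =1
    bcomp (dual_ev Hd w) (bcomp (bbil_r (amul Hdd) (P f)) (bcomp P sl)).
  apply: dualP => w; rewrite PE -dual_evE -dual_funE.
  have -> : g = sl (biso_inv (rho_r H) (g ⊠ y0)) by rewrite /= bisoVK slice_rE y1 scale1r.
  exact: E.
apply: tens_ext => b k.
have PF : P (sl (b ⊠ k)) = actl Hd (F b) (P k).
  by apply: dualP => e; rewrite actlE !PE (conv_F_r m1 GE FE).
change (dual_fun w (amul H f (sl (b ⊠ k))) = dual_ev Hd w (amul Hdd (P f) (P (sl (b ⊠ k))))).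
rewrite PF dual_evE (conv_gamma_r m2) /dpair !dual_fun_P (pair_gamma_r g1).
by rewrite -(conv_rho_l m1 GE) (conv_F_r m1 GE FE) (actrE GE) dual_funE.
Qed.

Lemma bidual_gamma_r f q : gamma_r Hdd (P f ⊠ P q) = tmap TP P P (gamma_r H (f ⊠ q)).
Proof.
have [m1 [psi [G_r [eps [[pF pR GE eC] g1 r1 h1]]]]] := dH.
have [m2 [_ [_ [_ [_ g2 _ _]]]]] := dHd.
apply: (tpair_sep (bqg_approx Hdd) (dual_ev_sep (Q := Hd)) (dual_ev_sep (Q := Hd))).
move=> _ _ [w _ <-] [e _ <-].
rewrite (pair_gamma_r g2) /dpair !dual_fun_P (pair_rho_l pR GE r1).
by rewrite tpair_map !dual_ev_P.
Qed.

Lemma bidual_rho_l q f : rho_l Hdd (P q ⊠ P f) = tmap TP P P (rho_l H (q ⊠ f)).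
Proof.
have [m1 [psi [G_r [eps [[pF pR GE eC] g1 r1 h1]]]]] := dH.
have [m2 [psi' [G_r' [_ [[_ pR' GE' _] _ r2 _]]]]] := dHd.
apply: (tpair_sep (bqg_approx Hdd) (dual_ev_sep (Q := Hd)) (dual_ev_sep (Q := Hd))).
move=> _ _ [w _ <-] [e _ <-].
rewrite (pair_rho_l pR' GE' r2) /dpair !dual_fun_P (pair_gamma_r g1).
by rewrite tpair_map !dual_ev_P.
Qed.

(** By [prod_ext] the second leg is a product [q b']; then [Delta(f) (1 ⊗ q)] is [gamma_r(f ⊗ q)],
    which [P] respects. *)
Lemma bidual_comulL f x :
  mulL (comul Hdd (P f)) (tmap TP P P x) = tmap TP P P (mulL (comul H f) x).
Proof.
have /(_ x) : bcomp (mulL (comul Hdd (P f))) (tmap TP P P) =1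
  bcomp (tmap TP P P) (mulL (comul H f)); last by [].
apply: tens_ext => a b.
have /(_ b) : bcomp (bcomp (mulL (comul Hdd (P f))) (tmap TP P P)) (bbil_r (tens TP) a) =1
  bcomp (bcomp (tmap TP P P) (mulL (comul H f))) (bbil_r (tens TP) a); last by [].
apply: (prod_ext (Q := H)) => q b'.
change (mulL (comul Hdd (P f)) (tmap TP P P (a ⊠ amul H q b')) =
  tmap TP P P (mulL (comul H f) (a ⊠ amul H q b'))).
have -> : a ⊠ amul H q b' = legl2 H q (a ⊠ b') by rewrite /legl2 tmapE.
rewrite -gamma_rM (tmap_mul bidual_mul) -bidual_gamma_r gamma_rM.
by rewrite /legl2 !tmapE /= bidual_mul.
Qed.

(** Here the first leg is a product [a' q], and [(q ⊗ 1) Delta(f)] is [rho_l(q ⊗ f)]. *)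
Lemma bidual_comulR f x :
  mulR (comul Hdd (P f)) (tmap TP P P x) = tmap TP P P (mulR (comul H f) x).
Proof.
have /(_ x) : bcomp (mulR (comul Hdd (P f))) (tmap TP P P) =1
  bcomp (tmap TP P P) (mulR (comul H f)); last by [].
apply: tens_ext => a b.
have /(_ a) : bcomp (bcomp (mulR (comul Hdd (P f))) (tmap TP P P)) (bbil_l (tens TP) b) =1
  bcomp (bcomp (tmap TP P P) (mulR (comul H f))) (bbil_l (tens TP) b); last by [].
apply: (prod_ext (Q := H)) => a' q.
change (mulR (comul Hdd (P f)) (tmap TP P P (amul H a' q ⊠ b)) =
  tmap TP P P (mulR (comul H f) (amul H a' q ⊠ b))).
have -> : amul H a' q ⊠ b = legr1 H q (a' ⊠ b) by rewrite /legr1 tmapE.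
rewrite -mul_rho_l (tmap_mul bidual_mul) -bidual_rho_l mul_rho_l.
by rewrite /legr1 !tmapE /= bidual_mul.
Qed.

End BidualMap.

Theorem theorem7p6 (R : realType) (TP : tensor_products R) (V : bornType R)
    (H : bqg TP V)
    (Hd : bqg TP (dual_space H)) (Hdd : bqg TP (dual_space Hd)) :
  is_dual H Hd -> is_dual Hd Hdd ->
  exists P : biso V (dual_space Hd),
    bqg_iso H Hdd P /\
    forall (f : V) (w : dual_space H), P f w = w f.
Proof.
move=> dH dHd; have [P PE] := bidual_ex dH dHd; exists P; split=> //; split.
- exact: bidual_mul PE.
- exact: bidual_comulL PE.
- exact: bidual_comulR PE.
Qed.
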